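(* Let $f:[a,b]\to\overline{\mathbb R}$ be distributionally integrable over $[a,b]$, with indefinite integral $F$ ($F(x)=(\mathfrak{dist})\int_a^xf(t)\,dt$ for $a\le x\le b$, $F(x)=0$ for $x<a$, $F(x)=F(b)$ for $x>b$). Let $\mathsf F$ be the Łojasiewicz distribution associated to the Łojasiewicz function $F$, $F\leftrightarrow\mathsf F$, and let $\mathsf f=\mathsf F'$ (distributional derivative). Then $\mathsf f$ has distributional point values almost everywhere and $$\mathsf f(x)=f(x)\quad\text{for almost every }x\in[a,b].$$
   Context: Distributions are real. Notation: $\overline{\mathbb R}=\mathbb R\cup\{-\infty,\infty\}$; $\mathcal E'[a,b]$ is the space of distributions on $\mathbb R$ with support contained in $[a,b]$; $\langle \mathsf g(x+ty),\phi(y)\rangle:=|t|^{-1}\langle \mathsf g(y),\phi((y-x)/t)\rangle$ for $t\ne0$. Point values. For $\mathsf g\in\mathcal D'(\mathbb R)$, the distributional (Łojasiewicz) point value $\mathsf g(x_0)$ exists and equals $\gamma\in\mathbb R$ if $\lim_{\varepsilon\to0}\langle \mathsf g(x_0+\varepsilon y),\phi(y)\rangle=\gamma\int_{-\infty}^\infty\phi(y)\,dy$ for every $\phi\in\mathcal D(\mathbb R)$. A Łojasiewicz distribution is one having a point value at every point of $\mathbb R$. A function $G:\mathbb R\to\mathbb R$ is a Łojasiewicz function if there is a (necessarily unique) Łojasiewicz distribution $\mathsf G$ with $\mathsf G(x)=G(x)$ for all $x\in\mathbb R$; write $G\leftrightarrow\mathsf G$. Test classes. $\mathcal T_0$: functions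 $\phi\in C^\infty(\mathbb R)$, $\phi\ge0$, $\int\phi=1$, such that for some $\alpha<-1$, $\phi^{(m)}(x)=O(|x|^{\alpha-m})$ as $|x|\to\infty$ for all $m\ge0$. $\mathcal T_1$: those $\phi\in\mathcal T_0$ with $x\phi'(x)\le0$ for all $x$. For $\mathsf g\in\mathcal E'(\mathbb R)$, $\phi\in\mathcal T_0$: $\mathsf g^{+}_{\phi,0}(x)=\limsup_{t\to0^+}\langle \mathsf g(x+ty),\phi(y)\rangle$ and $\mathsf g^{-}_{\phi,0}(x)=\liminf_{t\to0^+}\langle \mathsf g(x+ty),\phi(y)\rangle$. Integral. Let $f:[a,b]\to\overline{\mathbb R}$. A major distributional pair $(\mathsf u,\mathsf U)$ for $f$ consists of $\mathsf u\in\mathcal E'[a,b]$ and a Łojasiewicz distribution $\mathsf U$ with $\mathsf U'=\mathsf u$, $\mathsf U(a)=0$, such that there exist a countable set $E$ and a Lebesgue null set $Z$ with $\mathsf u^-_{\phi,0}(x)\ge f(x)$ for all $x\in[a,b]\setminus Z$, $\phi\in\mathcal T_0$, and $\mathsf u^-_{\phi,0}(x)>-\infty$ for all $x\in[a,b]\setminus E$, $\phi\in\mathcal T_1$. A minor distributional pair $(\mathsf v,\mathsf V)$ for $f$ consists of $\mathsf v\in\mathcal E'[a,b]$ and a Łojasiewicz distribution $\mathsf V$ with $\mathsf V'=\mathsf v$, $\mathsf V(a)=0$, such that there exist a countable set $E$ and a null set $Z$ with $\mathsf v^+_{\phi,0}(x)\le f(x)$ for all $x\in[a,b]\setminus Z$,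 $\phi\in\mathcal T_0$, and $\mathsf v^+_{\phi,0}(x)<\infty$ for all $x\in[a,b]\setminus E$, $\phi\in\mathcal T_1$. The function $f$ is distributionally integrable over $[a,b]$ if it has both major and minor pairs and $\sup\mathsf V(b)=\inf\mathsf U(b)$ (sup over minor pairs, inf over major pairs); the common value is $(\mathfrak{dist})\int_a^bf(x)\,dx$. A function distributionally integrable over $[a,b]$ is distributionally integrable over each subinterval, and its indefinite integral $F$ is a Łojasiewicz function. *)

(* Defs.v *)
From mathcomp Require Import all_boot all_order all_algebra.
From mathcomp Require Import all_classical all_reals all_analysis.
Set Implicit Arguments.
Unset Strict Implicit.
Unset Printing Implicit Defensive.
Import Order.TTheory GRing.Theory Num.Theory.
Import numFieldNormedType.Exports.
Local Open Scope classical_set_scope.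
Local Open Scope ring_scope.

Definition smooth (R : realType) (phi : R -> R) : Prop :=
  forall (n : nat) (x : R), derivable (derive1n n phi) x 1.

Definition fsupport (R : realType) (phi : R -> R) : set R :=
  closure [set x | phi x != 0].

Definition test_function (R : realType) (phi : R -> R) : Prop :=
  smooth phi /\ compact (fsupport phi).

(* An element of D'(R). The underlying map is total on R -> R, but its values
   outside of the test functions carry no information: two distributions are
   to be considered equal when they satisfy [eq_sdistr] below. *)
Record sdistr (R : realType) := SDistr {
  spair :> (R -> R) -> R ;
  spair_linear : forall (c : R) (phi psi : R -> R),
    test_function phi -> test_function psi ->
    spair (fun x => c * phi x + psi x) = c * spair phi + spair psi ;
  spair_continuous : forall K : set R, compact K ->
    exists (C : R) (N : nat), forall (phi : R -> R) (B : R),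
      test_function phi -> fsupport phi `<=` K ->
      (forall (m : nat) (x : R), (m <= N)%N -> `|derive1n m phi x| <= B) ->
      `|spair phi| <= C * B }.

Definition eq_sdistr (R : realType) (g h : sdistr R) : Prop :=
  forall phi : R -> R, test_function phi -> g phi = h phi.

Section derivative.
Variable R : realType.

Lemma smooth_derive1 (phi : R -> R) : smooth phi -> smooth (derive1 phi).
Proof. by move=> sphi n x; move: (sphi n.+1 x); rewrite /derive1n iterSr. Qed.

Lemma fsupport_derive1 (phi : R -> R) :
  fsupport (derive1 phi) `<=` fsupport phi.
Proof.
have cl : closed (fsupport phi) by exact: closed_closure.
have /closureS : [set x | derive1 phi x != 0] `<=` fsupport phi.
  move=> y /= dy; apply: contrapT => ny.
  move/negP: dy; apply; apply/eqP.
  have near0 : {near y, phi =1 cst 0}.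
    have : nbhs y (~` fsupport phi).
      by apply: open_nbhs_nbhs; split; [exact: closed_openC|].
    apply: filterS => z nz; apply: contrapT => /eqP pz.
    by apply: nz; exact: subset_closure.
  rewrite derive1E (near_eq_derive _ near0) ?oner_neq0//.
  by rewrite -derive1E derive1_cst.
by rewrite -((closure_id _).1 cl).
Qed.

Lemma test_function_derive1 (phi : R -> R) :
  test_function phi -> test_function (derive1 phi).
Proof.
move=> [sphi cphi]; split; first exact: smooth_derive1.
by apply: subclosed_compact cphi _; [exact: closed_closure|exact: fsupport_derive1].
Qed.

Variable g : sdistr R.

Let dpair (phi : R -> R) : R := - g (derive1 phi).

Let dpair_linear (c : R) (phi psi : R -> R) :
  test_function phi -> test_function psi ->
  dpair (fun x => c * phi x + psi x) = c * dpair phi + dpair psi.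
Proof.
move=> tphi tpsi; rewrite /dpair.
have -> : derive1 (fun x => c * phi x + psi x)
        = (fun x => c * derive1 phi x + derive1 psi x).
  apply/funext => x; have dphi := tphi.1 0%N x; have dpsi := tpsi.1 0%N x.
  rewrite !derive1E.
  have -> : (fun x => c * phi x + psi x) = (c *: phi) + psi by [].
  by rewrite deriveD// ?deriveZ//; exact: derivableZ.
rewrite spair_linear; [|exact: test_function_derive1..].
by rewrite opprD mulrN.
Qed.

Let dpair_continuous (K : set R) : compact K ->
  exists (C : R) (N : nat), forall (phi : R -> R) (B : R),
    test_function phi -> fsupport phi `<=` K ->
    (forall (m : nat) (x : R), (m <= N)%N -> `|derive1n m phi x| <= B) ->
    `|dpair phi| <= C * B.
Proof.
move=> /(spair_continuous g)[C [N gN]]; exists C, N.+1 => phi B tphi phiK phiB.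
rewrite /dpair normrN; apply: gN; first exact: test_function_derive1.
- exact: subset_trans (@fsupport_derive1 phi) phiK.
- by move=> m x mN; have := phiB m.+1 x mN; rewrite /derive1n iterSr.
Qed.

Definition dderiv : sdistr R := SDistr dpair_linear dpair_continuous.

End derivative.

(* <g(x + t y), phi(y)>, for t != 0. *)
Definition dilate (R : realType) (phi : R -> R) (x t : R) : R -> R :=
  fun y => `|t|^-1 * phi ((y - x) / t).

Definition point_value (R : realType) (g : sdistr R) (x gamma : R) : Prop :=
  forall phi : R -> R, test_function phi ->
    g (dilate phi x eps) @[eps --> 0^'] -->
    gamma * \int[lebesgue_measure]_y phi y.

Definition lojasiewicz_distr (R : realType) (g : sdistr R) : Prop :=
  forall x : R, exists gamma : R, point_value g x gamma.

(* G <-> g. *)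
Definition lojasiewicz_assoc (R : realType) (G : R -> R) (g : sdistr R) :
  Prop := forall x : R, point_value g x (G x).

Definition supported_in (R : realType) (g : sdistr R) (K : set R) : Prop :=
  forall phi : R -> R, test_function phi -> fsupport phi `&` K = set0 ->
    g phi = 0.

(* <g, psi> for g with compact support and psi smooth, not necessarily with
   compact support: g (chi psi) for any test function chi that is equal to 1
   on a neighbourhood of a compact set supporting g. The result does not
   depend on the choice of this set and of chi. *)
Definition cpair (R : realType) (g : sdistr R) (psi : R -> R) : R :=
  get [set r : R | exists (K O : set R) (chi : R -> R),
    [/\ compact K, supported_in g K, open O, K `<=` O &
        [/\ test_function chi, (forall x, O x -> chi x = 1) &
            r = g (fun x => chi x * psi x)]]].

Definition T0 (R : realType) (phi : R -> R) : Prop :=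
  [/\ smooth phi, (forall x, 0 <= phi x),
      \int[lebesgue_measure]_x phi x = 1 &
      exists2 alpha : R, alpha < -1 &
        forall m : nat, exists C M : R, forall x : R, M <= `|x| ->
          `|derive1n m phi x| <= C * `|x| `^ (alpha - m%:R)].

Definition T1 (R : realType) (phi : R -> R) : Prop :=
  T0 phi /\ forall x : R, x * derive1 phi x <= 0.

Definition upper_value (R : realType) (g : sdistr R) (phi : R -> R) (x : R) :
  \bar R := limf_esup (fun t : R => (cpair g (dilate phi x t))%:E) 0^'+.

Definition lower_value (R : realType) (g : sdistr R) (phi : R -> R) (x : R) :
  \bar R := limf_einf (fun t : R => (cpair g (dilate phi x t))%:E) 0^'+.

Definition major_pair (R : realType) (a b : R) (f : R -> \bar R)
    (u U : sdistr R) : Prop :=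
  [/\ supported_in u `[a, b], lojasiewicz_distr U, eq_sdistr (dderiv U) u,
      point_value U a 0 &
      exists E Z : set R,
        [/\ countable E, lebesgue_measure.-negligible Z,
            (forall x phi, x \in `[a, b] -> ~ Z x -> T0 phi ->
               (f x <= lower_value u phi x)%E) &
            (forall x phi, x \in `[a, b] -> ~ E x -> T1 phi ->
               (-oo < lower_value u phi x)%E)]].

Definition minor_pair (R : realType) (a b : R) (f : R -> \bar R)
    (v V : sdistr R) : Prop :=
  [/\ supported_in v `[a, b], lojasiewicz_distr V, eq_sdistr (dderiv V) v,
      point_value V a 0 &
      exists E Z : set R,
        [/\ countable E, lebesgue_measure.-negligible Z,
            (forall x phi, x \in `[a, b] -> ~ Z x -> T0 phi ->
               (upper_value v phi x <= f x)%E) &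
            (forall x phi, x \in `[a, b] -> ~ E x -> T1 phi ->
               (upper_value v phi x < +oo)%E)]].

Definition major_values (R : realType) (a b : R) (f : R -> \bar R) :
  set (\bar R) :=
  [set c%:E | c in [set c : R |
     exists u U, major_pair a b f u U /\ point_value U b c]].

Definition minor_values (R : realType) (a b : R) (f : R -> \bar R) :
  set (\bar R) :=
  [set c%:E | c in [set c : R |
     exists v V, minor_pair a b f v V /\ point_value V b c]].

Definition dist_integrable (R : realType) (a b : R) (f : R -> \bar R) : Prop :=
  [/\ exists u U, major_pair a b f u U,
      exists v V, minor_pair a b f v V &
      ereal_sup (minor_values a b f) = ereal_inf (major_values a b f)].

(* Meaningful when [dist_integrable a b f]; then the infimum is finite. *)
Definition dist_integral (R : realType) (a b : R) (f : R -> \bar R) : R :=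
  fine (ereal_inf (major_values a b f)).

Definition indefinite_integral (R : realType) (a b : R) (f : R -> \bar R)
    (x : R) : R :=
  if x < a then 0
  else if x <= b then dist_integral a x f
  else dist_integral a b f.

(* Main.v *)
Require Import Defs.
From mathcomp Require Import all_boot all_order all_algebra.
From mathcomp Require Import all_classical all_reals all_analysis.
From mathcomp Require Import measurable_realfun.
From mathcomp Require Import ring lra.
Set Implicit Arguments.
Unset Strict Implicit.
Unset Printing Implicit Defensive.
Import Order.TTheory GRing.Theory Num.Theory.
Import numFieldNormedType.Exports.
Local Open Scope classical_set_scope.
Local Open Scope ring_scope.

(* The core is a positivity theorem. Let H(x, t) be the pairing of a distribution
   w with t^-1 exp(- ((. - x) / t)^2); it solves H_t = (t / 2) H_xx. Suppose that
   w (psi ((. - c) / t)) -> 0 as t -> 0 for all c and psi, that H (x, .) is bounded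
   below near 0 for x outside of a countable set, and that its lower limit at 0
   is nonnegative for almost every x. Then w >= 0. Indeed, let P be the set of
   points without a neighbourhood on which w >= 0. It is perfect, and by Baire
   H >= - n on a portion of P for small t. The maximum principle, with barriers
   at the end points of the gaps of P, extends this bound to the gaps, and
   Fatou's lemma gives w >= 0 around a point of P; so P is empty.

   For a major pair (u, U) and a minor pair (v, V) this yields u - v >= 0, so
   U - V is nondecreasing. Restricting pairs to [a, c] gives V <= F <= U at every
   point, hence u - F' >= 0 and F' - v >= 0, and these measures have mass at most
   4^-n for suitable u_n and v_n. By the weak type inequality and Borel-Cantelli,
   for almost every x and n large they give mass at most 2^-n r to the ball of
   radius r <= 1 at x. So the dilates of F' at x are squeezed between those of v_n
   and u_n, whose upper and lower values enclose f x. *)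

(** * Smooth functions *)

(** The smallness of [w] at every point admits no exceptions: minus a Dirac mass at 0 meets the
    other two conditions, with 0 as the countable exceptional set. For [u - v] it holds because
    [U - V] has point values and the derivative of a test function has integral zero; it is what
    makes the bad set perfect. The Gaussian is used because it lies in [T1], so that both conditions
    on a pair apply to it, and because its dilates solve a heat equation. In a gap of the bad set
    the lateral sides are controlled but the corners are not: as t tends to 0 a corner contributes
    up to t^-1 times a Gaussian tail. Banach-Steinhaus makes this bound uniform in t, and a barrier
    X t^-p exp(- k X^2 / t^2) absorbs it, X being the distance to the corner shifted by the initial
    time s. It is a supersolution if k <= 1 and p <= 3 k, it dominates the corner term if k < 1, and
    the required multiple s^(p - 2) vanishes with s if p > 2. So k must lie between 2/3 and 1; k =
    5/6 and p = 5/2 are used. *)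

Section calculus.
Variable R : realType.
Implicit Types (f g : R -> R) (x y a c : R) (m n N : nat).

Lemma is_derive_derive1 f g : (forall x, is_derive x 1 f (g x)) -> derive1 f = g.
Proof. by move=> fg; apply/funext => x; rewrite derive1E; exact: derive_val. Qed.

Lemma derivable_is_derive1 f x : derivable f x 1 -> is_derive x 1 f (derive1 f x).
Proof. by move=> df; rewrite derive1E; exact: DeriveDef. Qed.

(** Derivatives are peeled off from the inside, so that an induction on [n] over arbitrary functions
    covers sums, products and compositions without formulas for higher derivatives. *)
Fixpoint ndiff n f : Prop :=
  if n is n'.+1 then (forall x, derivable f x 1) /\ ndiff n' (derive1 f)
  else True.

Lemma ndiff_is_derive n f g : (forall x, is_derive x 1 f (g x)) -> ndiff n g ->
  ndiff n.+1 f.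
Proof.
move=> fg ng; split; first by move=> x; have [] := fg x.
by rewrite (is_derive_derive1 fg).
Qed.

Lemma ndiffW n f : ndiff n.+1 f -> ndiff n f.
Proof.
by elim: n f => [//|n IH] f [df nf]; split => //; exact: IH.
Qed.

Lemma smoothP f : smooth f <-> forall n, ndiff n f.
Proof.
split=> [sf n|nf n].
  elim: n f sf => [//|n IH] f sf; split; first by move=> x; exact: (sf 0%N).
  by apply: IH; exact: smooth_derive1.
elim: n f nf => [|n IH] f nf; first by have [] := nf 1%N.
move=> x; rewrite /derive1n iterSr; apply: IH => m.
by have [] := nf m.+1.
Qed.

Lemma ndiffS_is_derive n f x : ndiff n.+1 f -> is_derive x 1 f (derive1 f x).
Proof. by move=> [df _]; exact: derivable_is_derive1. Qed.

Lemma ndiff_cst n c : ndiff n (cst c).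
Proof.
elim: n c => // n IH c; split => [x|]; first exact: derivable_cst.
by rewrite (_ : derive1 _ = cst 0)//; apply/funext => x; rewrite derive1_cst.
Qed.

Lemma ndiff_id n : ndiff n (@id R).
Proof.
case: n => // n; apply: (@ndiff_is_derive _ _ (cst 1)).
exact: ndiff_cst.
Qed.

Lemma ndiffD n f g : ndiff n f -> ndiff n g -> ndiff n (fun x => f x + g x).
Proof.
elim: n f g => // n IH f g nf ng.
apply: (@ndiff_is_derive _ _ (fun x => derive1 f x + derive1 g x)).
  move=> x.
  exact: (is_deriveD (ndiffS_is_derive x nf) (ndiffS_is_derive x ng)).
by apply: IH; [case: nf|case: ng].
Qed.

Lemma ndiffM n f g : ndiff n f -> ndiff n g -> ndiff n (fun x => f x * g x).
Proof.
elim: n f g => // n IH f g nf ng.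
apply: (@ndiff_is_derive n (fun x => f x * g x) (fun x => derive1 f x * g x + f x * derive1 g x)) => [x|].
  have := @is_deriveM _ _ f g x 1 _ _ (ndiffS_is_derive x nf) (ndiffS_is_derive x ng).
  by move=> H; apply: is_derive_eq; rewrite addrC /GRing.scale/= mulrC.
by apply: ndiffD; apply: IH; [case: nf|exact: ndiffW|exact: ndiffW|case: ng].
Qed.

Lemma ndiff_comp n f g : ndiff n f -> ndiff n g -> ndiff n (fun x => f (g x)).
Proof.
elim: n f g => // n IH f g nf ng.
apply: (@ndiff_is_derive n (fun x => f (g x)) (fun x => derive1 f (g x) * derive1 g x)) => [x|].
  exact: (is_derive1_comp (ndiffS_is_derive (g x) nf) (ndiffS_is_derive x ng)).
by apply: ndiffM; [apply: IH; [case: nf|exact: ndiffW]|case: ng].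
Qed.

Lemma ndiffV n f : (forall x, f x != 0) -> ndiff n f -> ndiff n (fun x => (f x)^-1).
Proof.
move=> f0; elim: n => // n IH nf.
apply: (@ndiff_is_derive _ _ (fun x => (-1 * ((f x)^-1 * (f x)^-1)) * derive1 f x)).
  move=> x.
  have := @is_deriveV _ f x _ 1 (f0 x) (ndiffS_is_derive x nf).
  move=> H; apply: is_derive_eq; rewrite /GRing.scale/=.
  by rewrite expr2 mulN1r invfM.
apply: ndiffM; last by case: nf.
apply: ndiffM; first exact: ndiff_cst.
by apply: ndiffM; apply: IH; exact: ndiffW.
Qed.

Lemma ndiff_expR n : ndiff n (@expR R).
Proof.
by elim: n => // n IH; apply: (@ndiff_is_derive _ _ expR).
Qed.

Lemma smooth_cst c : smooth (cst c : R -> R).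
Proof. by apply/smoothP => n; exact: ndiff_cst. Qed.

Lemma smoothD f g : smooth f -> smooth g -> smooth (fun x => f x + g x).
Proof. by move=> /smoothP sf /smoothP sg; apply/smoothP => n; exact: ndiffD. Qed.

Lemma smoothM f g : smooth f -> smooth g -> smooth (fun x => f x * g x).
Proof. by move=> /smoothP sf /smoothP sg; apply/smoothP => n; exact: ndiffM. Qed.

Lemma smooth_comp f g : smooth f -> smooth g -> smooth (fun x => f (g x)).
Proof. by move=> /smoothP sf /smoothP sg; apply/smoothP => n; exact: ndiff_comp. Qed.

Lemma smoothZ c f : smooth f -> smooth (fun x => c * f x).
Proof. by move=> sf; exact: (smoothM (@smooth_cst c) sf). Qed.

Lemma smoothB f g : smooth f -> smooth g -> smooth (fun x => f x - g x).
Proof.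
move=> sf sg; have := smoothD sf (@smoothZ (-1) g sg).
by congr smooth; apply/funext => x; rewrite mulN1r.
Qed.

Lemma smooth_id : smooth (@id R).
Proof. by apply/smoothP => n; exact: ndiff_id. Qed.

Lemma smooth_affine a c : smooth (fun x : R => a * x + c).
Proof.
apply: smoothD; last exact: smooth_cst.
by apply: smoothZ; exact: smooth_id.
Qed.

Lemma smooth_compZ f a c : smooth f -> smooth (fun x => f (a * x + c)).
Proof. by move=> sf; apply: (smooth_comp sf); exact: smooth_affine. Qed.

Lemma smooth_dil f c (t : R) : smooth f -> smooth (fun x => f ((x - c) / t)).
Proof.
move=> /(@smooth_compZ f t^-1 (- c / t)); congr smooth.
by apply/funext => x; congr f; rewrite mulrBl mulNr mulrC.
Qed.

Lemma smooth_derive1n f m : smooth f -> smooth (derive1n m f).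
Proof. by move=> sf n x; rewrite /derive1n -iterD; exact: sf. Qed.

Lemma smooth_is_derive f m x : smooth f ->
  is_derive x 1 (derive1n m f) (derive1n m.+1 f x).
Proof. by move=> sf; apply: derivable_is_derive1; exact: sf. Qed.

Lemma smooth_is_derive0 f x : smooth f -> is_derive x 1 f (derive1 f x).
Proof. by move=> sf; exact: (smooth_is_derive 0). Qed.

Lemma derivable_cont f x : derivable f x 1 -> {for x, continuous f}.
Proof. by move=> ?; apply/differentiable_continuous/derivable1_diffP. Qed.

Lemma smooth_continuous f : smooth f -> continuous f.
Proof. by move=> sf x; apply: derivable_cont; exact: (sf 0%N). Qed.

Lemma derive1nSr f m x : derive1n m.+1 f x = derive1n m (derive1 f) x.
Proof. by rewrite /derive1n iterSr. Qed.

Lemma derive1n_linear c f g m : smooth f -> smooth g ->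
  derive1n m (fun x => c * f x + g x) = (fun x => c * derive1n m f x + derive1n m g x).
Proof.
move=> sf sg; elim: m => // m IH.
rewrite /= IH; apply: is_derive_derive1 => x.
have H1 := smooth_is_derive m x sf; have H2 := smooth_is_derive m x sg.
have := @is_deriveD _ _ _ _ _ x 1 _ _ (@is_deriveZ _ _ _ _ c x 1 _ H1) H2.
by [].
Qed.

Lemma derive1n_cst m c x : derive1n m (cst c : R -> R) x = if m is 0%N then c else 0.
Proof.
have E : derive1 (cst c : R -> R) = cst 0 by apply/funext => y; rewrite derive1_cst.
case: m => // m; rewrite derive1nSr E; elim: m => // m IH.
rewrite derive1nSr (_ : derive1 _ = cst 0) //.
by apply/funext => y; rewrite derive1_cst.
Qed.

Lemma derive1nZ c f m : smooth f ->
  derive1n m (fun x => c * f x) = (fun x => c * derive1n m f x).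
Proof.
move=> sf; have := @derive1n_linear c _ _ m sf (@smooth_cst 0).
rewrite (_ : (fun x => _ + cst 0 x) = (fun x => c * f x)); last first.
  by apply/funext => x; rewrite /= addr0.
move=> ->; apply/funext => x; by rewrite derive1n_cst; case: m => [|m] /=; rewrite addr0.
Qed.

Lemma derive1nD f g m : smooth f -> smooth g ->
  derive1n m (fun x => f x + g x) = (fun x => derive1n m f x + derive1n m g x).
Proof.
move=> sf sg; have := @derive1n_linear 1 _ _ m sf sg.
have -> : (fun x => 1 * f x + g x) = (fun x => f x + g x).
  by apply/funext => x; rewrite mul1r.
by move=> ->; apply/funext => x; rewrite mul1r.
Qed.

Lemma derive1nB f g m : smooth f -> smooth g ->
  derive1n m (fun x => f x - g x) = (fun x => derive1n m f x - derive1n m g x).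
Proof.
move=> sf sg; have := @derive1n_linear (-1) _ _ m sg sf.
have -> : (fun x => -1 * g x + f x) = (fun x => f x - g x).
  by apply/funext => x; rewrite mulN1r addrC.
by move=> ->; apply/funext => x; rewrite mulN1r addrC.
Qed.

Lemma derive1M f g x : smooth f -> smooth g ->
  derive1 (fun x => f x * g x) x = derive1 f x * g x + f x * derive1 g x.
Proof.
move=> sf sg.
have := @is_deriveM _ _ f g x 1 _ _ (smooth_is_derive0 x sf) (smooth_is_derive0 x sg).
move=> H; rewrite derive1E (@derive_val _ _ _ _ _ _ _ H) addrC.
by rewrite /GRing.scale/= mulrC [X in _ + X = _]mulrC mulrC [X in _ + X = _]mulrC.
Qed.

Lemma derive1n_comp_affine f a c m : smooth f ->
  derive1n m (fun x => f (a * x + c)) = (fun x => a ^+ m * derive1n m f (a * x + c)).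
Proof.
move=> sf; elim: m => [|m IH].
  by apply/funext => x; rewrite expr0 mul1r.
rewrite derive1nS IH; apply: is_derive_derive1 => x.
have H1 := smooth_is_derive m (a * x + c) sf.
have H2 : is_derive x (1 : R) (fun x => a * x + c) a.
  have := @is_deriveD _ _ _ _ _ x 1 _ _ (@is_deriveZ _ _ _ _ a x 1 _ (is_derive_id x 1))
     (is_derive_cst c x 1).
  by rewrite addr0 /GRing.scale/= mulr1.
have := @is_deriveZ _ _ _ _ (a ^+ m) x 1 _ (@is_derive1_comp _ _ _ x _ _ H1 H2).
move=> H; apply: is_derive_eq; rewrite /GRing.scale/= exprSr -derive1nS; ring.
Qed.

Lemma derive1n_dil f c (t : R) m : smooth f ->
  derive1n m (fun x => f ((x - c) / t)) =
  (fun x => (t ^+ m)^-1 * derive1n m f ((x - c) / t)).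
Proof.
move=> sf.
have E x : (x - c) / t = t^-1 * x + (- c / t) by rewrite mulrBl mulNr mulrC.
rewrite (_ : (fun x => f _) = (fun x => f (t^-1 * x + (- c / t)))); last first.
  by apply/funext => x; rewrite E.
by rewrite derive1n_comp_affine//; apply/funext => x; rewrite -exprVn E.
Qed.

(** Each differentiation of the product doubles the number of terms, whence [2 ^+ m]. The geometric
    form of the bounds lets the induction replace [A] by [A * l] when [f] is differentiated, and
    likewise [B]. *)
Lemma leibniz_bound N f g x (A B l : R) : smooth f -> smooth g ->
  0 <= A -> 0 <= B -> 0 <= l ->
  (forall m, (m <= N)%N -> `|derive1n m f x| <= A * l ^+ m) ->
  (forall m, (m <= N)%N -> `|derive1n m g x| <= B * l ^+ m) ->
  forall m, (m <= N)%N ->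
    `|derive1n m (fun x => f x * g x) x| <= 2 ^+ m * (A * B) * l ^+ m.
Proof.
move=> sf sg A0 B0 l0.
elim: N f g A B sf sg A0 B0 => [|N IH] f g A B sf sg A0 B0 fA gB m.
  rewrite leqn0 => /eqP ->; rewrite expr0 mul1r mulr1 /= normrM.
  have := fA 0%N isT; have := gB 0%N isT; rewrite /= !expr0 !mulr1 => ? ?.
  exact: ler_pM.
case: m => [|m] mN.
  rewrite expr0 mul1r mulr1 /= normrM.
  have := fA 0%N isT; have := gB 0%N isT; rewrite /= !expr0 !mulr1 => ? ?.
  exact: ler_pM.
have sf' := smooth_derive1 sf; have sg' := smooth_derive1 sg.
rewrite derive1nSr (_ : derive1 _ = fun x => derive1 f x * g x + f x * derive1 g x); last first.
  by apply/funext => y; rewrite derive1M.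
rewrite derive1nD; [|exact: smoothM..].
apply: (le_trans (ler_normD _ _)).
have H1 := @IH (derive1 f) g (A * l) B sf' sg (mulr_ge0 A0 l0) B0.
have H2 := @IH f (derive1 g) A (B * l) sf sg' A0 (mulr_ge0 B0 l0).
apply: (le_trans (lerD (H1 _ _ m mN) (H2 _ _ m mN))).
- by move=> k kN; have := fA k.+1 kN; rewrite derive1nSr exprS mulrA.
- by move=> k kN; apply: gB; exact: leqW.
- by move=> k kN; apply: fA; exact: leqW.
- by move=> k kN; have := gB k.+1 kN; rewrite derive1nSr exprS mulrA.
by rewrite le_eqVlt; apply/orP; left; apply/eqP; rewrite !exprS; ring.
Qed.

Lemma MVT_bound f g (B a b : R) : a <= b ->
  (forall x, a <= x <= b -> is_derive x 1 f (g x)) ->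
  (forall x, a <= x <= b -> `|g x| <= B) -> `|f b - f a| <= B * (b - a).
Proof.
move=> ab fg gB.
have [->|abn] := eqVneq a b; first by rewrite !subrr normr0 mulr0.
have ltab : a < b by rewrite lt_neqAle abn.
have [||c] := @MVT_segment R f g a b ab.
- move=> x; rewrite in_itv/= => /andP[ax xb]; apply: fg.
  by rewrite !ltW.
- apply: derivable_within_continuous => x; rewrite in_itv/= => xab.
  by have [] := fg x xab.
rewrite in_itv/= => cab ->.
rewrite normrM [X in _ * X]ger0_norm ?subr_ge0//.
by apply: ler_wpM2r; rewrite ?subr_ge0//; exact: gB.
Qed.

End calculus.

(** * Flat functions, bumps and the Gaussian *)

Section bumps.
Variable R : realType.
Implicit Types (f g : R -> R) (x y a c : R) (m n k N : nat).

(** A quadratic remainder bound passes to limits, integrals and pairings with a distribution, where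
    mere differentiability would not; this is how derivatives of such objects are found below. *)
Lemma is_derive_quadratic f x0 (l r C : R) : 0 < r ->
  (forall h, `|h| <= r -> `|f (x0 + h) - f x0 - l * h| <= C * h ^+ 2) ->
  is_derive x0 1 f l.
Proof.
move=> r0 H.
have cv : h^-1 *: ((f \o shift x0) (h *: (1 : R)) - f x0) @[h --> 0^'] --> l.
  apply/cvgrPdist_le => e e0.
  have C1 : 0 < `|C| + 1 by rewrite ltr_wpDl.
  near=> h.
  have h0 : h != 0 by near: h; exact: nbhs_dnbhs_neq.
  have hr : `|h| <= r by near: h; exact: dnbhs0_le.
  have he : `|h| <= e / (`|C| + 1) by near: h; apply: dnbhs0_le; exact: divr_gt0.
  rewrite /= /GRing.scale/= mulr1 (addrC h).
  have -> : l - h^-1 * (f (x0 + h) - f x0) = - (h^-1 * (f (x0 + h) - f x0 - l * h)).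
    by field.
  rewrite normrN normrM normfV ler_pdivrMl ?normr_gt0//.
  apply: (le_trans (H h hr)).
  rewrite -(ger0_norm (sqr_ge0 h)) normrX expr2 mulrA mulrC.
  apply: ler_wpM2l => //.
  move: he; rewrite ler_pdivlMr// => /(le_trans _); apply.
  rewrite mulrC ler_wpM2l//.
  by rewrite (le_trans (ler_norm _))// lerDl.
apply: DeriveDef; first by apply/cvg_ex; exists l.
by apply: cvg_lim.
Unshelve. all: by end_near. Qed.

Lemma is_derive_ge0 f x (l : R) : {homo f : x y / x <= y} -> is_derive x 1 f l -> 0 <= l.
Proof.
move=> fm [df <-]; apply: limr_ge => //; near=> h => /=.
rewrite /GRing.scale/= mulr1.
have [h0|h0] := leP 0 h.
  by rewrite mulr_ge0 ?invr_ge0// subr_ge0 fm// lerDr.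
by apply: mulr_le0; rewrite ?invr_le0 ?(ltW h0)// subr_le0 fm// gerDr ltW.
Unshelve. all: by end_near. Qed.

(** With [y = x / k], the inequality [y <= expR y] is raised to the power [k]. *)
Lemma expR_ge_pow k x : 0 <= x -> x ^+ k <= k%:R ^+ k * expR x.
Proof.
move=> x0; case: k => [|k]; first by rewrite !expr0 mul1r -expR0 ler_expR.
have k0 : 0 < k.+1%:R :> R by [].
have -> : x = k.+1%:R * (x / k.+1%:R) by rewrite mulrC divfK// gt_eqF.
set y := x / _; have y0 : 0 <= y by rewrite divr_ge0.
rewrite exprMn ler_wpM2l ?exprn_ge0//.
rewrite mulrC expRM_natr lerXn2r ?nnegrE ?expR_ge0//.
by rewrite (le_trans _ (expR_ge1Dx y))// lerDr.
Qed.

(** The powers of [x^-1] in front of the flat exponential make the family closed under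
    differentiation, so that smoothness is one induction over all [k]. *)
Definition flat_fun k x : R := if 0 < x then x^-1 ^+ k * expR (- x^-1) else 0.

Lemma flat_fun_bound k x : 0 <= flat_fun k x <= k.+2%:R ^+ k.+2 * x ^+ 2.
Proof.
rewrite /flat_fun; case: ifPn => x0; last by rewrite lexx mulr_ge0 ?sqr_ge0// exprn_ge0.
rewrite mulr_ge0 ?exprn_ge0 ?invr_ge0 ?(ltW x0) ?expR_ge0//=.
have := @expR_ge_pow k.+2 x^-1 (ltW _); rewrite invr_gt0 => /(_ x0) H.
rewrite expRN ler_pdivrMr ?expR_gt0//.
rewrite -mulrA (mulrC (x ^+ 2)) mulrA.
rewrite -ler_pdivrMr ?exprn_gt0//.
by rewrite -exprVn -exprD addn2.
Qed.

Lemma flat_fun_derive k x :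
  is_derive x 1 (flat_fun k) (- k%:R * flat_fun k.+1 x + flat_fun k.+2 x).
Proof.
have [x0|x0|->] := ltgtP x 0.
- have -> : - k%:R * flat_fun k.+1 x + flat_fun k.+2 x = 0.
    by rewrite /flat_fun ltNge ltW//= mulr0 addr0.
  apply: (near_eq_is_derive _ (is_derive_cst (0 : R) x 1)).
  near=> y; rewrite /flat_fun ltNge ltW//=; near: y; exact: lt_nbhsl.
- have D : is_derive x 1 (fun x => x^-1 ^+ k * expR (- x^-1))
     (- k%:R * flat_fun k.+1 x + flat_fun k.+2 x).
    have xn : x != 0 by rewrite gt_eqF.
    have H1 := @is_deriveV R id x 1 1 xn (is_derive_id x 1).
    have H2 := is_deriveX k H1.
    have H3 := @is_derive1_comp R expR (fun y : R => - y^-1) x _ _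
       (is_derive_expR (- x^-1)) (is_deriveN H1).
    have H := is_deriveM H2 H3.
    rewrite (_ : (fun x => _) = (fun y : R => y^-1) ^+ k * (expR \o (fun y : R => - y^-1))); last first.
      by apply/funext => y; rewrite !fctE.
    apply: (is_derive_eq H); rewrite /flat_fun x0 /GRing.scale/= fctE.
    case: (k) => [|j] /=.
      by rewrite -!exprVn; ring.
    rewrite -!exprVn; move: (x^-1) (expR _) => y e; rewrite !exprS; ring.
  apply: near_eq_is_derive D.
  near=> y; rewrite /flat_fun ifT//; near: y; exact: lt_nbhsr.
- have -> : - k%:R * flat_fun k.+1 0 + flat_fun k.+2 0 = 0 :> R.
    by rewrite /flat_fun ltxx mulr0 addr0.
  (* At the origin the function is itself dominated by a multiple of [h ^+ 2], so its derivative
     there is 0. *)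
  apply: (@is_derive_quadratic _ _ _ 1 (k.+2%:R ^+ k.+2)) => // h _.
  rewrite add0r mul0r subr0 {2}/flat_fun ltxx subr0.
  by have /andP[? ?] := flat_fun_bound k h; rewrite ger0_norm.
Unshelve. all: by end_near. Qed.

Lemma smooth_flat_fun k : smooth (flat_fun k).
Proof.
apply/smoothP => n; elim: n k => // n IH k.
apply: (ndiff_is_derive (flat_fun_derive k)).
apply: ndiffD; last exact: IH.
by apply: ndiffM; [exact: ndiff_cst|exact: IH].
Qed.

Lemma flat_fun_homo : {homo flat_fun 0 : x y / x <= y}.
Proof.
move=> x y xy; rewrite /flat_fun !expr0 !mul1r; case: ifPn => x0; last first.
  by case: ifPn => // _; exact: expR_ge0.
by rewrite (lt_le_trans x0 xy) ler_expR lerN2 lef_pV2 ?posrE// (lt_le_trans x0).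
Qed.

Lemma flat_fun_gt0 x : 0 < x -> 0 < flat_fun 0 x.
Proof. by rewrite /flat_fun expr0 mul1r => ->; exact: expR_gt0. Qed.

Lemma flat_fun_ge0 k x : 0 <= flat_fun k x.
Proof. by have /andP[] := flat_fun_bound k x. Qed.

Definition step x : R := flat_fun 0 x * (flat_fun 0 x + flat_fun 0 (1 - x))^-1.

Lemma step_den_gt0 x : 0 < flat_fun 0 x + flat_fun 0 (1 - x).
Proof.
have [x0|x0] := ltP 0 x; first by rewrite ltr_pwDl ?flat_fun_gt0 ?flat_fun_ge0.
by rewrite ltr_wpDl ?flat_fun_ge0// flat_fun_gt0//; lra.
Qed.

Lemma smooth_step : smooth step.
Proof.
have H : smooth (fun x => flat_fun 0 x + flat_fun 0 (1 - x)).
  apply: smoothD; first exact: smooth_flat_fun.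
  have := @smooth_compZ R (flat_fun 0) (-1) 1 (@smooth_flat_fun 0).
  by congr smooth; apply/funext => x; congr (flat_fun 0); ring.
apply: smoothM; first exact: smooth_flat_fun.
apply/smoothP => n; apply: ndiffV; last by move/smoothP: H; apply.
by move=> x; rewrite gt_eqF// step_den_gt0.
Qed.

Lemma step0 x : x <= 0 -> step x = 0.
Proof. by move=> x0; rewrite /step {1}/flat_fun ltNge x0/= mul0r. Qed.

Lemma step1 x : 1 <= x -> step x = 1.
Proof.
move=> x1; rewrite /step {3}/flat_fun ltNge (_ : 1 - x <= 0)/= ?subr_le0//.
by rewrite addr0 mulfV// gt_eqF// flat_fun_gt0// (lt_le_trans ltr01).
Qed.

Lemma step_homo : {homo step : x y / x <= y}.
Proof.
move=> x y xy; rewrite /step ler_pdivrMr ?step_den_gt0// mulrAC.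
rewrite ler_pdivlMr ?step_den_gt0//.
have H1 := flat_fun_homo xy.
have H2 : flat_fun 0 (1 - y) <= flat_fun 0 (1 - x) by apply: flat_fun_homo; lra.
rewrite !mulrDr (mulrC (flat_fun 0 x) (flat_fun 0 y)) lerD2l.
apply: ler_pM => //; exact: flat_fun_ge0.
Qed.

Lemma step_ge0 x : 0 <= step x.
Proof.
have [x0|/ltW x0] := leP x 0; first by rewrite step0.
by rewrite -(step0 (lexx 0)) step_homo.
Qed.

Lemma step_le1 x : step x <= 1.
Proof. have [x0|/ltW x0] := leP 1 x; first by rewrite step1.
by rewrite -(step1 (lexx 1)) step_homo. Qed.

Lemma derive1_step_ge0 x : 0 <= derive1 step x.
Proof. exact: (is_derive_ge0 step_homo (smooth_is_derive0 _ smooth_step)). Qed.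

Definition bumpf x : R := step (2 - 2 * x) * step (2 + 2 * x).

Lemma smooth_bump : smooth bumpf.
Proof.
apply: smoothM.
  have := @smooth_compZ R step (- 2) 2 smooth_step.
  by congr smooth; apply/funext => x; congr step; ring.
have := @smooth_compZ R step 2 2 smooth_step.
by congr smooth; apply/funext => x; congr step; ring.
Qed.

Lemma bump_ge0 x : 0 <= bumpf x.
Proof. by rewrite mulr_ge0 ?step_ge0. Qed.

Lemma bump_le1 x : bumpf x <= 1.
Proof. by rewrite mulr_ile1 ?step_ge0 ?step_le1//. Qed.

Lemma bump1 x : `|x| <= 1 / 2 -> bumpf x = 1.
Proof. by rewrite ler_norml => /andP[? ?]; rewrite /bumpf !step1 ?mulr1//; lra. Qed.

Lemma bump0 x : 1 <= `|x| -> bumpf x = 0.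
Proof.
by rewrite ler_normr => /orP[?|?]; rewrite /bumpf; [rewrite step0 ?mul0r|rewrite mulrC step0 ?mul0r]; lra.
Qed.

Lemma derive1_step_eq0 x : 1 < x -> derive1 step x = 0.
Proof.
move=> x1; have : \forall y \near x, step y = (cst 1 : R -> R) y.
  by near=> y; rewrite /cst step1//; apply/ltW; near: y; exact: lt_nbhsr.
by move=> /near_eq_derive H; rewrite derive1E H -derive1E derive1_cst.
Unshelve. all: by end_near. Qed.

(** This puts the bump into [T1]. On each side of the origin one of the two steps is already on its
    plateau, so only the other, monotone one contributes to the derivative. *)
Lemma bump_unimodal x : x * derive1 bumpf x <= 0.
Proof.
have s1 s : smooth (fun y : R => step (s * y + 2)) := @smooth_compZ R step s 2 smooth_step.
have D s : derive1 (fun y => step (s * y + 2)) x = s * derive1 step (s * x + 2).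
  have := @derive1n_comp_affine R step s 2 1 smooth_step.
  by rewrite !derive1n1 expr1 => ->.
have [p pE] : exists p, p = - 2 * x + 2 by exists (- 2 * x + 2).
have [q qE] : exists q, q = 2 * x + 2 by exists (2 * x + 2).
have E : derive1 bumpf x = - 2 * derive1 step p * step q + step p * (2 * derive1 step q).
  have -> : bumpf = (fun y => step (- 2 * y + 2) * step (2 * y + 2)).
    by apply/funext => y; rewrite /bumpf addrC mulNr [2 + _]addrC.
  by rewrite (derive1M x (s1 (- 2)) (s1 2)) (D (- 2)) (D 2) -pE -qE.
rewrite E {E}; have dp := derive1_step_ge0 p; have dq := derive1_step_ge0 q.
have [x0|x0] := leP 0 x.
  have q1 : 1 < q by lra.
  rewrite (derive1_step_eq0 q1) (step1 (ltW q1)).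
  by move: dp; move: (derive1 step p) (step p) => A B A0; nra.
have p1 : 1 < p by lra.
rewrite (derive1_step_eq0 p1) (step1 (ltW p1)).
by move: dq; move: (derive1 step q) (step q) => A B A0; nra.
Qed.

Lemma derive1_gauss : derive1 (@gauss_fun R) = (fun x => - 2 * x * gauss_fun x).
Proof.
apply: is_derive_derive1 => x.
have H1 : is_derive x (1:R) (fun x : R => - x ^+ 2) (- 2 * x).
  apply: (is_derive_eq (is_deriveN (is_deriveX 2 (is_derive_id x 1)))).
  by rewrite /GRing.scale/= expr1 mulr1 mulNr.
rewrite mulrC; exact: (is_derive1_comp (is_derive_expR _) H1).
Qed.

Lemma smooth_gauss : smooth (@gauss_fun R).
Proof.
apply: smooth_comp; first by apply/smoothP => n; exact: ndiff_expR.
have := @smoothZ R (-1) _ (smoothM (@smooth_id R) (@smooth_id R)).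
by congr smooth; apply/funext => x; rewrite mulN1r expr2.
Qed.

(** Hermite's recurrence, the source both of the decay of all derivatives and of the heat equation
    for the kernel. *)
Lemma derive1n_gaussSS m y : derive1n m.+2 gauss_fun y =
  - 2 * y * derive1n m.+1 gauss_fun y - 2 * m.+1%:R * derive1n m gauss_fun y.
Proof.
elim: m y => [|m IH] y.
  rewrite derive1nS derive1n1 {1}derive1_gauss.
  rewrite [LHS](_ : _ = derive1 (fun x => (- 2 * x + 0) * gauss_fun x) y); last first.
    by congr (derive1 _ y); apply/funext => z; rewrite addr0.
  rewrite derive1M; [|exact: smooth_affine|exact: smooth_gauss].
  rewrite (_ : derive1 (fun x => - 2 * x + 0) y = - 2); last first.
    have := @derive1n_comp_affine R id (- 2) 0 1 (@smooth_id R).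
    by rewrite !derive1n1 => ->; rewrite derive1_id mulr1 expr1.
  by rewrite addr0 derive1n0; ring.
rewrite derive1nS (_ : derive1n m.+2 gauss_fun = fun y =>
  ((- 2 * y + 0) * derive1n m.+1 gauss_fun y) - 2 * m.+1%:R * derive1n m gauss_fun y); last first.
  by apply/funext => z; rewrite IH addr0.
have sg := smooth_gauss.
have s1 := @smooth_derive1n R _ m.+1 sg; have s0 := @smooth_derive1n R _ m sg.
have := @derive1nB R _ _ 1 (smoothM (@smooth_affine R (-2) 0) s1) (@smoothZ R (2 * m.+1%:R) _ s0).
rewrite !derive1n1 => ->.
have := @derive1nZ _ (2 * m.+1%:R) _ 1 s0; rewrite !derive1n1 => ->.
rewrite (derive1M y (@smooth_affine R (- 2) 0) s1).
rewrite (_ : derive1 (fun x => - 2 * x + 0) y = - 2); last first.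
  have := @derive1n_comp_affine R id (- 2) 0 1 (@smooth_id R).
  by rewrite !derive1n1 => ->; rewrite derive1_id mulr1 expr1.
rewrite -!derive1nS addr0 -(natr1 m.+1) -IH.
move: (derive1n m.+1 _ y) (derive1n m.+2 _ y) => u v; ring.
Qed.

Lemma gauss_decay m k : exists2 C : R, 0 <= C &
  forall y, (1 + `|y|) ^+ k * `|derive1n m gauss_fun y| <= C.
Proof.
(* The recurrence has three terms, so the induction carries two consecutive orders. *)
suff: (forall k, exists2 C : R, 0 <= C & forall y, (1 + `|y|) ^+ k * `|derive1n m gauss_fun y| <= C)
   /\ (forall k, exists2 C : R, 0 <= C & forall y, (1 + `|y|) ^+ k * `|derive1n m.+1 gauss_fun y| <= C).
  by move=> [+ _]; exact.
have pw y j : 0 <= (1 + `|y|) ^+ j by rewrite exprn_ge0// addr_ge0.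
elim: m {k} => [|m [IH0 IH1]].
  have H0 k : exists2 C : R, 0 <= C & forall y, (1 + `|y|) ^+ k * `|derive1n 0 gauss_fun y| <= C.
    (* The power is at most [k^k exp (1 + |y|)], and [1 + |y| - y^2 <= 2]. *)
    exists (k%:R ^+ k * expR 2); first by rewrite mulr_ge0 ?exprn_ge0 ?expR_ge0.
    move=> y /=; rewrite (ger0_norm (gauss_fun_ge0 y)).
    have y0 := normr_ge0 y.
    have := @expR_ge_pow k (1 + `|y|) (addr_ge0 ler01 y0) => H.
    apply: (le_trans (ler_wpM2r (gauss_fun_ge0 y) H)).
    rewrite -mulrA ler_wpM2l ?exprn_ge0// -expRD ler_expR.
    by rewrite -(ger0_norm (sqr_ge0 y)) normrX; nra.
  split => // k; have [C C0 H] := H0 k.+1; exists (2 * C); first by rewrite mulr_ge0.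
  move=> y; have := H y; have := mulr_ge0 (pw y k) (normr_ge0 (gauss_fun y)).
  rewrite derive1n0 derive1n1 derive1_gauss exprS !normrM normrN (ger0_norm (ler0n R 2)).
  set p := (_ ^+ k); nra.
split=> // k.
have [C1 C10 H1] := IH1 k.+1; have [C0 C00 H0] := IH0 k.
exists (2 * C1 + 2 * m.+1%:R * C0); first by rewrite addr_ge0 ?mulr_ge0.
move=> y; rewrite derive1n_gaussSS.
apply: (le_trans (ler_wpM2l (pw y k) (ler_normB _ _))).
rewrite mulrDr; apply: lerD.
  have := H1 y; have := mulr_ge0 (pw y k) (normr_ge0 (derive1n m.+1 gauss_fun y)).
  rewrite !normrM normrN (ger0_norm (ler0n R 2)) exprS.
  set p := (_ ^+ k); nra.
by rewrite normrM [X in _ * (X * _)]ger0_norm ?mulr_ge0// mulrCA ler_wpM2l ?mulr_ge0//.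
Qed.

End bumps.

(** * Uniform boundedness *)

Section ubp.
Variable R : realType.
Implicit Types (f g : R -> R) (x y a c : R) (m n k N : nat).

Lemma taylor2 f g (l : R -> R) (x h r C : R) : `|h| <= r ->
  (forall u, `|u - x| <= r -> is_derive u 1 f (g u)) ->
  (forall u, `|u - x| <= r -> is_derive u 1 g (l u)) ->
  (forall u, `|u - x| <= r -> `|l u| <= C) ->
  `|f (x + h) - f x - g x * h| <= C * h ^+ 2.
Proof.
move=> hr fg gl lC.
have C0 : 0 <= C by apply: le_trans (lC x _) => //; rewrite subrr normr0 (le_trans _ hr).
have gb u : `|u - x| <= r -> `|g u - g x| <= C * `|u - x|.
  move=> ur; have [xu|ux] := leP x u.
    rewrite (ger0_norm (_ : 0 <= u - x)) ?subr_ge0//.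
    by apply: (MVT_bound xu) => v vxu; [apply: gl|apply: lC]; rewrite !ler_norml in ur *; lra.
  rewrite distrC [X in C * X]distrC (ger0_norm (_ : 0 <= x - u)) ?subr_ge0 ?(ltW ux)//.
  by apply: (MVT_bound (ltW ux)) => v vxu; [apply: gl|apply: lC]; rewrite !ler_norml in ur *; lra.
pose p u := f u - g x * u.
have pd u : `|u - x| <= r -> is_derive u 1 p (g u - g x).
  move=> ur; have H := is_deriveB (fg u ur) (is_deriveZ (g x) (is_derive_id u 1)).
  by apply: (is_derive_eq H); rewrite /GRing.scale/= mulr1.
have -> : f (x + h) - f x - g x * h = p (x + h) - p x by rewrite /p; ring.
have [h0|h0] := leP 0 h.
  have -> : C * h ^+ 2 = C * h * ((x + h) - x) by rewrite expr2; ring.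
  apply: (@MVT_bound _ p (fun u => g u - g x)) => [|u uxh|u uxh].
  - by rewrite lerDl.
  - by apply: pd; rewrite !ler_norml in hr *; lra.
  - apply: le_trans (gb _ _) _; first by rewrite !ler_norml in hr *; lra.
    by apply: ler_wpM2l => //; rewrite !ler_norml in hr *; lra.
rewrite distrC.
have -> : C * h ^+ 2 = C * (- h) * (x - (x + h)) by rewrite expr2; ring.
apply: (@MVT_bound _ p (fun u => g u - g x)) => [|u uxh|u uxh].
- by rewrite gerDl ltW.
- by apply: pd; rewrite !ler_norml in hr *; lra.
- apply: le_trans (gb _ _) _; first by rewrite !ler_norml in hr *; lra.
  by apply: ler_wpM2l => //; rewrite !ler_norml in hr *; lra.
Qed.

Lemma smooth_family (G : nat -> R -> R) :
  (forall m x, is_derive x 1 (G m) (G m.+1 x)) ->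
  smooth (G 0%N) /\ forall m, derive1n m (G 0%N) = G m.
Proof.
move=> GD; have E m : derive1n m (G 0%N) = G m.
  by elim: m => // m IH; rewrite derive1nS IH; exact: is_derive_derive1.
by split => // n x; rewrite E; have [] := GD n x.
Qed.

Lemma continuous_bounded_itv f (a b : R) : continuous f ->
  exists2 B : R, 0 <= B & forall x, a <= x <= b -> `|f x| <= B.
Proof.
move=> cf; have [ab|ba] := leP a b; last first.
  by exists 0 => // x /andP[ax /(le_trans ax)]; rewrite leNgt ba.
have cn : {within `[a, b], continuous (fun x => `|f x|)}.
  apply: continuous_subspaceT => x.
  by apply: continuous_comp; [exact: cf|exact: norm_continuous].
have [c _ H] := EVT_max ab cn.
by exists `|f c| => // x xab; apply: H; rewrite in_itv.
Qed.

Lemma smooth_bounded f N r : smooth f -> exists2 B : R, 0 <= B &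
  forall m x, (m <= N)%N -> `|x| <= r -> `|derive1n m f x| <= B.
Proof.
move=> sf; elim: N => [|N [B B0 H]].
  have [B B0 H] := continuous_bounded_itv (- r) r (smooth_continuous sf).
  by exists B => // m x; rewrite leqn0 => /eqP -> xr; apply: H; rewrite -ler_norml.
have [B' B'0 H'] := continuous_bounded_itv (- r) r
   (smooth_continuous (@smooth_derive1n _ _ N.+1 sf)).
exists (B + B'); first exact: addr_ge0.
move=> m x; rewrite leq_eqVlt => /orP[/eqP -> xr|mN xr].
  by rewrite (le_trans (H' _ _)) ?lerDr// -ler_norml.
by rewrite (le_trans (H _ _ mN xr)) ?lerDl.
Qed.

(** Halving of [a] makes the errors summable, and [n k] grows without bound, so every derivative
    converges uniformly. The limits form a tower of derivatives because the Taylor remainders are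
    bounded uniformly in [k]. *)
Lemma smooth_limit (s : nat -> R -> R) (n : nat -> nat) (a : nat -> R) :
  (forall k, smooth (s k)) -> (forall k, 0 < a k) ->
  (forall k, a k.+1 <= a k / 2) -> (forall k, (n k < n k.+1)%N) ->
  (forall k m x, (m <= n k)%N ->
     `|derive1n m (s k.+1) x - derive1n m (s k) x| <= a k) ->
  exists2 psi, smooth psi &
     (forall k m x, (m <= n k)%N -> `|derive1n m psi x - derive1n m (s k) x| <= 2 * a k)
     /\ forall x, s k x @[k --> \oo] --> psi x.
Proof.
move=> ss a0 a2 nS sa.
have nk k : (k <= n k)%N.
  by elim: k => // k IH; exact: leq_ltn_trans (nS k).
have nD k j : (n k <= n (k + j))%N.
  by elim: j => [|j IH]; rewrite ?addn0// addnS (leq_trans IH)// ltnW.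
(* The bound telescopes, since [a k <= 2 * a k - 2 * a k.+1]. *)
have sD k j m x : (m <= n k)%N ->
    `|derive1n m (s (k + j)%N) x - derive1n m (s k) x| <= 2 * a k - 2 * a (k + j)%N.
  move=> mk; elim: j => [|j IH]; first by rewrite addn0 !subrr normr0.
  rewrite addnS -(subrKA (derive1n m (s (k + j)%N) x)).
  apply: (le_trans (ler_normD _ _)).
  have := sa (k + j)%N m x (leq_trans mk (nD k j)); have := a2 (k + j)%N.
  lra.
have sD' k j m x : (m <= n k)%N ->
    `|derive1n m (s (k + j)%N) x - derive1n m (s k) x| <= 2 * a k.
  by move=> mk; rewrite (le_trans (sD k j m x mk))// gerBl mulr_ge0// ltW.
have ag k : a k <= a 0%N * 2^-1 ^+ k.
  elim: k => [|k IH]; first by rewrite expr0 mulr1.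
  by rewrite (le_trans (a2 k))// exprSr mulrA ler_wpM2r.
have acv : a k @[k --> \oo] --> (0 : R).
  apply: (@squeeze_cvgr _ _ _ _ (cst 0) (fun k => a 0%N * 2^-1 ^+ k)).
  - by near=> k; rewrite ag andbT ltW.
  - exact: cvg_cst.
  - rewrite -[X in _ --> X](mulr0 (a 0%N)); apply: cvgMr.
    apply: cvg_expr; rewrite ger0_norm; lra.
have cv m x : cvg (derive1n m (s k) x @[k --> \oo]).
  apply/cauchy_cvgP/cauchy_exP => e e0.
  have /cvgrPdist_lt /(_ (e / 2)) : a k @[k --> \oo] --> (0 : R) by [].
  rewrite divr_gt0// => /(_ isT) [K _ HK].
  pose k := maxn K m; exists (derive1n m (s k) x), k => // j /= kj.
  have mk : (m <= n k)%N by rewrite (leq_trans _ (nk k))// leq_maxr.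
  have := sD' k (j - k)%N m x mk; rewrite subnKC// /ball/= distrC => /le_lt_trans; apply.
  have := HK k (leq_maxl _ _); rewrite /= sub0r normrN (ger0_norm (ltW (a0 _))); lra.
pose G m x := lim (derive1n m (s k) x @[k --> \oo]).
have GL m x : derive1n m (s k) x @[k --> \oo] --> G m x by exact: cv.
have GB k m x : (m <= n k)%N -> `|G m x - derive1n m (s k) x| <= 2 * a k.
  move=> mk; have H : `|derive1n m (s j) x - derive1n m (s k) x| @[j --> \oo] -->
     `|G m x - derive1n m (s k) x|.
    by apply: cvg_norm; apply: cvgB => //; exact: cvg_cst.
  rewrite -(cvg_lim _ H)//; apply: limr_le; first by apply/cvg_ex; eexists; exact: H.
  exists k => // j /= kj; by have := sD' k (j - k)%N m x mk; rewrite subnKC.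
have GD m x : is_derive x 1 (G m) (G m.+1 x).
  have [B B0 HB] := @smooth_bounded (s m.+2) m.+2 (`|x| + 1) (ss m.+2).
  have sB k u : (m.+2 <= k)%N -> `|u - x| <= 1 -> `|derive1n m.+2 (s k) u| <= B + 2 * a m.+2.
    move=> mk ux; have := sD' m.+2 (k - m.+2)%N m.+2 u (nk _); rewrite subnKC// => H.
    have uB : `|u| <= `|x| + 1.
      by rewrite -(subrK x u) (le_trans (ler_normD _ _))// addrC lerD2l.
    rewrite -(subrK (derive1n m.+2 (s m.+2) u) (derive1n m.+2 (s k) u)).
    by rewrite (le_trans (ler_normD _ _))// addrC lerD// HB.
  apply: (@is_derive_quadratic _ _ _ _ 1 (B + 2 * a m.+2)) => // h h1.
  have H : `|derive1n m (s k) (x + h) - derive1n m (s k) x - derive1n m.+1 (s k) x * h| @[k --> \oo] -->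
     `|G m (x + h) - G m x - G m.+1 x * h|.
    apply: cvg_norm; apply: cvgB; first by apply: cvgB.
    by apply: cvgMl.
  rewrite -(cvg_lim _ H)//; apply: limr_le; first by apply/cvg_ex; eexists; exact: H.
  exists m.+2 => // k /= mk.
  apply: (@taylor2 _ (derive1n m.+1 (s k)) (derive1n m.+2 (s k)) x h 1 (B + 2 * a m.+2) h1).
  - by move=> u _; exact: (smooth_is_derive m u (ss k)).
  - by move=> u _; exact: (smooth_is_derive m.+1 u (ss k)).
  - by move=> u ux; exact: sB.
have [sG dG] := smooth_family GD.
exists (G 0%N) => //; split; last by move=> x; exact: (GL 0%N x).
by move=> k m x mk; rewrite dG; exact: GB.
Unshelve. all: by end_near. Qed.

(** Fixing the support makes this a Frechet space, the setting of Banach-Steinhaus; centres and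
    scales are then supplied by dilation. *)
Definition test1 f := smooth f /\ forall x, 1 < `|x| -> f x = 0.

Section family.
Variables (I : Type) (T : I -> (R -> R) -> R).
Hypothesis T_linear : forall i c f g, test1 f -> test1 g ->
  T i (fun x => c * f x + g x) = c * T i f + T i g.
Hypothesis T_continuous : forall i, exists (C : R) (N : nat), forall f (B : R), test1 f ->
  (forall m x, (m <= N)%N -> `|derive1n m f x| <= B) -> `|T i f| <= C * B.
Hypothesis T_bounded : forall f, test1 f -> exists M : R, forall i, `|T i f| <= M.

Lemma test1_linear c f g : test1 f -> test1 g -> test1 (fun x => c * f x + g x).
Proof.
move=> [sf f0] [sg g0]; split; first exact: (smoothD (@smoothZ R c f sf) sg).
by move=> x x1; rewrite f0// g0// mulr0 addr0.
Qed.

Lemma test1_cst0 : test1 (cst 0).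
Proof. by split=> //; exact: smooth_cst. Qed.

(* Gliding hump: f is the limit of a sum of test functions f_k with T i_k f_k large,
   each one so small in the norms that matter for i_0, ..., i_(k-1) that it is not
   seen by them. *)
Lemma uniform_boundedness : exists (C : R) (N : nat), forall i f (B : R), test1 f ->
  (forall m x, (m <= N)%N -> `|derive1n m f x| <= B) -> `|T i f| <= C * B.
Proof.
apply: contrapT => H.
have {}H (C : R) N : exists i f B, [/\ test1 f,
    (forall m x, (m <= N)%N -> `|derive1n m f x| <= B) & C * B < `|T i f|].
  apply: contrapT => H1; apply: H; exists C, N => i f B tf fB.
  rewrite leNgt; apply/negP => H2; apply: H1; by exists i, f, B.
(* A state [(k, s, n, a)] records the stage, the partial sum, the order up to which the next
   increment must be small, and how small. *)
pose valid (st : nat * (R -> R) * nat * R) := test1 st.1.1.2 /\ 0 < st.2.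
pose next (st st' : nat * (R -> R) * nat * R) :=
  [/\ st'.1.1.1 = st.1.1.1.+1, st'.2 <= st.2 / 2, (st.1.2 < st'.1.2)%N,
     (forall m x, (m <= st.1.2)%N ->
        `|derive1n m st'.1.1.2 x - derive1n m st.1.1.2 x| <= st.2) &
     exists i, st.1.1.1.+2%:R <= `|T i st'.1.1.2| /\
        forall f, test1 f ->
          (forall m x, (m <= st'.1.2)%N -> `|derive1n m f x| <= 2 * st'.2) ->
           `|T i f| <= 1].
have /choice[nx Hnx] : forall st, exists st', valid st -> valid st' /\ next st st'.
  move=> [[[k s] n] a].
  have [[/= ts a0]|nv] := pselect (valid (k, s, n, a)); last by exists (k, s, n, a).
  have [M HM] := T_bounded ts.
  have M0 : 0 <= `|M| by [].
  (* Scaled by [a / B], the new hump is at most [a] up to order [n], yet [T i] maps it above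
     [|M| + k + 2], so that it outweighs [T i s], which is at most [M]. *)
  have [i [f [B [tf fB Hf]]]] := H ((`|M| + k.+2%:R) / a) n.
  have [C [N HC]] := T_continuous i.
  have B0 : 0 <= B by apply: le_trans (fB 0%N 0 isT).
  have Bpos : 0 < B.
    rewrite lt_neqAle B0 andbT; apply/eqP => BE.
    move: Hf; rewrite -BE mulr0 => Hf.
    have f0 x : f x = 0.
      by apply/eqP; rewrite -normr_le0; have := fB 0%N x isT; rewrite -BE.
    have : `|T i f| <= C * 0.
      apply: HC => // m x _; rewrite (_ : f = cst 0) ?derive1n_cst; last exact/funext.
      by case: m; rewrite normr0.
    by rewrite mulr0 leNgt Hf.
  pose s' x := (a / B) * f x + s x.
  have ts' : test1 s' by exact: test1_linear.
  (* The second entry ensures that everything added later, of size at most [2 * a'] in the norm that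
     bounds [T i], changes [T i] by at most 1. *)
  pose a' := Num.min (a / 2) (2 * (`|C| + 1))^-1.
  have a'0 : 0 < a' by rewrite lt_min !divr_gt0// invr_gt0 mulr_gt0// ltr_wpDl.
  exists (k.+1, s', maxn n.+1 N, a') => _; split => //; split => //.
  - by rewrite ge_min lexx.
  - by rewrite leq_max ltnSn.
  - move=> m x mn; rewrite /s' (@derive1n_linear R (a / B) f s m tf.1 ts.1).
    rewrite addrK normrM ger0_norm ?divr_ge0 ?(ltW a0)//.
    by rewrite mulrAC ler_pdivrMr// ler_pM2l//; exact: fB.
  exists i; split.
    rewrite /s' T_linear//.
    have H1 : `|M| + k.+2%:R <= `|a / B * T i f|.
      rewrite normrM ger0_norm ?divr_ge0 ?(ltW a0)// mulrAC ler_pdivlMr//.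
      by move: Hf; rewrite mulrAC ltr_pdivrMr// (mulrC a) => /ltW.
    have H2 := HM i; have H3 := ler_norm M.
    have := lerB_normD (a / B * T i f) (T i s); lra.
  move=> h th hB; have := HC h (2 * a') th.
  move=> /(_ (fun m x mN => hB m x (leq_trans mN (leq_maxr _ _)))) /le_trans; apply.
  have C1 : 0 < `|C| + 1 by rewrite ltr_wpDl.
  have : a' <= (2 * (`|C| + 1))^-1 by rewrite ge_min lexx orbT.
  rewrite -(ler_pM2l (_ : 0 < 2 * (`|C| + 1))) ?mulr_gt0// mulfV ?gt_eqF ?mulr_gt0// => Ha.
  apply: le_trans Ha; rewrite mulrA (mulrC C) ler_wpM2r ?(ltW a'0)//.
  by rewrite ler_pM2l// (le_trans (ler_norm _))// lerDl.
pose st k := iter k nx (0%N, cst 0, 0%N, 1).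
have v k : valid (st k).
  elim: k => [|k IH]; first by split => //; exact: test1_cst0.
  by have [] := Hnx _ IH.
have N k : next (st k) (st k.+1) by have [_] := Hnx _ (v k).
pose s k := (st k).1.1.2; pose n k := (st k).1.2; pose a k := (st k).2.
have N1 k : [/\ a k.+1 <= a k / 2, (n k < n k.+1)%N,
     (forall m x, (m <= n k)%N -> `|derive1n m (s k.+1) x - derive1n m (s k) x| <= a k) &
     exists i, k.+2%:R <= `|T i (s k.+1)| /\
        forall f, test1 f -> (forall m x, (m <= n k.+1)%N -> `|derive1n m f x| <= 2 * a k.+1) ->
           `|T i f| <= 1].
  have kE j : (st j).1.1.1 = j.
    by elim: j => // j IH; have [-> _ _ _ _] := N j; rewrite IH.
  by have [_ ? ? ?] := N k; rewrite (kE k).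
have ss k : smooth (s k) by have [[+ _] _] := v k; exact.
have a0 k : 0 < a k by have [] := v k.
have a2 k : a k.+1 <= a k / 2 by have [] := N1 k.
have nS k : (n k < n k.+1)%N by have [] := N1 k.
have sa k m x : (m <= n k)%N -> `|derive1n m (s k.+1) x - derive1n m (s k) x| <= a k.
  by have [_ _ H1 _] := N1 k; exact: H1.
have [psi spsi [Hpsi Hcv]] := smooth_limit ss a0 a2 nS sa.
have tpsi : test1 psi.
  split => // x x1; have : s k x @[k --> \oo] --> (0 : R).
    rewrite (_ : (fun k => s k x) = cst 0); first exact: cvg_cst.
    by apply/funext => k; have [[_ H0] _] := v k; exact: H0.
  by apply: cvg_unique => //; exact: Hcv.
have [M HM] := T_bounded tpsi.
have [k Hk] : exists k, M < k%:R by exists (Num.truncn M).+1; exact: truncnS_gt.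
have [_ _ _ [i [Hi1 Hi2]]] := N1 k.
have tsk : test1 (s k.+1) by have [] := v k.+1.
have td : test1 (fun x => -1 * s k.+1 x + psi x) by exact: test1_linear.
have : `|T i (fun x => -1 * s k.+1 x + psi x)| <= 1.
  apply: Hi2 => // m x mn; rewrite (@derive1n_linear R (-1) _ _ m (ss k.+1) spsi).
  by rewrite mulN1r addrC; exact: Hpsi.
rewrite T_linear// mulN1r => H3.
have H5 : `|T i (s k.+1)| <= `|- T i (s k.+1) + T i psi| + `|T i psi|.
  by rewrite [X in `|X| + _]addrC distrC -{1}(subrK (T i psi) (T i (s k.+1))) ler_normD.
have := HM i; move: Hi1 H3 H5 Hk; rewrite -(natr1 k.+1) -(natr1 k).
move: `|T i _| `|_ + _| `|T i psi| k%:R => *; lra.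
Qed.

End family.
End ubp.

(** * Compactly supported functionals and their dilates *)

Section cdistr.
Variable R : realType.
Implicit Types (f g : R -> R) (x y a c t : R) (m n k N : nat).

Lemma exists_uniform N (P : nat -> R -> Prop) :
  (forall m, exists2 C : R, 0 <= C & P m C) ->
  (forall m (C C' : R), C <= C' -> P m C -> P m C') ->
  exists2 C : R, 0 <= C & forall m, (m <= N)%N -> P m C.
Proof.
move=> PE PM; elim: N => [|N [C C0 H]].
  by have [C C0 H] := PE 0%N; exists C => // m; rewrite leqn0 => /eqP ->.
have [C' C'0 H'] := PE N.+1; exists (C + C'); first exact: addr_ge0.
move=> m; rewrite leq_eqVlt => /orP[/eqP ->|mN].
  by apply: PM H'; rewrite lerDr.
by apply: PM (H m mN); rewrite lerDl.
Qed.

Lemma derive1n_eq_open (A : set R) f g m x : open A ->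
  (forall y, A y -> f y = g y) -> A x -> derive1n m f x = derive1n m g x.
Proof.
move=> oA; elim: m f g x => [|m IH] f g x fg Ax; first exact: fg.
rewrite !derive1nSr; apply: IH Ax => y Ay; rewrite !derive1E.
apply: near_eq_derive; have : nbhs y A by exact: open_nbhs_nbhs.
by apply: filterS => z; exact: fg.
Qed.

Lemma open_norm_gt (r c : R) : open [set x : R | r < `|x - c|].
Proof.
rewrite [X in open X](_ : _ = (fun x : R => `|x - c|) @^-1` [set y | r < y]) //.
apply: open_comp; last exact: open_gt.
move=> x _; apply: cvg_norm.
by apply: cvgB; [exact: cvg_id|exact: cvg_cst].
Qed.

Lemma test1_derive1n0 f m x : test1 f -> 1 < `|x| -> derive1n m f x = 0.
Proof.
move=> [_ f0] x1.
rewrite (@derive1n_eq_open [set x | 1 < `|x - 0|] f (cst 0)) ?derive1n_cst /=.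
- by case: m.
- exact: open_norm_gt.
- by move=> y /=; rewrite subr0; exact: f0.
- by rewrite subr0.
Qed.

Lemma test1_bounded f N : test1 f ->
  exists2 B : R, 0 <= B & forall m x, (m <= N)%N -> `|derive1n m f x| <= B.
Proof.
move=> tf; have [B B0 H] := @smooth_bounded _ f N 1 tf.1; exists B => // m x mN.
have [x1|x1] := leP `|x| 1; first exact: H.
by rewrite test1_derive1n0// normr0.
Qed.

Definition dil f c t : R -> R := fun y => f ((y - c) / t).

Lemma smooth_dilE f c t : smooth f -> smooth (dil f c t).
Proof. by move=> sf; exact: smooth_dil. Qed.

Lemma derive1n_dilE f c t m : smooth f ->
  derive1n m (dil f c t) = (fun x => (t ^+ m)^-1 * dil (derive1n m f) c t x).
Proof. by move=> sf; exact: derive1n_dil. Qed.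

(** Compactly supported distributions as functionals on all smooth functions, so that Gaussians can
    be paired without a cut-off. *)
Definition cdistr (L : (R -> R) -> R) : Prop :=
  (forall c f g, smooth f -> smooth g ->
     L (fun x => c * f x + g x) = c * L f + L g) /\
  exists (r C : R) (N : nat), forall f (B : R), smooth f ->
    (forall m x, (m <= N)%N -> `|x| <= r -> `|derive1n m f x| <= B) -> `|L f| <= C * B.

Variable L : (R -> R) -> R.
Hypothesis cL : cdistr L.

Lemma cdistr_linear c f g : smooth f -> smooth g ->
  L (fun x => c * f x + g x) = c * L f + L g.
Proof. by move=> sf sg; exact: cL.1. Qed.

Lemma cdistr0 : L (cst 0) = 0.
Proof.
have := @cdistr_linear 1 (cst 0) (cst 0) (@smooth_cst R 0) (@smooth_cst R 0).
rewrite (_ : (fun x => _) = cst 0); last by apply/funext => x; rewrite /= mulr0 addr0.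
by rewrite mul1r => /eqP; rewrite addrC -subr_eq subrr => /eqP.
Qed.

Lemma cdistrZ c f : smooth f -> L (fun x => c * f x) = c * L f.
Proof.
move=> sf; have := @cdistr_linear c f (cst 0) sf (@smooth_cst R 0).
rewrite cdistr0 addr0 => <-; congr L; by apply/funext => x; rewrite /= addr0.
Qed.

Lemma cdistrD f g : smooth f -> smooth g -> L (fun x => f x + g x) = L f + L g.
Proof.
move=> sf sg; have := @cdistr_linear 1 f g sf sg; rewrite mul1r => <-; congr L.
by apply/funext => x; rewrite mul1r.
Qed.

Lemma cdistrB f g : smooth f -> smooth g -> L (fun x => f x - g x) = L f - L g.
Proof.
move=> sf sg; have := @cdistr_linear (-1) g f sg sf; rewrite mulN1r addrC => <-; congr L.
by apply/funext => x; rewrite mulN1r addrC.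
Qed.

Lemma cdistr_continuous : exists (r C : R) (N : nat), [/\ 0 <= r, 0 <= C &
  forall f (B : R), smooth f ->
    (forall m x, (m <= N)%N -> `|x| <= r -> `|derive1n m f x| <= B) -> `|L f| <= C * B].
Proof.
have [_ [r [C [N H]]]] := cL; exists `|r|, C, N; split => //.
  have := H (cst 0) 1 (@smooth_cst R 0); rewrite cdistr0 normr0 mulr1; apply.
  by move=> m x _ _; rewrite derive1n_cst; case: m; rewrite normr0.
move=> f B sf fB; apply: H => // m x mN xr; apply: fB => //.
exact: le_trans (ler_norm r).
Qed.

(** The seminorms only read derivatives on [|x| <= r], and these agree once the functions agree on a
    larger open interval. *)
Lemma cdistr_eq_on : exists2 r : R, 0 <= r & forall f g, smooth f -> smooth g ->
  (forall x, `|x| < r + 1 -> f x = g x) -> L f = L g.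
Proof.
have [r [C [N [r0 C0 H]]]] := cdistr_continuous; exists r => // f g sf sg fg.
apply/eqP; rewrite -subr_eq0 -(cdistrB sf sg) -normr_le0 -(mulr0 C).
apply: H; first exact: smoothB.
move=> m x mN xr; rewrite (derive1nB m sf sg) (@derive1n_eq_open (ball 0 (r + 1)) f g).
- by rewrite subrr normr0.
- by apply: ball_open; rewrite ltr_wpDl.
- by move=> y; rewrite /ball/= sub0r normrN; exact: fg.
- by rewrite /ball/= sub0r normrN (le_lt_trans xr)// ltrDl.
Qed.

Section pairing_derivative.
Variables (k : R -> R -> R) (l : R -> R) (u r : R).
Hypotheses (r0 : 0 < r) (sk : forall s, smooth (k s)) (sl : smooth l).
Hypothesis kD : forall m, exists2 C : R, 0 <= C & forall h y, `|h| <= r ->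
  `|derive1n m (k (u + h)) y - derive1n m (k u) y - derive1n m l y * h| <= C * h ^+ 2.

(** Differentiation under the pairing: the remainder is quadratic in [h] for each derivative in [y],
    uniformly in [y], hence in the seminorm that controls [L]. *)
Lemma pairing_is_derive : is_derive u 1 (fun s => L (k s)) (L l).
Proof.
have [r1 [C1 [N [r10 C10 HL]]]] := cdistr_continuous.
have [|C C0 HC] := @exists_uniform N (fun m C => forall h y, `|h| <= r ->
  `|derive1n m (k (u + h)) y - derive1n m (k u) y - derive1n m l y * h| <= C * h ^+ 2) kD.
  by move=> m C C' CC' H h y hr; rewrite (le_trans (H h y hr))// ler_wpM2r// sqr_ge0.
apply: (@is_derive_quadratic _ _ _ _ r (C1 * C)) => // h hr.
pose d y := k (u + h) y - k u y.
have sd : smooth d := smoothB (@sk (u + h)) (@sk u).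
have -> : L (k (u + h)) - L (k u) - L l * h = L (fun y => - h * l y + d y).
  by rewrite (@cdistr_linear (- h) _ _ sl sd) (cdistrB (@sk (u + h)) (@sk u)); ring.
rewrite -mulrA; apply: HL; first exact: smoothD (@smoothZ R (- h) _ sl) sd.
move=> m y mN _.
  rewrite (@derive1n_linear R (- h) _ _ m sl sd) (derive1nB m (@sk (u + h)) (@sk u)).
have := HC m mN h y hr; congr (`|_| <= _); ring.
Qed.

End pairing_derivative.

Section scaled.
Variables (c : R) (q : nat).
Hypothesis Lq : forall f, test1 f -> exists2 e : R, 0 < e & exists M : R, forall t,
  t != 0 -> `|t| <= e -> `|L (dil f c t)| <= M * `|t| ^+ q.

Lemma cdistr_ubp (r1 : R) : exists (C : R) (N : nat), 0 <= C /\ forall t f (B : R),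
  t != 0 -> `|t| <= r1 -> test1 f ->
  (forall m x, (m <= N)%N -> `|derive1n m f x| <= B) -> `|L (dil f c t)| <= C * `|t| ^+ q * B.
Proof.
have [r [C [N [r0 C0 HL]]]] := cdistr_continuous.
pose I := {t : R | t != 0 /\ `|t| <= r1}.
pose T (i : I) f := (`|sval i| ^+ q)^-1 * L (dil f c (sval i)).
have HD (e t : R) f (B : R) : 0 < e -> e <= `|t| -> smooth f ->
    (forall m x, (m <= N)%N -> `|derive1n m f x| <= B) -> `|L (dil f c t)| <= C * (1 + e^-1) ^+ N * B.
  move=> e0 et sf fB; rewrite -mulrA; apply: HL; first exact: smooth_dilE.
  move=> m x mN _; rewrite derive1n_dilE// normrM normfV normrX.
  have B0 : 0 <= B by apply: le_trans (fB 0%N 0 isT).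
  apply: ler_pM => //; [|exact: fB].
  rewrite -exprVn (@le_trans _ _ ((1 + e^-1) ^+ m))//.
    rewrite lerXn2r ?nnegrE ?addr_ge0 ?invr_ge0 ?(ltW e0)//.
    rewrite (@le_trans _ _ e^-1)// ?lerDr// lef_pV2 ?posrE//.
    exact: lt_le_trans et.
  by rewrite ler_weXn2l// lerDl invr_ge0 ltW.
have tpos (i : I) : 0 < `|sval i| by rewrite normr_gt0; case: (svalP i).
have [||f tf|C1 [N1 H1]] := @uniform_boundedness R I T.
- move=> i b f g [sf _] [sg _]; rewrite /T.
  rewrite (_ : dil _ c _ = fun x => b * dil f c (sval i) x + dil g c (sval i) x)//.
  by rewrite cdistr_linear; [ring|exact: smooth_dilE..].
- move=> i; exists ((`|sval i| ^+ q)^-1 * (C * (1 + `|sval i|^-1) ^+ N)), N => f B tf fB.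
  rewrite /T normrM ger0_norm ?invr_ge0 ?exprn_ge0// -mulrA ler_wpM2l ?invr_ge0 ?exprn_ge0//.
  by apply: HD => //; case: tf.
- have [e e0 [M HM]] := Lq tf; have [B B0 HB] := test1_bounded N tf.
  exists (`|M| + (e ^+ q)^-1 * (C * (1 + e^-1) ^+ N * B)) => i; rewrite /T normrM ger0_norm ?invr_ge0 ?exprn_ge0//.
  have P0 : 0 <= C * (1 + e^-1) ^+ N * B.
    by rewrite !mulr_ge0// exprn_ge0// addr_ge0// invr_ge0 ltW.
  have [ie|/ltW ei] := leP `|sval i| e.
    apply: ler_wpDr; first by apply: mulr_ge0 => //; rewrite invr_ge0 exprn_ge0// ltW.
    rewrite ler_pdivrMl ?exprn_gt0// mulrC.
    have := HM (sval i); case: (svalP i) => i0 _ /(_ i0 ie) /le_trans; apply.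
    by rewrite ler_wpM2r ?exprn_ge0// ler_norm.
  rewrite ler_wpDl// ler_pM ?invr_ge0 ?exprn_ge0//.
    by rewrite lef_pV2 ?posrE ?exprn_gt0// lerXn2r ?nnegrE// ltW.
  by apply: HD => //; case: tf.
have C10 : 0 <= `|C1| by [].
exists `|C1|, N1; split => // t f B t0 tr tf fB.
have B0 : 0 <= B by apply: le_trans (fB 0%N 0 isT).
have := H1 (exist _ t (conj t0 tr)) f B tf fB.
rewrite /T/= normrM ger0_norm ?invr_ge0 ?exprn_ge0//.
rewrite ler_pdivrMl ?exprn_gt0 ?normr_gt0// => /le_trans; apply.
by rewrite mulrA (mulrC (_ ^+ q)) -!mulrA ler_wpM2r ?ler_norm// mulr_ge0// exprn_ge0.
Qed.

Lemma smooth_bump_scale t : smooth (fun y => bumpf (y / t)).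
Proof.
have := @smooth_dil R (@bumpf R) 0 t (@smooth_bump R).
by congr smooth; apply/funext => y; rewrite subr0.
Qed.

(* Decomposing g over dyadic shells extends the bound of [cdistr_ubp] from
   compactly supported functions to decaying ones. *)
Lemma cdistr_decay : exists (C : R) (N : nat), 0 <= C /\ forall t g (A : R),
  t != 0 -> `|t| <= 1 -> smooth g ->
  (forall m y, (m <= N)%N -> (1 + `|y|) ^+ (q.+1 + N) * `|derive1n m g y| <= A) ->
  `|L (dil g c t)| <= C * `|t| ^+ q * A.
Proof.
have [r r0 HLr] := cdistr_eq_on.
(* A plateau of radius [rho / 2] about [c] covers the interval that [L] sees. *)
pose rho := 2 * (r + 1 + `|c|).
have rho1 : 1 <= rho by rewrite /rho; have := normr_ge0 c; lra.
have [C [N [C0 HC]]] := cdistr_ubp (2 * rho).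
(* A dyadic shell: [beta] also vanishes for [|u| <= 1 / 4], so the decay of [g] gains a power of
   [2^j / 4] on the shell of scale [2^j]. *)
pose beta (u : R) := bumpf u - bumpf (2 * u).
have sb2 : smooth (fun u : R => bumpf (2 * u)).
  have := @smooth_compZ R (@bumpf R) 2 0 (@smooth_bump R).
  by congr smooth; apply/funext => u; rewrite addr0.
have tb : test1 (@bumpf R) by split; [exact: smooth_bump|move=> x /ltW; exact: bump0].
have tbeta : test1 beta.
  split; first exact: smoothB (@smooth_bump R) sb2.
  move=> x x1; rewrite /beta !bump0 ?subrr ?(ltW x1)// normrM ger0_norm//; lra.
have [Bb Bb0 HBb] := test1_bounded N tb.
have [Be Be0 HBe] := test1_bounded N tbeta.
pose K := 2 ^+ N * Bb + 2 ^+ N * (4 ^+ (q.+1 + N) * Be).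
have K1 : 0 <= 2 ^+ N * Bb by rewrite mulr_ge0 ?exprn_ge0.
have K2 : 0 <= 2 ^+ N * (4 ^+ (q.+1 + N) * Be) by rewrite !mulr_ge0 ?exprn_ge0.
exists (C * K), N; split; first by rewrite mulr_ge0// addr_ge0.
move=> t g A t0 t1 sg gA.
have A0 : 0 <= A.
  by apply: le_trans (gA 0%N 0 isT); rewrite mulr_ge0// exprn_ge0// addr_ge0.
have pw1 (y : R) : 1 <= (1 + `|y|) ^+ (q.+1 + N) by rewrite exprn_ege1// lerDl.
have gA' m y : (m <= N)%N -> `|derive1n m g y| <= A.
  by move=> mN; apply: le_trans (gA m y mN); rewrite ler_peMl.
have tpos : 0 < `|t| by rewrite normr_gt0.
have spos j : 0 < 2 ^+ j :> R by rewrite exprn_gt0.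
have pow2 j : 1 <= (2 : R) ^+ j by rewrite exprn_ege1// ler1n.
pose b j (y : R) := bumpf (y / 2 ^+ j).
have sb j : smooth (b j) := @smooth_bump_scale (2 ^+ j).
pose h j y := g y * b j y.
have sh j : smooth (h j) := smoothM sg (@sb j).
(* The shell of scale [2^(j+1)] costs its power [q] through the scaled bound and gains its power
   [q + 1] through the decay of [g]. The remaining factor [2^-(j+1)] produces the partial geometric
   sum [1 - 2^-j]. *)
have bnd j : 2 ^+ j * `|t| <= 2 * rho ->
    `|L (dil (h j) c t)| <= C * `|t| ^+ q * (2 ^+ N * Bb + (2 ^+ N * (4 ^+ (q.+1 + N) * Be)) * (1 - 2^-1 ^+ j)) * A.
  elim: j => [|j IH] jr.
    rewrite expr0 subrr mulr0 addr0 -mulrA.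
    apply: (HC t _ _ t0); first by rewrite expr0 mul1r in jr.
      split; first exact: sh.
      by move=> x x1; rewrite /h /b expr0 divr1 bump0 ?mulr0// ltW.
    move=> m x mN.
    have := @leibniz_bound R N g (b 0%N) x A Bb 1 sg (@sb 0%N) A0 Bb0 ler01.
    move=> /(_ _ _ m mN); rewrite expr1n mulr1.
    move=> /(_ _ _)/le_trans; apply.
    - by move=> i iN; rewrite expr1n mulr1; exact: gA'.
    - move=> i iN; rewrite expr1n mulr1 /b (_ : (fun _ => _) = @bumpf R); first exact: HBb.
      by apply/funext => y; rewrite expr0 divr1.
    by rewrite (mulrC A) mulrA ler_wpM2r// ler_wpM2r// ler_weXn2l// ler1n.
  have jr' : 2 ^+ j * `|t| <= 2 * rho.
    by apply: le_trans jr; rewrite ler_wpM2r// ler_weXn2l// ler1n.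
  pose fj (u : R) := g (2 ^+ j.+1 * u) * beta u.
  have sgj : smooth (fun u => g (2 ^+ j.+1 * u)).
    have := @smooth_compZ R g (2 ^+ j.+1) 0 sg.
    by congr smooth; apply/funext => u; rewrite addr0.
  have sfj : smooth fj := smoothM sgj tbeta.1.
  have hE : dil (h j.+1) c t = fun y => 1 * dil (h j) c t y + dil fj c (2 ^+ j.+1 * t) y.
    apply/funext => y; rewrite /dil /h /fj /beta /b mul1r.
    have -> : (y - c) / (2 ^+ j.+1 * t) = (y - c) / t / 2 ^+ j.+1.
      by rewrite invfM mulrA mulrAC.
    rewrite mulrC [2 ^+ j.+1 * _]mulrC divfK ?gt_eqF// mulrC.
    have -> : 2 * ((y - c) / t / 2 ^+ j.+1) = (y - c) / t / 2 ^+ j.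
      by rewrite exprS invfM; field; rewrite gt_eqF//= t0.
    by ring.
  rewrite hE (@cdistr_linear 1 _ _ (@smooth_dilE _ c t (@sh j)) (@smooth_dilE _ c (2 ^+ j.+1 * t) sfj)).
  rewrite mul1r; apply: (le_trans (ler_normD _ _)).
  have H2 : `|L (dil fj c (2 ^+ j.+1 * t))| <= C * `|2 ^+ j.+1 * t| ^+ q *
      (2 ^+ N * (A * 4 ^+ (q.+1 + N) * (2^-1 ^+ j.+1) ^+ q.+1 * Be)).
    apply: HC.
    - by rewrite mulf_neq0// gt_eqF.
    - by rewrite normrM ger0_norm ?(ltW (spos _)).
    - split => // x x1; rewrite /fj; have [_ ->] := tbeta => //; by rewrite mulr0.
    move=> m x mN.
    have [x4|x4] := ltP `|x| 4^-1.
      rewrite (@derive1n_eq_open (ball 0 4^-1) fj (cst 0)) ?derive1n_cst.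
      - case: (m) => [|?]; rewrite normr0 !mulr_ge0// ?exprn_ge0 ?invr_ge0 ?exprn_ge0//.
      - by apply: ball_open; rewrite invr_gt0.
      - move=> y; rewrite /ball/= sub0r normrN => y4.
        rewrite /fj /beta !bump1 ?subrr ?mulr0// ?normrM ?(ger0_norm (ler0n R 2)); lra.
      - by rewrite /ball/= sub0r normrN.
    have A'0 : 0 <= A * 4 ^+ (q.+1 + N) * (2^-1 ^+ j.+1) ^+ q.+1.
      by rewrite !mulr_ge0// ?exprn_ge0 ?invr_ge0 ?exprn_ge0.
    have := @leibniz_bound R N (fun u => g (2 ^+ j.+1 * u)) beta x
      (A * 4 ^+ (q.+1 + N) * (2^-1 ^+ j.+1) ^+ q.+1) Be 1 sgj tbeta.1 A'0 Be0 ler01.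
    move=> /(_ _ _ m mN); rewrite expr1n mulr1.
    move=> H; apply: (le_trans (H _ _)).
    - move=> i iN; rewrite expr1n mulr1.
      have := @derive1n_comp_affine R g (2 ^+ j.+1) 0 i sg.
      rewrite (_ : (fun x => g (_ + 0)) = (fun u => g (2 ^+ j.+1 * u))); last first.
        by apply/funext => u; rewrite addr0.
      move=> ->; rewrite addr0 normrM ger0_norm ?exprn_ge0 ?(ltW (spos _))//.
      have H1 := gA i (2 ^+ j.+1 * x) iN.
      have H3 : (2 ^+ j.+1 / 4) ^+ (q.+1 + N) * `|derive1n i g (2 ^+ j.+1 * x)| <= A.
        apply: le_trans H1; apply: ler_wpM2r => //.
        rewrite lerXn2r ?nnegrE ?divr_ge0 ?addr_ge0 ?(ltW (spos _))//.
        rewrite normrM [X in 1 + X * _]ger0_norm ?(ltW (spos _))//.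
        by rewrite ler_wpDl// ler_wpM2l// ltW.
      rewrite (@le_trans _ _ ((2 ^+ j.+1) ^+ N * `|derive1n i g (2 ^+ j.+1 * x)|))//.
        by rewrite ler_wpM2r// ler_weXn2l.
      move: H3; rewrite expr_div_n mulrAC ler_pdivrMr ?exprn_gt0//.
      move=> H4; rewrite !exprVn ler_pdivlMr ?exprn_gt0//; apply: le_trans H4.
      by rewrite exprD le_eqVlt; apply/orP; left; apply/eqP; ring.
    - by move=> i iN; rewrite expr1n mulr1; exact: HBe.
    by rewrite ler_wpM2r ?mulr_ge0// ler_weXn2l// ler1n.
  apply: (le_trans (lerD (IH jr') H2)).
  rewrite normrM (ger0_norm (ltW (spos _))) exprMn.
  have -> : C * ((2 ^+ j.+1) ^+ q * `|t| ^+ q) *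
     (2 ^+ N * (A * 4 ^+ (q.+1 + N) * (2^-1 ^+ j.+1) ^+ q.+1 * Be)) =
     ((2 ^+ j.+1) ^+ q * (2^-1 ^+ j.+1) ^+ q) * (C * `|t| ^+ q * (2 ^+ N * (4 ^+ (q.+1 + N) * Be) * 2^-1 ^+ j.+1) * A).
    by rewrite [(2^-1 ^+ j.+1) ^+ q.+1]exprS; ring.
  rewrite -exprMn -exprMn mulfV// !expr1n mul1r.
  by rewrite le_eqVlt; apply/orP; left; apply/eqP; rewrite exprS; field.
(* The least [j] with the second property has the first by minimality, or for [j = 0] because
   [|t| <= 1 <= rho]. *)
have [j [j1 j2]] : exists j, 2 ^+ j * `|t| <= 2 * rho /\ rho <= 2 ^+ j * `|t|.
  have [n Hn] : exists n, rho / `|t| <= 2 ^+ n.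
    exists (Num.truncn (rho / `|t|)).+1.
    apply: (le_trans (ltW (truncnS_gt _))); rewrite -natrX ler_nat.
    exact/ltnW/ltn_expl.
  have [j Hj Hmin] := ex_minnP (ex_intro (fun n => rho / `|t| <= 2 ^+ n) n Hn).
  exists j; split; last by rewrite -ler_pdivrMr.
  case: j Hj Hmin => [|j] Hj Hmin; first by rewrite expr0 mul1r; lra.
  have : ~~ (rho / `|t| <= 2 ^+ j) by apply/negP => /Hmin; rewrite ltnn.
  by rewrite -ltNge ltr_pdivlMr// exprS -mulrA => /ltW; rewrite ler_pM2l.
have -> : L (dil g c t) = L (dil (h j) c t).
  apply: (HLr _ _ (@smooth_dilE _ c t sg) (@smooth_dilE _ c t (@sh j))).
  move=> x xr; rewrite /dil /h /b bump1 ?mulr1//.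
  rewrite !normrM !normfV (ger0_norm (ltW (spos j))) -mulrA -invfM.
  rewrite ler_pdivrMr ?mulr_gt0// mulrC mulrC.
  have := ler_normB x c; move: j2; rewrite mulrC /rho; lra.
apply: (le_trans (bnd j j1)); rewrite ler_wpM2r// (mulrC C K) (mulrAC _ C) mulrC.
rewrite [K * _ * C]mulrAC -[leRHS]mulrA [K * _]mulrC mulrC.
rewrite ler_wpM2l ?mulr_ge0 ?exprn_ge0//.
rewrite /K lerD2l -[leRHS]mulr1 ler_wpM2l// gerBl exprn_ge0// invr_ge0//.
Qed.

End scaled.
End cdistr.

(** * Heat extension *)

Section kernel.
Variable R : realType.
Implicit Types (f g : R -> R) (x y a c t : R) (m n k N j : nat).

Lemma scale_realE (u v : R) : u *: v = u * v.
Proof. by []. Qed.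

Lemma derive1n_derive1n f m j : derive1n j (derive1n m f) = derive1n (m + j) f.
Proof. by rewrite /derive1n -iterD addnC. Qed.

(** The [m]-th derivative in [y] of [t^-1 exp (- ((y - x) / t)^2)]. Up to the factor [sqrt pi] this
    is the standard heat kernel at time [t^2 / 4], whence the coefficient [t / 2] in its
    equation. *)
Definition kap m x t y : R := (t ^+ m.+1)^-1 * derive1n m gauss_fun ((y - x) / t).

Lemma smooth_kap m x t : smooth (kap m x t).
Proof.
exact: (@smoothZ R _ _ (@smooth_dil R _ x t (@smooth_derive1n R _ m (@smooth_gauss R)))).
Qed.

Lemma derive1n_kap j m x t : derive1n j (kap m x t) = kap (m + j) x t.
Proof.
have sg := @smooth_derive1n R _ m (@smooth_gauss R).
rewrite /kap (@derive1nZ R (t ^+ m.+1)^-1 _ j (@smooth_dil R _ x t sg)).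
rewrite (@derive1n_dil R _ x t j sg).
apply/funext => y; rewrite derive1n_derive1n mulrA -invfM -exprD.
by rewrite addSn.
Qed.

Lemma kap_bound m : exists2 C : R, 0 <= C &
  forall x t y, 0 < t -> `|kap m x t y| <= C * (t ^+ m.+1)^-1.
Proof.
have [C C0 HC] := gauss_decay R m 0; exists C => // x t y t0.
rewrite /kap normrM ger0_norm ?invr_ge0 ?exprn_ge0 ?(ltW t0)//.
rewrite mulrC ler_wpM2r ?invr_ge0 ?exprn_ge0 ?(ltW t0)//.
by have := HC ((y - x) / t); rewrite expr0 mul1r.
Qed.

Lemma kap_bound_ge m t0 : 0 < t0 -> exists2 C : R, 0 <= C &
  forall x t y, t0 <= t -> `|kap m x t y| <= C.
Proof.
move=> t00; have [C C0 HC] := kap_bound m; exists (C * (t0 ^+ m.+1)^-1).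
  by rewrite mulr_ge0// invr_ge0 exprn_ge0// ltW.
move=> x t y t0t; have t_gt0 := lt_le_trans t00 t0t.
apply: (le_trans (HC _ _ _ t_gt0)); rewrite ler_wpM2l//.
by rewrite lef_pV2 ?posrE ?exprn_gt0// lerXn2r ?nnegrE// ltW.
Qed.

Lemma kap_dx m x t y : is_derive x 1 (fun x => kap m x t y) (- kap m.+1 x t y).
Proof.
have H1 := smooth_is_derive m ((y - x) / t) (@smooth_gauss R).
have H2 : is_derive x (1 : R) (fun x => (y - x) / t) (- t^-1).
  have H := is_deriveZ t^-1 (is_deriveB (is_derive_cst y x 1) (is_derive_id x 1)).
  have E : (fun x => (y - x) / t) = t^-1 *: (cst y - id).
    by apply/funext => z; rewrite /= mulrC.
  by rewrite E; apply: (is_derive_eq H); rewrite sub0r /GRing.scale/= mulrN1.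
have H3 := @is_derive1_comp R _ (fun x => (y - x) / t) x _ _ H1 H2.
have H := is_deriveZ (t ^+ m.+1)^-1 H3.
apply: (is_derive_eq H); rewrite /kap /GRing.scale/= mulrN mulrN; congr (- _).
by rewrite [in RHS]exprS invfM; ring.
Qed.

Lemma is_derive_invX m t : t != 0 ->
  is_derive t 1 (fun t => (t ^+ m)^-1) (- m%:R * (t ^+ m.+1)^-1).
Proof.
move=> t0; have H1 := @is_deriveX _ _ id m t 1 1 (is_derive_id t 1).
have tm0 : (id ^+ m) t != 0 :> R by rewrite fctE expf_neq0.
have H := @is_deriveV R _ t _ 1 tm0 H1.
have E : (fun t : R => (t ^+ m)^-1) = (fun y => ((id ^+ m : R -> R) y)^-1).
  by apply/funext => y; rewrite fctE.
rewrite E; apply: (is_derive_eq H); rewrite fctE /GRing.scale/=.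
case: m {H1 tm0 H E} => [|m]; first by rewrite !mul0r mulr0 oppr0 mul0r.
rewrite mulr1 /= mulNr mulNr; congr (- _).
have p0 : t ^+ m != 0 by rewrite expf_neq0.
rewrite [t ^+ m.+2]exprS [t ^+ m.+1]exprS; move: (t ^+ m) p0 => p p0.
by field; rewrite t0 p0.
Qed.

(** Hermite's recurrence turns the derivative of the scaling into a second derivative in space. *)
Lemma kap_dt m x t y : 0 < t ->
  is_derive t 1 (fun t => kap m x t y) (t / 2 * kap m.+2 x t y).
Proof.
move=> t0; have tn : t != 0 by rewrite gt_eqF.
have H1 := smooth_is_derive m ((y - x) / t) (@smooth_gauss R).
have H2 : is_derive t (1 : R) (fun t => (y - x) / t) (- (y - x) / t ^+ 2).
  have H := is_deriveZ (y - x) (@is_deriveV R id t _ 1 tn (is_derive_id t 1)).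
  by apply: (is_derive_eq H); rewrite /GRing.scale/=; field.
have H3 := @is_derive1_comp R _ (fun t => (y - x) / t) t _ _ H1 H2.
have H := is_deriveM (is_derive_invX m.+1 tn) H3.
apply: (is_derive_eq H); rewrite /kap derive1n_gaussSS !scale_realE /comp.
move: (derive1n m.+1 _ _) (derive1n m _ _) => G1 G0.
have p0 : t ^+ m != 0 by rewrite expf_neq0.
rewrite -(natr1 m) [t ^+ m.+3]exprS [t ^+ m.+2]exprS [t ^+ m.+1]exprS.
by move: (t ^+ m) p0 => p p0; field; rewrite tn p0.
Qed.

Variable L : (R -> R) -> R.
Hypothesis cL : cdistr L.

Definition heat m x t : R := L (kap m x t).

Lemma heat_bound m t0 : 0 < t0 -> exists2 C : R, 0 <= C &
  forall x t, t0 <= t -> `|heat m x t| <= C.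
Proof.
move=> t00; have [r [C [N [r0 C0 HL]]]] := cdistr_continuous cL.
have [|j B B' BB' H x t y t0t|B B0 HB] := @exists_uniform R N
  (fun j B => forall x t y, t0 <= t -> `|kap (m + j) x t y| <= B).
- by move=> j; exact: kap_bound_ge.
- exact: le_trans (H _ _ _ t0t) BB'.
exists (C * B); first exact: mulr_ge0.
move=> x t t0t; apply: HL; first exact: smooth_kap.
by move=> j y jN _; rewrite derive1n_kap; exact: HB.
Qed.

Lemma heat_dx m x t : 0 < t -> is_derive x 1 (fun x => heat m x t) (- heat m.+1 x t).
Proof.
move=> t0; rewrite /heat -mulN1r -(cdistrZ cL (-1) (@smooth_kap m.+1 x t)).
apply: (@pairing_is_derive R L cL (fun x => kap m x t) _ x 1 ltr01).
- by move=> s; exact: smooth_kap.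
- exact: (@smoothZ R (-1) _ (@smooth_kap m.+1 x t)).
move=> j; have [C C0 HC] := kap_bound_ge (m.+2 + j) t0; exists C => // h y h1.
rewrite (@derive1nZ R (-1) _ j (@smooth_kap m.+1 x t)) !derive1n_kap mulN1r.
apply: (@taylor2 R (fun x => kap (m + j) x t y) (fun x => - kap (m + j).+1 x t y)
  (fun x => kap (m + j).+2 x t y) x h 1 C h1) => u _.
- exact: kap_dx.
- by apply: (is_derive_eq (is_deriveN (kap_dx _ u t y))); rewrite opprK.
- exact: HC.
Qed.

Lemma heat_dt m x t : 0 < t ->
  is_derive t 1 (fun t => heat m x t) (t / 2 * heat m.+2 x t).
Proof.
move=> t0; rewrite /heat -(cdistrZ cL (t / 2) (@smooth_kap m.+2 x t)).
have t20 : 0 < t / 2 by rewrite divr_gt0.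
apply: (@pairing_is_derive R L cL (fun t => kap m x t) _ t (t / 2) t20).
- by move=> s; exact: smooth_kap.
- exact: (@smoothZ R (t / 2) _ (@smooth_kap m.+2 x t)).
move=> j; have [C C0 HC] := kap_bound_ge (m.+2 + j) t20.
have [C' C'0 HC'] := kap_bound_ge (m.+4 + j) t20.
exists (C / 2 + t ^+ 2 * C'); first by apply: addr_ge0; [exact: divr_ge0|exact: mulr_ge0 (sqr_ge0 _) C'0].
move=> h y ht.
rewrite (@derive1nZ R (t / 2) _ j (@smooth_kap m.+2 x t)) !derive1n_kap.
have ut u : `|u - t| <= t / 2 -> t / 2 <= u <= 3 / 2 * t.
  by rewrite ler_norml; lra.
apply: (@taylor2 R (fun t => kap (m + j) x t y) (fun t => t / 2 * kap (m + j).+2 x t y)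
  (fun t => 2^-1 * kap (m + j).+2 x t y + t / 2 * (t / 2 * kap (m + j).+4 x t y))
  t h (t / 2)) => // u /ut /andP[u1 u2].
- by apply: kap_dt; exact: lt_le_trans u1.
- have u0 : 0 < u by exact: lt_le_trans u1.
  have H1 : is_derive u (1 : R) (fun u => u / 2) 2^-1.
    have H := is_deriveZ (2^-1 : R) (is_derive_id u 1).
    have E : (fun u : R => u / 2) = 2^-1 *: id by apply/funext => z; rewrite /= mulrC.
    by rewrite E; apply: (is_derive_eq H); rewrite scale_realE mulr1.
  have H := is_deriveM H1 (kap_dt (m + j).+2 x y u0).
  by apply: (is_derive_eq H); rewrite !scale_realE;
    move: (kap _ _ _ _) (kap _ _ _ _) => A B; ring.
- apply: (le_trans (ler_normD _ _)); apply: lerD.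
    by rewrite normrM ger0_norm ?invr_ge0// mulrC ler_wpM2r ?invr_ge0//; exact: HC.
  have u0 : 0 <= u / 2 by lra.
  rewrite mulrA normrM (ger0_norm (mulr_ge0 u0 u0)); apply: ler_pM => //.
  - by rewrite mulr_ge0.
  - by rewrite expr2; nra.
  - exact: HC'.
Qed.

End kernel.

(** * Maximum principle for the heat equation *)

Section maximum_principle.
Variable R : realType.
Implicit Types (f g : R -> R) (x y a c d t : R) (m n k N j : nat).

Lemma second_derivative_min f g (l x r : R) : 0 < r ->
  (forall y, `|y - x| <= r -> is_derive y 1 f (g y)) -> is_derive x 1 g l ->
  (forall y, `|y - x| <= r -> f x <= f y) -> 0 <= l.
Proof.
move=> r0 fg gl fmin.
have xr y : x - r < y < x + r -> `|y - x| <= r by rewrite ler_norml; lra.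
have gx : g x = 0.
  have H : is_derive x (1 : R) f 0.
    apply: (@derive1_at_min R f (x - r) (x + r) x).
    - lra.
    - by move=> y; rewrite in_itv/= => /xr /fg [].
    - by rewrite in_itv/=; lra.
    - by move=> y; rewrite in_itv/= => /xr /fmin.
  have H' : is_derive x (1 : R) f (g x) by apply: fg; rewrite subrr normr0 ltW.
  by rewrite -(@derive_val _ _ _ _ _ _ _ H') (@derive_val _ _ _ _ _ _ _ H).
rewrite leNgt; apply/negP => l0.
have [gd gE] := gl.
have cv : h^-1 *: (g (h *: (1 : R) + x) - g x) @[h --> 0^'] --> l by rewrite -gE; exact: gd.
have nl : 0 < - l by rewrite oppr_gt0.
move/cvgrPdist_lt : cv => /(_ _ nl); rewrite near_withinE => /nbhs_ballP [e /= e0 He].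
pose h := Num.min (e / 2) r.
have h0 : 0 < h by rewrite lt_min divr_gt0.
have hr : h <= r by rewrite ge_min lexx orbT.
have he : h <= e / 2 by rewrite ge_min lexx.
have g_neg (u : R) : 0 < u -> u <= h -> g (x + u) < 0.
  move=> u0 uh; have := He u; rewrite /ball/= sub0r normrN ger0_norm ?(ltW u0)//.
  have -> : u < e by lra.
  move=> /(_ isT (lt0r_neq0 u0)); rewrite [u%:A]mulr1 gx subr0 (addrC u x).
  rewrite scale_realE ltr_norml => /andP[H1 _].
  have : u^-1 * g (x + u) < 0 by lra.
  by rewrite pmulr_rlt0// invr_gt0.
have fD u v : x <= u -> u <= v -> v <= x + h -> exists2 w, u <= w <= v & f v - f u = g w * (v - u).
  move=> xu uv vx; have [||w] := @MVT_segment R f g u v uv.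
  - by move=> z; rewrite in_itv/= => zh; apply: fg; rewrite ler_norml; lra.
  - apply: derivable_within_continuous => z; rewrite in_itv/= => zh.
    by have [] := fg z; rewrite ?ler_norml//; lra.
  by rewrite in_itv/= => wuv ->; exists w.
(* The mean value point of the first half may be [x] itself, where [g] vanishes; the second half
   makes the decrease strict. *)
have [|||w1 w1h f1] := fD x (x + h / 2); [lra..|].
have [|||w2 w2h f2] := fD (x + h / 2) (x + h); [lra..|].
have g1 : g w1 <= 0.
  have [->|w1x] := eqVneq w1 x; first by rewrite gx.
  have := g_neg (w1 - x); rewrite (addrC x) subrK => H; apply/ltW/H; last lra.
  by rewrite subr_gt0 lt_neqAle eq_sym w1x; lra.
have g2 : g w2 < 0.
  by have := g_neg (w2 - x); rewrite (addrC x) subrK => H; apply: H; lra.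
have := fmin (x + h); rewrite ler_norml => F1.
have {}F1 : f x <= f (x + h) by apply: F1; lra.
nra.
Qed.

Lemma is_derive_left_min f (l x r : R) : 0 < r -> is_derive x 1 f l ->
  (forall y, x - r <= y <= x -> f x <= f y) -> l <= 0.
Proof.
move=> r0 [fd fE] fmin; rewrite leNgt; apply/negP => l0.
have cv : h^-1 *: (f (h *: (1 : R) + x) - f x) @[h --> 0^'] --> l by rewrite -fE; exact: fd.
move/cvgrPdist_lt : cv => /(_ _ l0); rewrite near_withinE => /nbhs_ballP [e /= e0 He].
pose h := Num.min (e / 2) r.
have h0 : 0 < h by rewrite lt_min divr_gt0.
have hr : h <= r by rewrite ge_min lexx orbT.
have he : h <= e / 2 by rewrite ge_min lexx.
have := He (- h); rewrite /ball/= sub0r opprK ger0_norm ?(ltW h0)//.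
have -> : h < e by lra.
have hn : - h != 0 by rewrite oppr_eq0 gt_eqF.
move=> /(_ isT hn); rewrite [(- h)%:A]mulr1 scale_realE.
have : (- h)^-1 * (f (- h + x) - f x) <= 0.
  rewrite nmulr_rle0 ?invr_lt0 ?oppr_lt0// subr_ge0 fmin//; lra.
by rewrite ltr_norml; lra.
Qed.

Lemma heat_maximum_principle (H Hx Hxx Ht : R -> R -> R) c d (t0 t1 : R) :
  0 < t0 ->
  (forall x t, 0 < t -> {for (x, t), continuous (fun p : R * R => H p.1 p.2)}) ->
  (forall x t, 0 < t -> is_derive x 1 (H^~ t) (Hx x t)) ->
  (forall x t, 0 < t -> is_derive x 1 (Hx^~ t) (Hxx x t)) ->
  (forall x t, 0 < t -> is_derive t 1 (H x) (Ht x t)) ->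
  (forall x t, c <= x <= d -> 0 < t -> t / 2 * Hxx x t <= Ht x t) ->
  (forall x, c <= x <= d -> 0 <= H x t0) ->
  (forall t, t0 <= t <= t1 -> 0 <= H c t) -> (forall t, t0 <= t <= t1 -> 0 <= H d t) ->
  forall x t, c <= x <= d -> t0 <= t <= t1 -> 0 <= H x t.
Proof.
move=> t00 cH dHx dHxx dHt heatH Hbot Hc Hd x t xcd tt.
rewrite leNgt; apply/negP => Hxt.
(* A slope in time that turns the differential inequality into a strict one, yet raises the negative
   value at [(x, t)] by at most half its size. *)
pose k := - H x t / (2 * (t - t0 + 1)).
have tt0 : 0 < 2 * (t - t0 + 1) by lra.
have k0 : 0 < k by rewrite divr_gt0// oppr_gt0.
have kE : k * (t - t0) <= - H x t / 2.
  rewrite /k mulrAC ler_pdivrMr//.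
  have nH : 0 < - H x t by rewrite oppr_gt0.
  nra.
pose A : set (R * R) := `[c, d] `*` `[t0, t1].
pose G (p : R * R) := H p.1 p.2 + k * (p.2 - t0).
have Axt : A (x, t) by split; rewrite /= in_itv.
have cA : compact A by apply: compact_setX; exact: segment_compact.
have cG : {within A, continuous G}.
  apply: continuous_in_subspaceT => -[u v] /set_mem [_ /=]; rewrite in_itv/= => /andP[v0 _].
  apply: cvgD; first by apply: cH; exact: lt_le_trans v0.
  apply: cvgMr; apply: cvgB; last exact: cvg_cst.
  exact: cvg_snd.
have [|[u s] /set_mem [/= ucd stt] Gmin] := compact_EVT_min _ cA cG; first by exists (x, t).
rewrite !in_itv/= in ucd stt.
have Gus : G (u, s) < 0.
  apply: (@le_lt_trans _ _ (G (x, t))); first by apply: Gmin; exact/mem_set.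
  by rewrite /G/=; lra.
have Hus : H u s < 0.
  move: Gus; rewrite /G/=; have : 0 <= k * (s - t0) by rewrite mulr_ge0 ?(ltW k0)//; lra.
  lra.
have uc : c < u.
  rewrite lt_neqAle; apply/andP; split; last by lra.
  by apply/eqP => E; move: Hus; rewrite -E ltNge Hc//.
have ud : u < d.
  rewrite lt_neqAle; apply/andP; split; last by lra.
  by apply/eqP => E; move: Hus; rewrite E ltNge Hd//.
have st : t0 < s.
  rewrite lt_neqAle; apply/andP; split; last by lra.
  by apply/eqP => E; move: Hus; rewrite -E ltNge Hbot//.
have s0 : 0 < s by exact: lt_trans st.
have Hxx0 : 0 <= Hxx u s.
  apply: (@second_derivative_min (H^~ s) (Hx^~ s) _ u (Num.min (u - c) (d - u))).
  - by rewrite lt_min !subr_gt0 uc.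
  - by move=> y _; exact: dHx.
  - exact: dHxx.
  - move=> y; rewrite le_min !ler_norml => yu.
    have := Gmin (y, s); rewrite /G/= lerD2r; apply; apply/mem_set; split; rewrite /= in_itv/=; lra.
(* The minimum may sit at the final time, so it is compared with earlier times only. *)
have : Ht u s + k <= 0.
  apply: (@is_derive_left_min (fun v => H u v + k * (v - t0)) _ s (s - t0)).
  - by rewrite subr_gt0.
  - have D := is_deriveD (dHt u s s0) (is_deriveZ k (is_deriveB (is_derive_id s 1) (is_derive_cst t0 s 1))).
    by apply: (is_derive_eq D); rewrite scale_realE subr0 mulr1.
  - move=> y ys; have := Gmin (u, y); apply; apply/mem_set; split; rewrite /= in_itv/=; lra.
have := heatH u s ucd s0.
have : 0 <= s / 2 * Hxx u s by rewrite mulr_ge0// divr_ge0// ltW.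
lra.
Qed.

End maximum_principle.

(** * The part of the kernel near an end of a gap *)

Section edge.
Variable R : realType.
Implicit Types (f g : R -> R) (x y a c d t z : R) (m n k N j : nat).

Lemma step_derive_bounded N : exists2 B : R, 0 <= B &
  forall m x, (m <= N)%N -> `|derive1n m (@step R) x| <= B.
Proof.
have [B B0 HB] := @smooth_bounded R (@step R) N 2 (@smooth_step R).
exists (B + 1) => [|m x mN]; first exact: addr_ge0.
have [x2|x2] := leP `|x| 2; first by rewrite (le_trans (HB m x mN x2))// lerDl.
have [x0|x0] := ltP x 0.
  rewrite (@derive1n_eq_open R [set y | y < 0] _ (cst 0))//.
  - rewrite derive1n_cst; case: m mN => [|m] _; by rewrite normr0 addr_ge0.
  - by move=> y /= y0; rewrite step0// ltW.
rewrite (@derive1n_eq_open R [set y | 1 < y] _ (cst 1))//.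
- rewrite derive1n_cst; case: m mN => [|m] _; first by rewrite normr1 lerDr.
  by rewrite normr0 addr_ge0.
- by move=> y /= y0; rewrite step1// ltW.
- by move=> /=; move: x2; rewrite ger0_norm//; lra.
Qed.

(** The cut-off is one-sided: it removes from the kernel everything beyond the corner as well. The
    transition between thirds leaves a margin of [t / 3] inside the gap at scale [t]. *)
Definition cutf y : R := 1 - step (3 * y - 1).

Lemma smooth_cut : smooth cutf.
Proof. exact: (smoothB (@smooth_cst R 1) (@smooth_compZ R (@step R) 3 (- 1) (@smooth_step R))). Qed.

Lemma cut_le1 y : cutf y <= 1.
Proof. by rewrite lerBlDr lerDl step_ge0. Qed.

Lemma cut1 y : y <= 1 / 3 -> cutf y = 1.
Proof. by move=> y1; rewrite /cutf step0 ?subr0//; lra. Qed.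

Lemma cut0 y : 2 / 3 <= y -> cutf y = 0.
Proof. by move=> y1; rewrite /cutf step1 ?subrr//; lra. Qed.

Lemma cut_derive_bounded N : exists2 B : R, 0 <= B &
  forall m x, (m <= N)%N -> `|derive1n m cutf x| <= B.
Proof.
have [B B0 HB] := step_derive_bounded N.
exists (1 + 3 ^+ N * B) => [|m x mN]; first by rewrite addr_ge0// mulr_ge0// exprn_ge0.
have := @smooth_compZ R (@step R) 3 (- 1) (@smooth_step R) => s3.
rewrite /cutf (derive1nB m (@smooth_cst R 1) s3) (@derive1n_comp_affine R _ 3 (-1) m (@smooth_step R)).
apply: (le_trans (ler_normB _ _)); apply: lerD.
  rewrite derive1n_cst; case: m mN => [|m] _; by rewrite ?normr1// normr0.
rewrite normrM normrX ger0_norm//; apply: ler_pM => //; last exact: HB.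
by rewrite ler_weXn2l// ler1n.
Qed.

Definition cutgauss y : R := cutf y * gauss_fun y.

Lemma cutgauss_decay N k : exists2 C : R, 0 <= C & forall m y, (m <= N)%N ->
  (1 + `|y|) ^+ k * `|derive1n m cutgauss y| <= C.
Proof.
have [B B0 HB] := cut_derive_bounded N.
have [|C C0 HC] := @exists_uniform R N
   (fun m C => forall y, (1 + `|y|) ^+ k * `|derive1n m (@gauss_fun R) y| <= C)
   (fun m => gauss_decay R m k).
  by move=> m C C' CC' H y; exact: le_trans (H y) CC'.
exists (2 ^+ N * (B * C)) => [|m y mN]; first by rewrite !mulr_ge0// exprn_ge0.
have p0 : 0 < (1 + `|y|) ^+ k by rewrite exprn_gt0// ltr_wpDr.
have Cp : 0 <= C * ((1 + `|y|) ^+ k)^-1 by rewrite mulr_ge0// invr_ge0 ltW.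
have := @leibniz_bound R N cutf (@gauss_fun R) y B (C * ((1 + `|y|) ^+ k)^-1) 1
  smooth_cut (@smooth_gauss R) B0 Cp ler01.
move=> /(_ _ _ m mN) H.
rewrite mulrC -ler_pdivlMr//; apply: (le_trans (H _ _)).
- by move=> i iN; rewrite expr1n mulr1; exact: HB.
- by move=> i iN; rewrite expr1n mulr1 ler_pdivlMr// mulrC; exact: HC.
rewrite expr1n mulr1 -!mulrA; apply: ler_pM => //.
- by rewrite mulr_ge0.
- by rewrite ler_weXn2l// ler1n.
Qed.

Lemma derive1n_expZ m z y :
  derive1n m (fun y => expR (z * y)) y = z ^+ m * expR (z * y).
Proof.
have E k x : derive1n k (@expR R) x = expR x.
  elim: k x => // k IH x; rewrite derive1nSr (_ : derive1 _ = expR)//.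
  by apply: is_derive_derive1 => w; exact: is_derive_expR.
have se : smooth (@expR R) by apply/smoothP => n; exact: ndiff_expR.
have := @derive1n_comp_affine R expR z 0 m se.
have -> : (fun x : R => expR (z * x + 0)) = (fun x : R => expR (z * x)).
  by apply/funext => x; rewrite addr0.
by move=> ->; rewrite E addr0.
Qed.

(** In units of [t], with the corner as origin: the portion near the corner of a Gaussian centred at
    distance [z] from it. *)
Definition edge_fun z y : R := cutf y * gauss_fun (y - z).

(** Expanding the square isolates the small factor [gauss_fun z]; the exponential left over grows at
    most like [exp (2 z)], because [cutf] vanishes for [y >= 2 / 3]. *)
Lemma edge_funE z y : edge_fun z y = gauss_fun z * (expR (2 * z * y) * cutgauss y).
Proof.
rewrite /edge_fun /cutgauss /gauss_fun mulrCA; rewrite mulrA mulrCA.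
by rewrite -!expRD mulrC [RHS]mulrC; congr (expR _ * _); ring.
Qed.

Lemma smooth_edge_fun z : smooth (edge_fun z).
Proof.
have := @smooth_compZ R (@gauss_fun R) 1 (- z) (@smooth_gauss R).
move=> /(smoothM smooth_cut); congr smooth; apply/funext => y.
by rewrite mul1r.
Qed.

Lemma edge_growth N : exists2 K : R, 0 <= K & forall z, 0 <= z ->
  (1 + 2 * z) ^+ N * (gauss_fun z * expR (2 * z)) <=
  K * ((z + 1) * expR (- (5 / 6) * (z + 1) ^+ 2)).
Proof.
have [a aE] : exists a : R, forall z, - z ^+ 2 + 2 * z + (1 + 2 * z) <= a - 5 / 6 * (z + 1) ^+ 2.
  (* The difference to be bounded is [- z^2 / 6 + 17 z / 3 + 11 / 6], with maximum 50 at [z = 17].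
     Its leading coefficient is negative because the rate 5/6 is below 1. *)
  by exists 50 => z; have := sqr_ge0 (z - 17); rewrite !expr2; lra.
exists (N%:R ^+ N * expR a) => [|z z0].
  by apply: mulr_ge0; [exact: exprn_ge0|exact: expR_ge0].
have H : (1 + 2 * z) ^+ N <= N%:R ^+ N * expR (1 + 2 * z) by apply: expR_ge_pow; lra.
have {}H := ler_wpM2r (mulr_ge0 (gauss_fun_ge0 z) (expR_ge0 (2 * z))) H.
apply: (le_trans H).
rewrite -!mulrA ler_wpM2l ?exprn_ge0// /gauss_fun mulNr.
apply: (@le_trans _ _ (expR a * expR (- (5 / 6 * (z + 1) ^+ 2)))).
  by rewrite -!expRD ler_expR; have := aE z; lra.
by rewrite ler_wpM2l ?expR_ge0// ler_peMl ?expR_ge0// lerDr.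
Qed.

Variable L : (R -> R) -> R.
Hypothesis cL : cdistr L.

Definition local_bound (q : nat) c := forall f, test1 f ->
  exists2 e : R, 0 < e & exists M : R, forall t,
  t != 0 -> `|t| <= e -> `|L (dil f c t)| <= M * `|t| ^+ q.

(** The uniform bound for decaying functions is applied to [edge_fun z]. Each derivative of
    [expR (2 * z * y)] costs a factor [2 z], and [edge_growth] absorbs these powers. *)
Lemma edge_bound c : local_bound 0 c -> exists2 C : R, 0 <= C &
  forall z t, 0 <= z -> t != 0 -> `|t| <= 1 ->
  `|L (dil (edge_fun z) c t)| <= C * ((z + 1) * expR (- (5 / 6) * (z + 1) ^+ 2)).
Proof.
move=> /(cdistr_decay cL)[C [N [C0 HC]]].
have [B B0 HB] := cutgauss_decay N (1 + N).
have [K K0 HK] := edge_growth N.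
exists (C * (2 ^+ N * B * K)); first by rewrite !mulr_ge0 ?exprn_ge0.
move=> z t z0 t0 t1; rewrite -mulrA.
have sE : smooth (fun y : R => expR (2 * z * y)).
  have := @smooth_compZ R expR (2 * z) 0; have -> : (fun x : R => expR (2 * z * x + 0)) = (fun x : R => expR (2 * z * x)).
    by apply/funext => x; rewrite addr0.
  by apply; apply/smoothP => n; exact: ndiff_expR.
have scg : smooth cutgauss := smoothM smooth_cut (@smooth_gauss R).
have E : edge_fun z = fun y => gauss_fun z * (expR (2 * z * y) * cutgauss y).
  by apply/funext => y; exact: edge_funE.
have := HC t (edge_fun z) (gauss_fun z * (2 ^+ N * ((1 + 2 * z) ^+ N * expR (2 * z) * B))) t0 t1
  (@smooth_edge_fun z).
rewrite expr0 mulr1; move=> H; apply: (le_trans (H _)); last first.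
  rewrite -!mulrA ler_wpM2l//.
  have := HK z z0 => G.
  have P0 : 0 <= 2 ^+ N * B by rewrite mulr_ge0// exprn_ge0.
  have -> : gauss_fun z * (2 ^+ N * ((1 + 2 * z) ^+ N * (expR (2 * z) * B))) =
    (2 ^+ N * B) * ((1 + 2 * z) ^+ N * (gauss_fun z * expR (2 * z))) by ring.
  by rewrite [leRHS]mulrA ler_wpM2l.
move=> m y mN.
have g0 := gauss_fun_ge0 z.
have p0 : 0 < (1 + `|y|) ^+ (1 + N) by rewrite exprn_gt0// ltr_wpDr.
have [y1|y1] := ltP (2 / 3) y.
  rewrite (@derive1n_eq_open R [set y | 2 / 3 < y] _ (cst 0))//.
  - by rewrite derive1n_cst; case: m {mN} => [|m]; rewrite normr0 mulr0 !mulr_ge0 ?exprn_ge0 ?expR_ge0//; lra.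
  - by move=> w /= /ltW w1; rewrite /edge_fun cut0 ?mul0r.
rewrite E (@derive1nZ R (gauss_fun z) _ m (smoothM sE scg)) normrM (ger0_norm g0).
rewrite mulrCA ler_wpM2l// mulrC -ler_pdivlMr//.
have Bp : 0 <= B * ((1 + `|y|) ^+ (1 + N))^-1 by rewrite mulr_ge0// invr_ge0 ltW.
have Ep : 0 <= (1 + 2 * z) ^+ N * expR (2 * z) by rewrite mulr_ge0 ?expR_ge0// exprn_ge0//; lra.
have := @leibniz_bound R N _ cutgauss y ((1 + 2 * z) ^+ N * expR (2 * z)) (B * ((1 + `|y|) ^+ (1 + N))^-1) 1
  sE scg Ep Bp ler01.
move=> /(_ _ _ m mN) H1; apply: (le_trans (H1 _ _)).
- move=> i iN; rewrite expr1n mulr1 derive1n_expZ normrM.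
  apply: ler_pM => //.
    rewrite normrX ger0_norm; last by lra.
    apply: (@le_trans _ _ ((1 + 2 * z) ^+ i)).
      by rewrite lerXn2r ?nnegrE//; lra.
    by rewrite ler_weXn2l//; lra.
  by rewrite ger0_norm ?expR_ge0// ler_expR; nra.
- by move=> i iN; rewrite expr1n mulr1 ler_pdivlMr// mulrC; exact: HB.
rewrite expr1n mulr1 -!mulrA; apply: ler_pM => //.
- by rewrite !mulr_ge0 ?invr_ge0 ?exprn_ge0 ?expR_ge0//; lra.
- by rewrite ler_weXn2l// ler1n.
Qed.

End edge.

(** * The corner barrier *)

Section barrier.
Variable R : realType.
Implicit Types (x t s e b l c r : R) (f g : R -> R).

Lemma is_derive_mul f g x l l' : is_derive x 1 f l -> is_derive x 1 g l' ->
  is_derive x 1 (fun x => f x * g x) (l * g x + f x * l').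
Proof.
move=> fl gl; apply: (is_derive_eq (is_deriveM fl gl)).
by rewrite !scale_realE addrC mulrC.
Qed.

Lemma is_derive_scale c f x l : is_derive x 1 f l ->
  is_derive x 1 (fun x => c * f x) (c * l).
Proof. by move=> fl; apply: (is_derive_eq (is_deriveZ c fl)). Qed.

Lemma is_derive_add f g x l l' : is_derive x 1 f l -> is_derive x 1 g l' ->
  is_derive x 1 (fun x => f x + g x) (l + l').
Proof. by move=> fl gl; apply: (is_derive_eq (is_deriveD fl gl)). Qed.

Lemma is_derive_exp f x l : is_derive x 1 f l ->
  is_derive x 1 (fun x => expR (f x)) (expR (f x) * l).
Proof. by move=> fl; exact: (@is_derive1_comp R expR f x _ _ (is_derive_expR _) fl). Qed.

Lemma is_derive_lin e b x : is_derive x 1 (fun x => e * x + b) e.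
Proof.
apply: (is_derive_eq (is_derive_add (is_derive_scale e (is_derive_id x 1)) (is_derive_cst b x 1))).
by rewrite addr0 mulr1.
Qed.

(* With X = e x + b and e^2 = 1, the function X t^(-5/2) exp(- (5/6) X^2 / t^2)
   is a supersolution of u_t = (t/2) u_xx where X >= 0; a multiple of it
   dominates the growth of a heat extension at a corner, and decays pointwise
   when s -> 0. *)
Definition barE s e b x t : R :=
  expR (- (5 / 2) * (ln t - ln s) + - (5 / 6) * (((e * x + b) * (e * x + b)) * (t ^+ 2)^-1)).
Definition bar s e b x t : R := (s ^+ 2)^-1 * ((e * x + b) * barE s e b x t).
Definition barx s e b x t : R :=
  (s ^+ 2)^-1 * (e * (barE s e b x t * (1 - 5 / 3 * ((e * x + b) ^+ 2 * (t ^+ 2)^-1)))).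
Definition barxx s e b x t : R :=
  (s ^+ 2)^-1 * (e ^+ 2 * ((e * x + b) * (t ^+ 2)^-1 * barE s e b x t *
    (25 / 9 * ((e * x + b) ^+ 2 * (t ^+ 2)^-1) - 5))).
Definition bart s e b x t : R :=
  (s ^+ 2)^-1 * ((e * x + b) * barE s e b x t *
    (5 / 3 * ((e * x + b) ^+ 2 * (t ^+ 3)^-1) - 5 / 2 * t^-1)).

Lemma is_derive_barE_x s e b x t :
  is_derive x 1 (fun x => barE s e b x t)
    (barE s e b x t * (- (5 / 3) * (e * ((e * x + b) * (t ^+ 2)^-1)))).
Proof.
have H1 := is_derive_mul (is_derive_lin e b x) (is_derive_lin e b x).
have H2 := is_derive_mul H1 (is_derive_cst (t ^+ 2)^-1 x 1).
have H3 := is_derive_add (is_derive_cst (- (5 / 2) * (ln t - ln s)) x 1)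
  (is_derive_scale (- (5 / 6)) H2).
apply: (is_derive_eq (is_derive_exp H3)); congr (_ * _); rewrite /cst.
by move: ((t ^+ 2)^-1) => w; field.
Qed.

Lemma is_derive_bar_x s e b x t :
  is_derive x 1 (fun x => bar s e b x t) (barx s e b x t).
Proof.
have H := is_derive_scale (s ^+ 2)^-1 (is_derive_mul (is_derive_lin e b x) (is_derive_barE_x s e b x t)).
apply: (is_derive_eq H); rewrite /barx; congr (_ * _).
by move: ((t ^+ 2)^-1) (barE _ _ _ _ _) => w E; field.
Qed.

Lemma is_derive_barx_x s e b x t :
  is_derive x 1 (fun x => barx s e b x t) (barxx s e b x t).
Proof.
have H1 := is_derive_mul (is_derive_lin e b x) (is_derive_lin e b x).
have H2 := is_derive_scale (- (5 / 3)) (is_derive_mul H1 (is_derive_cst (t ^+ 2)^-1 x 1)).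
have H3 := is_derive_add (is_derive_cst (1 : R) x 1) H2.
have H := is_derive_scale (s ^+ 2)^-1 (is_derive_scale e (is_derive_mul (is_derive_barE_x s e b x t) H3)).
have E : (fun x => barx s e b x t) = (fun x => (s ^+ 2)^-1 * (e * (barE s e b x t *
   (cst 1 x + - (5 / 3) * ((e * x + b) * (e * x + b) * cst (t ^+ 2)^-1 x))))).
  by apply/funext => u; rewrite /barx /cst expr2 mulNr.
rewrite E; apply: (is_derive_eq H); rewrite /barxx /cst; congr (_ * _).
by move: ((t ^+ 2)^-1) (barE _ _ _ _ _) => w E'; field.
Qed.

Lemma is_derive_bar_t s e b x t : 0 < t ->
  is_derive t 1 (fun t => bar s e b x t) (bart s e b x t).
Proof.
move=> t0; have tn : t != 0 by rewrite gt_eqF.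
have H1 := is_derive_scale (- (5 / 2)) (is_derive_add (is_derive1_ln t0) (is_derive_cst (- ln s) t 1)).
have H2 := is_derive_scale (- (5 / 6)) (is_derive_scale ((e * x + b) * (e * x + b)) (is_derive_invX 2 tn)).
have H := is_derive_scale (s ^+ 2)^-1 (is_derive_scale (e * x + b) (is_derive_exp (is_derive_add H1 H2))).
apply: (is_derive_eq H); rewrite /bart /barE /cst; congr (_ * _); rewrite -[RHS]mulrA; congr (_ * _).
by move: (expR _) => E; field.
Qed.

(** The terms linear in [X] cancel because 5/2 is three times 5/6; what remains is [5 / 18] times a
    nonnegative cubic term. *)
Lemma bar_supersolution s e b x t : e ^+ 2 = 1 -> 0 < t -> 0 <= e * x + b ->
  t / 2 * barxx s e b x t <= bart s e b x t.
Proof.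
move=> e1 t0 X0; rewrite /barxx /bart mulrCA ler_wpM2l ?invr_ge0 ?sqr_ge0//.
rewrite e1 mul1r -subr_ge0.
set X := e * x + b in X0 *; have E0 : 0 <= barE s e b x t by exact: expR_ge0.
move: (barE _ _ _ _ _) E0 => E E0; have tn : t != 0 by rewrite gt_eqF.
have -> : X * E * (5 / 3 * (X ^+ 2 * (t ^+ 3)^-1) - 5 / 2 * t^-1) -
   t / 2 * (X * (t ^+ 2)^-1 * E * (25 / 9 * (X ^+ 2 * (t ^+ 2)^-1) - 5)) =
   5 / 18 * (X * E * X ^+ 2 * (t ^+ 3)^-1) by field.
by rewrite !mulr_ge0 ?invr_ge0 ?exprn_ge0 ?(ltW t0).
Qed.

Lemma bar_ge0 s e b x t : 0 <= e * x + b -> 0 <= bar s e b x t.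
Proof. by move=> X0; rewrite !mulr_ge0 ?invr_ge0 ?sqr_ge0 ?expR_ge0. Qed.

Lemma bar_bottom s e b x : 0 < s ->
  bar s e b x s = (s ^+ 2)^-1 * ((e * x + b) * expR (- (5 / 6) * ((e * x + b) / s) ^+ 2)).
Proof.
by move=> s0; rewrite /bar /barE subrr mulr0 add0r expr_div_n expr2.
Qed.

(** The prefactor [s^-2 (s / t)^(5/2)] equals [t^-2 (s / t)^(1/2)], and [s = t exp (- 2 r)] makes
    the root equal to [exp (- r)]. *)
Lemma bar_decay e b x t r : 0 < t -> 0 <= e * x + b ->
  bar (t * expR (- (2 * r))) e b x t <= (t ^+ 2)^-1 * (e * x + b) * expR (- r).
Proof.
move=> t0 X0; rewrite /bar /barE lnM ?posrE ?expR_gt0// expRK.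
set X := e * x + b in X0 *.
have tn : t != 0 by rewrite gt_eqF.
have -> : - (5 / 2) * (ln t - (ln t + - (2 * r))) = - (5 * r) by field.
rewrite exprMn invfM -!mulrA ler_wpM2l ?invr_ge0 ?sqr_ge0//.
rewrite [leLHS]mulrCA ler_wpM2l// expRD [leLHS]mulrA.
have -> : (expR (- (2 * r)) ^+ 2)^-1 * expR (- (5 * r)) = expR (- r) :> R.
  by rewrite expr2 -expRD -expRN -expRD; congr expR; ring.
rewrite ler_piMr ?expR_ge0// -expR0 ler_expR.
rewrite mulNr oppr_le0 !mulr_ge0// ?invr_ge0 ?sqr_ge0//.
Qed.

Lemma bar_continuous s e b x t : 0 < t ->
  {for (x, t), continuous (fun p : R * R => bar s e b p.1 p.2)}.
Proof.
move=> t0; rewrite /bar /barE.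
have cl : (fun p : R * R => e * p.1 + b) @ (x, t) --> e * x + b.
  by apply: cvgD; [apply: cvgMr; exact: cvg_fst|exact: cvg_cst].
have csnd : (fun p : R * R => p.2) @ (x, t) --> t by exact: cvg_snd.
have cln : (fun p : R * R => ln p.2) @ (x, t) --> ln t.
  apply: cvg_comp csnd _; exact: continuous_ln.
apply: cvgMr; apply: cvgM => //.
apply: (@continuous_comp _ _ _ (fun p : R * R => - (5 / 2) * (ln p.2 - ln s) +
   - (5 / 6) * (((e * p.1 + b) * (e * p.1 + b)) * (p.2 ^+ 2)^-1)) expR); last exact: continuous_expR.
apply: cvgD.
  apply: cvgMr; apply: cvgB; last exact: cvg_cst.
  exact: cln.
apply: cvgMr; apply: cvgM; first exact: cvgM.
apply: cvgV; first by rewrite /= expf_neq0// gt_eqF.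
rewrite (_ : (fun p : R * R => p.2 ^+ 2) = (fun p : R * R => p.2 * p.2)); last first.
  by apply/funext => p; rewrite expr2.
by rewrite expr2; apply: cvgM; exact: cvg_snd.
Qed.

End barrier.

(** * Carrying a lower bound across a gap *)

Section gap.
Variable R : realType.
Implicit Types (f g : R -> R) (x y a c d t z : R) (m n k N j : nat).
Variable L : (R -> R) -> R.
Hypothesis cL : cdistr L.

Lemma MVT_lipschitz f g (B : R) : (forall u : R, is_derive u 1 f (g u)) ->
  (forall u, `|g u| <= B) -> forall x y, `|f x - f y| <= B * `|x - y|.
Proof.
move=> fg gB x y; wlog yx : x y / y <= x => [W|].
  have [yx|/ltW xy] := leP y x; first exact: W.
  by rewrite distrC [X in B * X]distrC; exact: W.
rewrite [X in B * X]ger0_norm ?subr_ge0//.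
by apply: (@MVT_bound R f g) => // u _.
Qed.

(** Joint continuity comes from a Lipschitz bound in [x], uniform for times above [t / 2], together
    with continuity in [t] at a fixed point. *)
Lemma heat_continuous m x t : 0 < t ->
  {for (x, t), continuous (fun p : R * R => heat L m p.1 p.2)}.
Proof.
move=> t0; have t20 : 0 < t / 2 by rewrite divr_gt0.
have [C C0 HC] := heat_bound cL m.+1 t20.
have ct : heat L m x s @[s --> t] --> heat L m x t.
  by apply: derivable_cont; have [] := heat_dt cL m x t0.
apply/cvgrPdist_le => e e0.
have e20 : 0 < e / 2 by rewrite divr_gt0.
have C1 : 0 < C + 1 by rewrite ltr_wpDl.
move/cvgrPdist_le : ct => /(_ _ e20) Ht.
have Hs : (fun p : R * R => p.2) @ (x, t) --> t by exact: cvg_snd.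
have Hf : (fun p : R * R => p.1) @ (x, t) --> x by exact: cvg_fst.
near=> p.
have p2 : t / 2 < p.2.
  by near: p; apply: (cvgr_gt t Hs); rewrite ltr_pdivrMr//; lra.
have p1 : `|x - p.1| <= e / (2 * (C + 1)).
  by near: p; move/cvgrPdist_le : Hf; apply; rewrite divr_gt0// mulr_gt0.
have Hp : `|heat L m x t - heat L m x p.2| <= e / 2.
  by near: p; exact: (Hs _ Ht).
have p0 : 0 < p.2 by exact: lt_trans p2.
rewrite /= -(subrKA (heat L m x p.2)); apply: (le_trans (ler_normD _ _)).
rewrite [leRHS](splitr e) lerD//.
have D u : is_derive u (1 : R) (fun x => heat L m x p.2) (- heat L m.+1 u p.2).
  exact: heat_dx.
have Db u : `|- heat L m.+1 u p.2| <= C by rewrite normrN HC// ltW.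
apply: (le_trans (MVT_lipschitz D Db x p.1)).
apply: (@le_trans _ _ (C * (e / (2 * (C + 1))))); first by rewrite ler_wpM2l.
have -> : C * (e / (2 * (C + 1))) = e / 2 * (C / (C + 1)) by field; rewrite gt_eqF.
by rewrite ler_piMr ?(ltW e20)// ler_pdivrMr// mul1r lerDl.
Unshelve. all: by end_near. Qed.

Section slice.
Variables (c d Cc Cd t : R).
Hypotheses (Cc0 : 0 <= Cc) (Cd0 : 0 <= Cd).
Hypothesis Hc : forall z t, 0 <= z -> t != 0 -> `|t| <= 1 ->
  `|L (dil (edge_fun z) c t)| <= Cc * ((z + 1) * expR (- (5 / 6) * (z + 1) ^+ 2)).
Hypothesis Hd : forall z t, 0 <= z -> t != 0 -> `|t| <= 1 ->
  `|L (dil (edge_fun z) d t)| <= Cd * ((z + 1) * expR (- (5 / 6) * (z + 1) ^+ 2)).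
Hypothesis Lpos : forall f, smooth f -> (forall x, 0 <= f x) ->
  (exists2 e, 0 < e & forall x, f x != 0 -> c + e <= x <= d - e) -> 0 <= L f.

Definition corner_barrier x s : R :=
  Cc * bar t 1 (t - c) x s + Cd * bar t (- 1) (d + t) x s.

(** The kernel splits into two edge pieces and a middle piece supported inside the gap, on which [L]
    is nonnegative. The right edge is reduced to the left one by the reflection [- t]; the condition
    [2 * t <= d - c] keeps the two cut-offs apart. The shift of the barriers by [t] turns [z] into
    [z + 1]. *)
Lemma heat_slice x : 0 < t -> t <= 1 -> 2 * t <= d - c -> c <= x <= d ->
  - corner_barrier x t <= heat L 0 x t.
Proof.
move=> t0 t1 tcd /andP[cx xd].
have tn : t != 0 by rewrite gt_eqF.
have tn' : - t != 0 by rewrite oppr_eq0.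
have nt : `|t| <= 1 by rewrite ger0_norm// ltW.
have nt' : `|- t| <= 1 by rewrite normrN.
pose zc := (x - c) / t; pose zd := (d - x) / t.
have zc0 : 0 <= zc by rewrite divr_ge0 ?subr_ge0// ltW.
have zd0 : 0 <= zd by rewrite divr_ge0 ?subr_ge0// ltW.
have sc := @smooth_dil R _ c t (@smooth_edge_fun R zc).
have sd := @smooth_dil R _ d (- t) (@smooth_edge_fun R zd).
pose fc y := t^-1 * dil (edge_fun zc) c t y.
pose fd y := t^-1 * dil (edge_fun zd) d (- t) y.
have sfc : smooth fc := @smoothZ R t^-1 _ sc.
have sfd : smooth fd := @smoothZ R t^-1 _ sd.
pose mid y := (kap 0 x t y - fc y) - fd y.
have sm1 : smooth (fun y => kap 0 x t y - fc y) := smoothB (@smooth_kap R 0 x t) sfc.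
have smid : smooth mid := smoothB sm1 sfd.
have midE y : mid y = t^-1 * gauss_fun ((y - x) / t) *
    (1 - cutf ((y - c) / t) - cutf ((d - y) / t)).
  rewrite /mid /fc /fd /kap /dil /edge_fun expr1 derive1n0.
  have -> : (y - c) / t - zc = (y - x) / t by rewrite /zc; field.
  have -> : (y - d) / - t = (d - y) / t by field.
  have -> : (d - y) / t - zd = - ((y - x) / t) by rewrite /zd; field.
  have -> : gauss_fun (- ((y - x) / t)) = gauss_fun ((y - x) / t).
    by rewrite /gauss_fun sqrrN.
  by ring.
have Lmid : 0 <= L mid.
  apply: Lpos => // [y|].
    rewrite midE !mulr_ge0 ?invr_ge0 ?(ltW t0) ?gauss_fun_ge0//.
    have [yc|yc] := leP ((y - c) / t) (2 / 3).
      rewrite (@cut0 R ((d - y) / t)) ?subr0 ?subr_ge0 ?cut_le1//.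
      move: yc; rewrite ler_pdivrMr// ler_pdivlMr//; lra.
    by rewrite (cut0 (ltW yc)) subr0 subr_ge0 cut_le1.
  exists (t / 3) => [|y]; first by rewrite divr_gt0.
  rewrite midE => H; rewrite leNgt -leNgt.
  apply/andP; split; rewrite leNgt; apply/negP => yc; move/negP: H; apply; apply/eqP.
    rewrite (@cut1 R ((y - c) / t)); last by rewrite ler_pdivrMr//; lra.
    by rewrite (@cut0 R ((d - y) / t)) ?subrr ?sub0r ?oppr0 ?mulr0// ler_pdivlMr//; lra.
  rewrite (@cut0 R ((y - c) / t)); last by rewrite ler_pdivlMr//; lra.
  by rewrite (@cut1 R ((d - y) / t)) ?subr0 ?subrr ?mulr0// ler_pdivrMr//; lra.
have E : heat L 0 x t = L mid + L fd + L fc.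
  by rewrite /mid (cdistrB cL sm1 sfd) (cdistrB cL (@smooth_kap R 0 x t) sfc) !subrK.
have Bc : `|L fc| <= Cc * bar t 1 (t - c) x t.
  rewrite /fc (cdistrZ cL _ sc) normrM ger0_norm ?invr_ge0 ?(ltW t0)//.
  have := Hc zc0 tn nt => H.
  apply: (@le_trans _ _ (t^-1 * (Cc * ((zc + 1) * expR (- (5 / 6) * (zc + 1) ^+ 2))))).
    by rewrite ler_wpM2l// invr_ge0 ltW.
  rewrite bar_bottom//.
  have -> : (1 * x + (t - c)) / t = zc + 1 by rewrite /zc; field.
  have -> : 1 * x + (t - c) = t * (zc + 1) by rewrite /zc; field.
  by move: (expR _) => ex; rewrite le_eqVlt; apply/orP; left; apply/eqP; field.
have Bd : `|L fd| <= Cd * bar t (-1) (d + t) x t.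
  rewrite /fd (cdistrZ cL _ sd) normrM ger0_norm ?invr_ge0 ?(ltW t0)//.
  have := Hd zd0 tn' nt' => H.
  apply: (@le_trans _ _ (t^-1 * (Cd * ((zd + 1) * expR (- (5 / 6) * (zd + 1) ^+ 2))))).
    by rewrite ler_wpM2l// invr_ge0 ltW.
  rewrite bar_bottom//.
  have -> : (-1 * x + (d + t)) / t = zd + 1 by rewrite /zd; field.
  have -> : -1 * x + (d + t) = t * (zd + 1) by rewrite /zd; field.
  by move: (expR _) => ex; rewrite le_eqVlt; apply/orP; left; apply/eqP; field.
rewrite E /corner_barrier.
move: Bc Bd Lmid; rewrite !ler_norml; lra.
Qed.

End slice.

(** The maximum principle is applied from a small initial time [s], where the slice estimate bounds
    the bottom, to the heat extension plus [M] plus the corner barriers; then [s] tends to 0, and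
    the barriers vanish at the fixed point [(x, t)]. *)
Lemma heat_gap c d (M t1 : R) : c < d -> 0 <= M ->
  local_bound L 0 c -> local_bound L 0 d ->
  (forall f, smooth f -> (forall x, 0 <= f x) ->
    (exists2 e, 0 < e & forall x, f x != 0 -> c + e <= x <= d - e) -> 0 <= L f) ->
  (forall t, 0 < t <= t1 -> - M <= heat L 0 c t) ->
  (forall t, 0 < t <= t1 -> - M <= heat L 0 d t) ->
  forall x t, c <= x <= d -> 0 < t <= t1 -> - M <= heat L 0 x t.
Proof.
move=> cd M0 lc ld Lpos Hc Hd x t xcd /andP[t0 tt1].
have [Cc Cc0 HCc] := edge_bound cL lc.
have [Cd Cd0 HCd] := edge_bound cL ld.
have main s : 0 < s -> s <= 1 -> 2 * s <= d - c -> s <= t ->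
    - M - corner_barrier c d Cc Cd s x t <= heat L 0 x t.
  move=> s0 s1 scd st.
  pose B := corner_barrier c d Cc Cd s.
  have Bge0 u v : c <= u <= d -> 0 <= B u v.
    move=> ucd; rewrite addr_ge0// mulr_ge0//; apply: bar_ge0; lra.
  pose Bx u v := Cc * barx s 1 (s - c) u v + Cd * barx s (-1) (d + s) u v.
  pose Bxx u v := Cc * barxx s 1 (s - c) u v + Cd * barxx s (-1) (d + s) u v.
  pose Bt u v := Cc * bart s 1 (s - c) u v + Cd * bart s (-1) (d + s) u v.
  suff : 0 <= (heat L 0 x t + M) + B x t by rewrite /B; lra.
  apply: (@heat_maximum_principle R (fun x t => (heat L 0 x t + M) + B x t)
    (fun x t => (- heat L 1 x t + 0) + Bx x t) (fun x t => (heat L 2 x t + 0) + Bxx x t)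
    (fun x t => (t / 2 * heat L 2 x t + 0) + Bt x t) c d s t1 s0) => //.
  - move=> u v v0; apply: cvgD.
      by apply: cvgD; [exact: heat_continuous|exact: cvg_cst].
    by apply: cvgD; apply: cvgMr; exact: bar_continuous.
  - move=> u v v0; apply: is_derive_add.
      exact: (is_derive_add (heat_dx cL 0 u v0) (is_derive_cst M u 1)).
    exact: (is_derive_add (is_derive_scale Cc (is_derive_bar_x s 1 (s - c) u v))
      (is_derive_scale Cd (is_derive_bar_x s (-1) (d + s) u v))).
  - move=> u v v0; apply: is_derive_add.
      apply: (is_derive_add _ (is_derive_cst (0 : R) u 1)).
      by apply: (is_derive_eq (is_deriveN (heat_dx cL 1 u v0))); rewrite opprK.
    exact: (is_derive_add (is_derive_scale Cc (is_derive_barx_x s 1 (s - c) u v))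
      (is_derive_scale Cd (is_derive_barx_x s (-1) (d + s) u v))).
  - move=> u v v0; apply: is_derive_add.
      exact: (is_derive_add (heat_dt cL 0 u v0) (is_derive_cst M v 1)).
    exact: (is_derive_add (is_derive_scale Cc (is_derive_bar_t s 1 (s - c) u v0))
      (is_derive_scale Cd (is_derive_bar_t s (-1) (d + s) u v0))).
  - move=> u v ucd v0; rewrite !addr0 mulrDr lerD2l /Bxx /Bt mulrDr; apply: lerD.
      rewrite mulrCA ler_wpM2l//; apply: bar_supersolution => //; first by rewrite expr1n.
      lra.
    rewrite mulrCA ler_wpM2l//; apply: bar_supersolution => //; first by rewrite sqrrN expr1n.
    lra.
  - move=> u ucd; have := @heat_slice c d Cc Cd s HCc HCd Lpos u s0 s1 scd ucd.
    by rewrite -/(B u s); lra.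
  - move=> v /andP[v0 v1].
    have h1 : 0 <= B c v by apply: Bge0; lra.
    have h2 : - M <= heat L 0 c v by apply: Hc; rewrite (lt_le_trans s0 v0).
    lra.
  - move=> v /andP[v0 v1].
    have h1 : 0 <= B d v by apply: Bge0; lra.
    have h2 : - M <= heat L 0 d v by apply: Hd; rewrite (lt_le_trans s0 v0).
    lra.
  - by rewrite st.
pose K := (t ^+ 2)^-1 * (Cc * (x - c + 1) + Cd * (d - x + 1)).
have K0 : 0 <= K.
  by rewrite mulr_ge0 ?invr_ge0 ?sqr_ge0// addr_ge0// mulr_ge0//; lra.
(* The initial time is [t exp (- 2 n)]. By [exp (- 2 n) <= 1 / (1 + 2 n)], the two premises make it
   at most 1 and at most half of the gap. *)
have limit n : t <= 1 + 2 * n%:R -> 2 * t <= (d - c) * (1 + 2 * n%:R) ->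
    - M - K / (1 + n%:R) <= heat L 0 x t.
  move=> n1 n2; have n0 : 0 <= n%:R :> R by [].
  pose s := t * expR (- (2 * n%:R)).
  have p2 : 0 < 1 + 2 * n%:R :> R by lra.
  have sle : s <= t / (1 + 2 * n%:R).
    rewrite /s ler_wpM2l ?(ltW t0)// expRN lef_pV2 ?posrE ?expR_gt0//.
    exact: expR_ge1Dx.
  have s0 : 0 < s by rewrite mulr_gt0// expR_gt0.
  have s1 : s <= 1 by apply: (le_trans sle); rewrite ler_pdivrMr// mul1r.
  have scd : 2 * s <= d - c.
    apply: (@le_trans _ _ (2 * (t / (1 + 2 * n%:R)))); first by rewrite ler_wpM2l.
    by rewrite mulrA ler_pdivrMr.
  have st : s <= t.
    by rewrite /s ler_piMr ?(ltW t0)// -expR0 ler_expR oppr_le0 mulr_ge0.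
  apply: le_trans (main s s0 s1 scd st); rewrite lerD2l lerN2.
  have b1 : bar s 1 (s - c) x t <= (t ^+ 2)^-1 * (x - c + 1) * expR (- n%:R).
    apply: (le_trans (bar_decay _ t0 _)); first lra.
    rewrite ler_wpM2r ?expR_ge0// ler_wpM2l ?invr_ge0 ?sqr_ge0//; lra.
  have b2 : bar s (-1) (d + s) x t <= (t ^+ 2)^-1 * (d - x + 1) * expR (- n%:R).
    apply: (le_trans (bar_decay _ t0 _)); first lra.
    rewrite ler_wpM2r ?expR_ge0// ler_wpM2l ?invr_ge0 ?sqr_ge0//; lra.
  rewrite /corner_barrier.
  apply: (le_trans (lerD (ler_wpM2l Cc0 b1) (ler_wpM2l Cd0 b2))).
  have -> : Cc * ((t ^+ 2)^-1 * (x - c + 1) * expR (- n%:R)) +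
     Cd * ((t ^+ 2)^-1 * (d - x + 1) * expR (- n%:R)) = K * expR (- n%:R).
    by rewrite /K; ring.
  by rewrite ler_wpM2l// expRN lef_pV2 ?posrE ?expR_gt0 ?expR_ge1Dx//; lra.
rewrite leNgt; apply/negP => hM.
pose e := - M - heat L 0 x t.
have e0 : 0 < e by rewrite /e; lra.
pose n := (Num.truncn (t + 2 * t / (d - c) + K / e)).+1.
have dc0 : 0 < d - c by lra.
have nb : t + 2 * t / (d - c) + K / e < n%:R by exact: truncnS_gt.
have q1 : 0 <= 2 * t / (d - c) by rewrite divr_ge0 ?mulr_ge0 ?(ltW t0) ?(ltW dc0).
have q2 : 0 <= K / e by rewrite divr_ge0 ?(ltW e0).
have n0 : 0 <= n%:R :> R by [].
have := limit n.
have -> : t <= 1 + 2 * n%:R by lra.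
have -> : 2 * t <= (d - c) * (1 + 2 * n%:R).
  by rewrite [leRHS]mulrC -ler_pdivrMr//; lra.
move=> /(_ isT isT) H.
have : K / (1 + n%:R) < e.
  by rewrite ltr_pdivrMr ?ltr_wpDr// mulrC -ltr_pdivrMr//; lra.
rewrite /e in H *; lra.
Qed.

End gap.

(** * Recovering a distribution from its heat extension *)

Section interval_integral.
Variable R : realType.
Implicit Types (f g : R -> R) (x y a b c d t z r : R) (m n k N j : nat).
Local Notation mu := (@lebesgue_measure R).

Definition intab a b f : R := \int[mu]_(x in `[a, b]) f x.

Lemma int_integrable a b f : continuous f ->
  mu.-integrable `[a, b] (EFin \o f).
Proof.
move=> cf; apply: continuous_compact_integrable; first exact: segment_compact.
exact: continuous_subspaceT.
Qed.

Lemma cont_mul f g : continuous f -> continuous g -> continuous (fun x => f x * g x).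
Proof. by move=> cf cg x; apply: cvgM; [exact: cf|exact: cg]. Qed.

Lemma cont_scale c f : continuous f -> continuous (fun x => c * f x).
Proof. by move=> cf x; apply: cvgMr; exact: cf. Qed.

Lemma cont_sub f g : continuous f -> continuous g -> continuous (fun x => f x - g x).
Proof. by move=> cf cg x; apply: cvgB; [exact: cf|exact: cg]. Qed.

Lemma intB a b f g : continuous f -> continuous g ->
  intab a b (fun x => f x - g x) = intab a b f - intab a b g.
Proof.
move=> cf cg; have H1 := int_integrable a b cf; have H2 := int_integrable a b cg.
by rewrite /intab RintegralB.
Qed.

Lemma intZ a b c f : continuous f -> intab a b (fun x => c * f x) = c * intab a b f.
Proof. by move=> cf; have H := int_integrable a b cf; rewrite /intab RintegralZl. Qed.

Lemma le_int a b f g : continuous f -> continuous g ->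
  (forall x, a <= x <= b -> f x <= g x) -> intab a b f <= intab a b g.
Proof.
move=> cf cg fg; have H1 := int_integrable a b cf; have H2 := int_integrable a b cg.
by rewrite /intab le_Rintegral.
Qed.

Lemma int_cst a b c : a <= b -> intab a b (cst c) = c * (b - a).
Proof.
move=> ab; rewrite /intab Rintegral_cst; last exact: measurable_itv.
congr (_ * _); have := @lebesgue_measure_itv R `[a, b]; rewrite /= lte_fin => E.
rewrite [X in fine X](_ : _ = if a < b then (b%:E - a%:E)%E else 0%E)//.
have [//|ba] := ltP a b.
by have -> : a = b; [lra|rewrite /= subrr].
Qed.

Lemma int_bound a b f (B : R) : a <= b -> continuous f ->
  (forall x, a <= x <= b -> `|f x| <= B) -> `|intab a b f| <= B * (b - a).
Proof.
move=> ab cf fB; rewrite ler_norml -mulNr -!int_cst//.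
have cc (e : R) : continuous (cst e : R -> R) by move=> x; exact: cvg_cst.
apply/andP; split; apply: le_int => // x /fB; rewrite /cst ler_norml; lra.
Qed.

Lemma int_is_derive a x f : a < x -> continuous f ->
  is_derive x 1 (fun u => intab a u f) (f x).
Proof.
move=> ax cf; have x1 : x < x + 1 by rewrite ltrDl.
have ax' : (BLeft a < BRight x)%E by rewrite lte_fin.
have [fd fE] := @continuous_FTC1 R f (BLeft a) x (x + 1) x1 (int_integrable a (x + 1) cf) ax' (cf x).
by rewrite -fE; exact: derivable_is_derive1.
Qed.

Lemma int_FTC a b f g : a < b -> (forall x, a <= x <= b -> is_derive x 1 f (g x)) ->
  continuous g -> intab a b g = f b - f a.
Proof.
move=> ab fg cg.
have fc x : a <= x <= b -> {for x, continuous f}.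
  by move=> xab; apply: derivable_cont; have [] := fg x xab.
rewrite /intab /Rintegral (@continuous_FTC2 R g f a b)//.
- exact: continuous_subspaceT.
- split.
  + by move=> x; rewrite in_itv/= => /andP[ax xb]; have [] := fg x; rewrite ?ltW.
  + by apply: cvg_at_right_filter; apply: fc; rewrite lexx ltW.
  + by apply: cvg_at_left_filter; apply: fc; rewrite lexx ltW.
- move=> x; rewrite in_itv/= => /andP[ax xb].
  by rewrite derive1E; apply: derive_val; apply: fg; rewrite !ltW.
Qed.

End interval_integral.

(** * Convolution with the kernel *)

Section convolution.
Variable R : realType.
Implicit Types (f g : R -> R) (x y a b c d t z r : R) (m n k N j : nat).
Local Notation mu := (@lebesgue_measure R).
Variable L : (R -> R) -> R.
Hypothesis cL : cdistr L.
Variables (f : R -> R) (r t : R).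
Hypotheses (sf : smooth f) (fr : forall x, r < `|x| -> f x = 0) (r0 : 0 <= r) (t0 : 0 < t).

Lemma kap_sym m x y : kap m x t y = (-1) ^+ m * kap m y t x.
Proof.
rewrite /kap mulrCA; congr (_ * _).
have := @derive1n_comp_affine R gauss_fun (-1) 0 m (@smooth_gauss R).
have -> : (fun x : R => gauss_fun (-1 * x + 0)) = gauss_fun.
  by apply/funext => z; rewrite addr0 mulN1r /gauss_fun sqrrN.
move=> /(congr1 (fun F : R -> R => F ((y - x) / t))) ->.
by have -> : -1 * ((y - x) / t) + 0 = (x - y) / t by ring.
Qed.

Lemma smooth_kap_x m y : smooth (fun x => kap m x t y).
Proof.
have := @smoothZ R ((-1) ^+ m) _ (@smooth_kap R m y t).
by congr smooth; apply/funext => x; rewrite -kap_sym.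
Qed.

(** The upper end is left variable so that the integral can be differentiated in it; the lower end
    lies well below the support of [f]. *)
Definition conv m u y : R := intab (- (r + 2)) u (fun x => f x * kap m x t y).

Lemma conv_integrand_continuous m y : continuous (fun x => f x * kap m x t y).
Proof. exact: (smooth_continuous (smoothM sf (@smooth_kap_x m y))). Qed.

Lemma conv_dy m (u : R) y : - (r + 2) <= u ->
  is_derive y 1 (conv m u) (conv m.+1 u y).
Proof.
move=> ru; have [C C0 HC] := @kap_bound_ge R m.+2 t t0.
have [B B0 HB] := continuous_bounded_itv (- (r + 2)) u (smooth_continuous sf).
apply: (@is_derive_quadratic R _ y _ 1 (B * C * (u + (r + 2))) ltr01) => h h1.
have c0 := @conv_integrand_continuous m y; have c1 := @conv_integrand_continuous m.+1 y.
have c2 := @conv_integrand_continuous m (y + h).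
have -> : conv m u (y + h) - conv m u y - conv m.+1 u y * h =
   intab (- (r + 2)) u (fun x => f x * kap m x t (y + h) - f x * kap m x t y - h * (f x * kap m.+1 x t y)).
  rewrite /conv intB; [|exact: cont_sub|exact: cont_scale].
  by rewrite intB// intZ//; ring.
have -> : B * C * (u + (r + 2)) * h ^+ 2 = (B * (C * h ^+ 2)) * (u - - (r + 2)) by ring.
apply: int_bound => //.
  by apply: cont_sub; [exact: cont_sub|exact: cont_scale].
move=> x xu; have -> : f x * kap m x t (y + h) - f x * kap m x t y - h * (f x * kap m.+1 x t y) =
  f x * (kap m x t (y + h) - kap m x t y - kap m.+1 x t y * h) by ring.
rewrite normrM; apply: ler_pM => //; first exact: HB.
have D j z : is_derive z 1 (kap j x t) (kap j.+1 x t z).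
  have := smooth_is_derive 0 z (@smooth_kap R j x t).
  by rewrite derive1n0 derive1n_kap addn1.
by apply: (@taylor2 R (kap m x t) (kap m.+1 x t) (kap m.+2 x t) y h 1) => // z _; exact: HC.
Qed.

Lemma smooth_conv m (u : R) : - (r + 2) <= u ->
  smooth (conv m u) /\ forall j, derive1n j (conv m u) = conv (m + j) u.
Proof.
move=> ru; have := @smooth_family R (fun j => conv (m + j) u).
rewrite addn0; apply => j y.
by rewrite addnS; exact: conv_dy.
Qed.

(** Fubini's exchange of [L] with the integral, by differentiation in the upper end: [L (conv 0 u)]
    has derivative [f u * heat L 0 u t], and it vanishes at [u = - (r + 1)], below the support of
    [f]. *)
Lemma L_conv : L (conv 0 (r + 1)) = intab (- (r + 1)) (r + 1) (fun x => f x * heat L 0 x t).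
Proof.
have ch : continuous (fun x => f x * heat L 0 x t).
  apply: cont_mul; first exact: smooth_continuous.
  by move=> x; apply: derivable_cont; have [] := heat_dx cL 0 x t0.
have D u : - (r + 1) <= u <= r + 1 ->
    is_derive u 1 (fun u => L (conv 0 u)) (f u * heat L 0 u t).
  move=> /andP[u1 u2]; rewrite /heat -(cdistrZ cL (f u) (@smooth_kap R 0 u t)).
  have E v : Num.max v (- (r + 2)) = v \/ v < - (r + 2).
    by case: (leP v (- (r + 2))) => [|?]; [rewrite le_eqVlt => /orP[/eqP ->|]; [left|right]|left].
  (* The truncation makes the family smooth for every [v]; near [u] it changes nothing, as
     [u >= - (r + 1)]. *)
  have sk v : smooth (conv 0 (Num.max v (- (r + 2)))).
    by apply: (@smooth_conv 0 _ _).1; rewrite le_max lexx orbT.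
  have half : 0 < 1 / 2 :> R by rewrite divr_gt0.
  have : is_derive u 1 (fun v => L (conv 0 (Num.max v (- (r + 2))))) (L (fun y => f u * kap 0 u t y)).
    apply: (@pairing_is_derive R L cL (fun v => conv 0 (Num.max v (- (r + 2)))) _ u (1 / 2) half).
    - exact: sk.
    - exact: (@smoothZ R (f u) _ (@smooth_kap R 0 u t)).
    move=> m.
    have [B B0 HB] := @smooth_bounded R f 1 (r + 2) sf.
    have [C C0 HC] := @kap_bound_ge R m t t0.
    have [C' C'0 HC'] := @kap_bound_ge R m.+1 t t0.
    exists (B * C + B * C') => [|h y hh]; first by rewrite addr_ge0// mulr_ge0.
    have uh : - (r + 2) < u + h by move: hh; rewrite ler_norml; lra.
    have -> : Num.max (u + h) (- (r + 2)) = u + h by apply/max_idPl; exact: ltW.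
    have -> : Num.max u (- (r + 2)) = u by apply/max_idPl; lra.
    rewrite !(@smooth_conv 0 _ _).2; [|lra|exact: ltW].
    rewrite (@derive1nZ R (f u) _ m (@smooth_kap R 0 u t)) derive1n_kap !add0n.
    apply: (@taylor2 R (fun u => conv m u y) (fun x => f x * kap m x t y)
      (fun x => derive1 f x * kap m x t y + f x * - kap m.+1 x t y) u h (1 / 2)) => // v vu.
    - apply: int_is_derive; last exact: conv_integrand_continuous.
      by move: vu; rewrite ler_norml; lra.
    - apply: is_derive_mul; last exact: kap_dx.
      exact: smooth_is_derive0.
    - have vr : `|v| <= r + 2 by move: vu; rewrite !ler_norml; lra.
      apply: (le_trans (ler_normD _ _)).
      rewrite (normrM (derive1 f v)) (normrM (f v)) normrN; apply: lerD.
        apply: ler_pM => //; first by have := HB 1%N v isT vr; rewrite derive1n1.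
        exact: HC.
      by apply: ler_pM => //; [exact: (HB 0%N v isT vr)|exact: HC'].
  apply: near_eq_is_derive; near=> v.
  have -> // : Num.max v (- (r + 2)) = v.
  apply/max_idPl; apply: ltW; near: v; apply: lt_nbhsr; lra.
have rr : - (r + 1) < r + 1 by have := r0; lra.
rewrite (int_FTC rr D ch) [X in _ - X](_ : _ = 0) ?subr0// -(cdistr0 cL).
congr L; apply/funext => y; apply/eqP; rewrite -normr_le0.
have ab : - (r + 2) <= - (r + 1) by lra.
rewrite -(mul0r (- (r + 1) - - (r + 2))); apply: int_bound => //.
  exact: (@conv_integrand_continuous 0 y).
move=> x xr; rewrite fr ?mul0r ?normr0// ltr_normr; apply/orP; right; lra.
Unshelve. all: by end_near. Qed.

Lemma conv_ibp m y : conv m.+1 (r + 1) y =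
  intab (- (r + 2)) (r + 1) (fun x => derive1 f x * kap m x t y).
Proof.
have sf' := smooth_derive1 sf.
have c1 := smooth_continuous (smoothM sf' (@smooth_kap_x m y)).
have c2 := @conv_integrand_continuous m.+1 y.
have rr : - (r + 2) < r + 1 by have := r0; lra.
have D x : - (r + 2) <= x <= r + 1 -> is_derive x 1 (fun x => f x * kap m x t y)
    (derive1 f x * kap m x t y - f x * kap m.+1 x t y).
  move=> _; have := is_derive_mul (smooth_is_derive0 x sf) (kap_dx m x t y).
  by rewrite mulrN.
have := int_FTC rr D (cont_sub c1 c2).
rewrite intB// !fr ?mul0r ?subrr.
- by move=> /eqP; rewrite subr_eq0 => /eqP ->.
- by rewrite ltr_normr; apply/orP; right; lra.
- by rewrite ltr_normr; apply/orP; left; lra.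
Qed.

End convolution.

(** * The Gaussian as an approximate identity *)

Section approximate_identity.
Variable R : realType.
Implicit Types (f g : R -> R) (x y a b c d t z r : R) (m n k N j : nat).
Local Notation mu := (@lebesgue_measure R).

Definition gauss_mass : R := Num.sqrt pi.

Lemma gauss_mass_gt0 : 0 < gauss_mass.
Proof. by rewrite sqrtr_gt0 pi_gt0. Qed.

Lemma integral_gauss_affine y c : 0 < c ->
  (\int[mu]_x (gauss_fun ((x - y) / c))%:E = (c * gauss_mass)%:E)%E.
Proof.
move=> c0; have cn : c != 0 by rewrite gt_eqF.
pose F (x : R) := c^-1 * x + (- y / c).
have DF x : is_derive x 1 F c^-1 by exact: is_derive_lin.
have F' : derive1 F = cst c^-1 by exact: is_derive_derive1.
have H : (\int[mu]_x (gauss_fun x)%:E = \int[mu]_x (((gauss_fun \o F) * derive1 F) x)%:E)%E.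
  apply: increasing_ge0_integration_by_substitutionT.
  - by move=> u v uv; rewrite /F ltrD2r ltr_pM2l ?invr_gt0.
  - by rewrite F'; move=> x; exact: cvg_cst.
  - by rewrite F'; apply: is_cvg_cst.
  - by rewrite F'; apply: is_cvg_cst.
  - by move=> x; have [] := DF x.
  - apply/cvgrNyPle => A; near=> x.
    rewrite /F -lerBrDr ler_pdivrMl//; near: x; exact: nbhs_ninfty_le.
  - apply/cvgryPge => A; near=> x.
    rewrite /F -lerBlDr ler_pdivlMl//; near: x; exact: nbhs_pinfty_ge.
  - exact: continuous_gauss_fun.
  - exact: gauss_fun_ge0.
rewrite integralT_gauss in H.
have -> : (fun x => (gauss_fun ((x - y) / c))%:E) =
    (fun x => c%:E * (((gauss_fun \o F) * derive1 F) x)%:E)%E.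
  apply/funext => x; rewrite F' /F -EFinM fctE /= /cst; congr EFin.
  rewrite mulrCA mulfV// mulr1; congr gauss_fun; ring.
rewrite ge0_integralZl//; last 3 first.
- apply/measurable_EFinP; apply: continuous_measurable_fun.
  rewrite F' => x; apply: cvgM; last exact: cvg_cst.
  apply: continuous_comp; last exact: continuous_gauss_fun.
  by apply: cvgD; [apply: cvgMr; exact: cvg_id|exact: cvg_cst].
- move=> x _; rewrite lee_fin F' mulr_ge0 ?gauss_fun_ge0//.
  by rewrite /cst invr_ge0 ltW.
- by rewrite lee_fin ltW.
by rewrite -H -EFinM.
Unshelve. all: by end_near. Qed.

Definition gaussc y c x : R := gauss_fun ((x - y) / c).

Lemma gaussc_continuous y c : continuous (gaussc y c).
Proof. exact: (smooth_continuous (@smooth_dil R _ y c (@smooth_gauss R))). Qed.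

Lemma gaussc_integrable y c : 0 < c -> mu.-integrable setT (EFin \o gaussc y c).
Proof.
move=> c0; apply/integrableP; split.
  by apply/measurable_EFinP; apply: continuous_measurable_fun; exact: gaussc_continuous.
have -> : (fun x => `|(EFin \o gaussc y c) x|%E) = (fun x => (gauss_fun ((x - y) / c))%:E).
  by apply/funext => x; rewrite /= ger0_norm// gauss_fun_ge0.
by rewrite integral_gauss_affine// ltry.
Qed.

Lemma Rintegral_gaussc y c : 0 < c -> \int[mu]_x gaussc y c x = c * gauss_mass.
Proof. by move=> c0; rewrite /Rintegral integral_gauss_affine. Qed.

(** This bounds the first moment by a Gaussian of twice the width, whose integral is known. It
    amounts to [|z| <= exp (3 z^2 / 4)], and [1 + 3 z^2 / 4] already suffices. *)
Lemma gauss_moment z : `|z| * gauss_fun z <= gauss_fun (z / 2).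
Proof.
rewrite /gauss_fun expr_div_n.
have -> : - z ^+ 2 = - (z ^+ 2 / 2 ^+ 2) + - (3 / 4 * z ^+ 2) :> R by field.
rewrite expRD mulrCA ler_piMr ?expR_ge0// expRN ler_pdivrMr ?expR_gt0// mul1r.
apply: le_trans (expR_ge1Dx _).
by rewrite -(ger0_norm (sqr_ge0 z)) normrX; have := sqr_ge0 (`|z| - 2 / 3); nra.
Qed.

Lemma conv_approx f (r t B K : R) y : smooth f -> 0 <= r -> 0 < t ->
  (forall x, r < `|x| -> f x = 0) -> (forall x, `|f x| <= B) ->
  (forall x, `|derive1 f x| <= K) ->
  `|conv f r t 0 (r + 1) y - gauss_mass * f y| <= 2 * K * gauss_mass * t.
Proof.
move=> sf r0 t0 fr fB fK; have tn : t != 0 by rewrite gt_eqF.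
have K0 : 0 <= K by apply: le_trans (fK 0).
have B0 : 0 <= B by apply: le_trans (fB 0).
have kE x : kap 0 x t y = t^-1 * gaussc y t x.
  rewrite /kap expr1 derive1n0 /gaussc; congr (_ * _).
  have -> : (x - y) / t = - ((y - x) / t) by ring.
  by rewrite /gauss_fun sqrrN.
have cf := smooth_continuous sf.
pose h x := t^-1 * f x * gaussc y t x.
have ch : continuous h by apply: cont_mul; [exact: cont_scale|exact: gaussc_continuous].
have ig := gaussc_integrable y t0.
have ih : mu.-integrable setT (EFin \o h).
  have igB := integrableZl measurableT (t^-1 * B) ig.
  apply: (le_integrable _ _ _ igB) => //.
    by apply/measurable_EFinP; exact: continuous_measurable_fun.
  move=> x _; rewrite /= lee_fin /h !normrM ler_wpM2r// ler_wpM2l// (ger0_norm B0); exact: fB.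
have E1 : conv f r t 0 (r + 1) y = \int[mu]_x h x.
  rewrite /conv /intab Rintegral_mkcond; congr Rintegral; apply/funext => x.
  rewrite patchE; case: ifPn => [_|]; first by rewrite kE /h; ring.
  move=> /negP xn; rewrite /h fr ?mulr0 ?mul0r//.
  rewrite ltNge; apply/negP => xr; apply: xn; rewrite inE/= in_itv/=.
  by move: xr; rewrite ler_norml; lra.
have E2 : gauss_mass * f y = \int[mu]_x (t^-1 * f y * gaussc y t x).
  by rewrite RintegralZl// Rintegral_gaussc//; field.
have i2 : mu.-integrable setT (EFin \o (fun x => t^-1 * f y * gaussc y t x)).
  exact: (integrableZl measurableT (t^-1 * f y) ig).
rewrite E1 E2 -RintegralB//.
have i3 : mu.-integrable setT (EFin \o (fun x => h x - t^-1 * f y * gaussc y t x)).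
  exact: (integrableB measurableT ih i2).
apply: (le_trans (le_normr_Rintegral measurableT i3)).
have t2 : 0 < 2 * t by rewrite mulr_gt0.
have -> : 2 * K * gauss_mass * t = \int[mu]_x (K * gaussc y (2 * t) x).
  rewrite RintegralZl//; last exact: gaussc_integrable.
  by rewrite Rintegral_gaussc//; ring.
apply: le_Rintegral => //.
- exact: (integrable_abse i3).
- exact: (integrableZl measurableT K (gaussc_integrable y t2)).
move=> x _; rewrite /h -mulrBl -mulrBr !normrM (ger0_norm (gauss_fun_ge0 _ : 0 <= gaussc y t x)).
have fxy : `|f x - f y| <= K * `|x - y|.
  by apply: (MVT_lipschitz _ fK) => u; exact: smooth_is_derive0.
have tx : `|x - y| = t * `|(x - y) / t|.
  by rewrite normrM normfV (ger0_norm (ltW t0)) mulrC divfK.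
rewrite normfV (ger0_norm (ltW t0)).
apply: (@le_trans _ _ (t^-1 * (K * `|x - y|) * gaussc y t x)).
  rewrite ler_wpM2r ?gauss_fun_ge0// ler_wpM2l// invr_ge0; exact: ltW.
rewrite tx; have -> : t^-1 * (K * (t * `|(x - y) / t|)) * gaussc y t x =
   K * (`|(x - y) / t| * gauss_fun ((x - y) / t)) by rewrite /gaussc; field.
rewrite ler_wpM2l//; apply: (le_trans (gauss_moment _)).
by rewrite /gaussc le_eqVlt; apply/orP; left; apply/eqP; congr gauss_fun; field.
Qed.

End approximate_identity.

(** * Passing to the limit in the smoothed pairing *)

Section fatou.
Variable R : realType.
Implicit Types (f g : R -> R) (x y a b c d t z r : R) (m n k N j : nat).
Local Notation mu := (@lebesgue_measure R).
Variable L : (R -> R) -> R.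
Hypothesis cL : cdistr L.

Lemma smooth_compact_bounded f N r : smooth f -> (forall x, r < `|x| -> f x = 0) ->
  exists2 B : R, 0 <= B & forall m x, (m <= N)%N -> `|derive1n m f x| <= B.
Proof.
move=> sf fr; have [B B0 HB] := @smooth_bounded R f N r sf; exists B => // m x mN.
have [xr|xr] := leP `|x| r; first exact: HB.
rewrite (@derive1n_eq_open R [set y | r < `|y - 0|] f (cst 0)) ?derive1n_cst.
- by case: (m); rewrite normr0.
- exact: open_norm_gt.
- by move=> y /=; rewrite subr0; exact: fr.
- by rewrite /= subr0.
Qed.

(** Integration by parts moves all derivatives from the kernel to [f], so the first-order error of
    the approximate identity holds in the seminorm that bounds [L]. *)
Lemma conv_limit f r : smooth f -> 0 <= r -> (forall x, r < `|x| -> f x = 0) ->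
  exists2 C : R, 0 <= C & forall t, 0 < t ->
    `|L (conv f r t 0 (r + 1)) - gauss_mass R * L f| <= C * t.
Proof.
move=> sf r0 fr; have [r1 [C [N [r10 C0 HL]]]] := cdistr_continuous cL.
have [B B0 HB] := smooth_compact_bounded N.+1 sf fr.
exists (C * (2 * B * gauss_mass R)) => [|t t0].
  by rewrite !mulr_ge0// ltW// gauss_mass_gt0.
have ru : - (r + 2) <= r + 1 by lra.
have [sc dc] := smooth_conv sf t0 0 ru.
rewrite -(cdistrZ cL (gauss_mass R) sf) -(cdistrB cL sc (@smoothZ R (gauss_mass R) _ sf)) -mulrA.
apply: HL; first exact: (smoothB sc (@smoothZ R (gauss_mass R) _ sf)).
move=> m x mN _.
rewrite (derive1nB m sc (@smoothZ R (gauss_mass R) _ sf)) (@derive1nZ R (gauss_mass R) _ m sf) dc add0n.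
have IBP g j : smooth g -> (forall x, r < `|x| -> g x = 0) ->
    conv g r t j (r + 1) x = conv (derive1n j g) r t 0 (r + 1) x.
  elim: j g => [//|j IH] g sg gr.
  have g'r z : r < `|z| -> derive1 g z = 0.
    move=> zr; rewrite -derive1n1 (@derive1n_eq_open R [set y | r < `|y - 0|] g (cst 0)) ?derive1n_cst//.
    + exact: open_norm_gt.
    + by move=> y /=; rewrite subr0; exact: gr.
    + by rewrite /= subr0.
  rewrite (conv_ibp t sg gr r0) -[intab _ _ _]/(conv (derive1 g) r t j (r + 1) x).
  by rewrite (IH _ (smooth_derive1 sg) g'r) /derive1n iterSr.
rewrite (IBP f m sf fr).
apply: conv_approx => //.
- exact: smooth_derive1n.
- move=> z zr; rewrite (@derive1n_eq_open R [set y | r < `|y - 0|] f (cst 0)) ?derive1n_cst.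
  + by case: (m).
  + exact: open_norm_gt.
  + by move=> y /=; rewrite subr0; exact: fr.
  + by rewrite /= subr0.
- by move=> z; apply: HB; exact: leqW.
- by move=> z; rewrite -derive1nS; apply: HB.
Qed.

End fatou.

Section fatou_step.
Variable R : realType.
Implicit Types (f g : R -> R) (x y a b c d t z r : R) (m n k N j : nat).
Local Notation mu := (@lebesgue_measure R).

Lemma near_0_rightP (P : R -> Prop) : (\forall t \near 0^'+, P t) <->
  exists2 e : R, 0 < e & forall t, 0 < t < e -> P t.
Proof.
split.
  rewrite near_withinE => /nbhs_ballP [e /= e0 H]; exists e => // t /andP[t0 te].
  by apply: H => //; rewrite /ball/= sub0r normrN ger0_norm// ltW.
move=> [e e0 H]; rewrite near_withinE; apply/nbhs_ballP; exists e => //= t.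
rewrite /ball/= sub0r normrN => te t0; apply: H; rewrite t0/=.
by move: te; rewrite ger0_norm// ltW.
Qed.

Variable L : (R -> R) -> R.
Hypothesis cL : cdistr L.

(** The pairing of [f] with the heat extension tends to [gauss_mass R * L f], and its negative part
    tends to 0 by dominated convergence. *)
Lemma heat_fatou f p q (M t1 : R) : smooth f -> (forall x, 0 <= f x) ->
  (forall x, f x != 0 -> p <= x <= q) -> 0 < t1 ->
  (forall x t, p <= x <= q -> 0 < t <= t1 -> - M <= heat L 0 x t) ->
  {ae mu, forall x, p <= x <= q -> forall e, 0 < e ->
     \forall t \near 0^'+, - e <= heat L 0 x t} ->
  0 <= L f.
Proof.
move=> sf f0 fpq t10 HM Hae.
pose r : R := `|p| + `|q|.
have r0 : 0 <= r by rewrite addr_ge0.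
have fr x : r < `|x| -> f x = 0.
  move=> rx; apply/eqP; apply: contraTT rx => /fpq xpq; rewrite -leNgt.
  rewrite /r ler_norml; have := ler_norm q; have := ler_norm (- p); rewrite normrN.
  have := normr_ge0 p; have := normr_ge0 q; lra.
pose t_ n := t1 / n.+1%:R.
have t_0 n : 0 < t_ n by rewrite divr_gt0.
have t_1 n : t_ n <= t1 by rewrite ler_pdivrMr// ler_peMr ?(ltW t10)// ler1n.
(* Only lower bounds are available, so dominated convergence is applied to the negative part, which
   [M] controls on the support of [f]. *)
pose h n x : R := Num.min 0 (heat L 0 x (t_ n)).
pose g n x := f x * h n x.
have ch n : continuous (h n).
  move=> x; apply: (@continuous_min R R (cst 0) (fun x => heat L 0 x (t_ n)) x); first exact: cvg_cst.
  by apply: derivable_cont; have [] := heat_dx cL 0 x (t_0 n).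
have cf := smooth_continuous sf.
have cg n : continuous (g n) := cont_mul cf (@ch n).
have cfh n : continuous (fun x => f x * heat L 0 x (t_ n)).
  apply: (cont_mul cf) => x.
  by apply: derivable_cont; have [] := heat_dx cL 0 x (t_0 n).
pose M' := `|M|.
have gM n x : `|g n x| <= M' * f x.
  have [fx|fx] := eqVneq (f x) 0; first by rewrite /g fx mul0r mulr0 normr0.
  rewrite /g normrM (ger0_norm (f0 x)) mulrC ler_wpM2r// /h ler_norml.
  have HMx := HM x (t_ n) (fpq x fx); rewrite t_0 t_1 in HMx.
  have := HMx isT; have := ler_norm M; rewrite -/M' le_min ge_min => h1 h2.
  have M'0 : 0 <= M' by exact: normr_ge0.
  by rewrite oppr_le0 M'0 (le_trans _ h2) ?lerN2.
pose D : set R := `[- (r + 1), r + 1]%classic.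
have dc : (fun n => \int[mu]_(x in D) (g n x)%:E)%E @ \oo --> (\int[mu]_(x in D) (cst 0 x : \bar R))%E.
  have [|||||_ _ H] := @dominated_convergence _ _ R mu D (measurable_itv _) (fun n x => (g n x)%:E) (cst 0%E)
     (fun x => (M' * f x)%:E).
  - move=> n; apply/measurable_EFinP; apply: measurable_funTS.
    exact: continuous_measurable_fun.
  - exact: measurable_cst.
  - apply: (@filterS _ _ (ae_filter_ringOfSetsType mu) _ _ _ Hae) => x Hx _.
    apply: cvg_EFin; first by near=> n.
    rewrite (_ : fine \o _ = fun n => g n x)//.
    have [fx|fx] := eqVneq (f x) 0.
      rewrite (_ : (fun n => g n x) = cst 0); first exact: cvg_cst.
      by apply/funext => n; rewrite /g fx mul0r.
    rewrite -(mulr0 (f x)); apply: cvgMr; apply/cvgrPdist_le => e e0.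
    have /near_0_rightP [d d0 Hd] := Hx (fpq x fx) e e0.
    exists (Num.truncn (t1 / d)).+1 => // n /= nd; rewrite sub0r normrN /h.
    have td : 0 < t_ n < d.
      rewrite t_0/= ltr_pdivrMr// mulrC -ltr_pdivrMr//.
      apply: (lt_le_trans (truncnS_gt _)); rewrite ler_nat; exact: leqW.
    have := Hd _ td => h1.
    rewrite ler_norml le_min ge_min h1 (ltW e0) oppr_le0 (ltW e0)//.
  - exact: (@int_integrable R (- (r + 1)) (r + 1) _ (@cont_scale R M' f cf)).
  - by apply: aeW => x n _; rewrite abse_EFin lee_fin.
  exact: H.
have ic : intab (- (r + 1)) (r + 1) (g n) @[n --> \oo] --> 0.
  rewrite integral0 in dc.
  exact: (fine_cvg dc).
have [C C0 HC] := conv_limit cL sf r0 fr.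
have lower n : intab (- (r + 1)) (r + 1) (g n) - C * t_ n <= gauss_mass R * L f.
  have := HC _ (t_0 n); rewrite (L_conv cL sf fr r0 (t_0 n)) ler_norml => /andP[_ H1].
  have : intab (- (r + 1)) (r + 1) (g n) <= intab (- (r + 1)) (r + 1) (fun x => f x * heat L 0 x (t_ n)).
    by apply: le_int => // x _; rewrite /g ler_wpM2l// /h ge_min lexx orbT.
  lra.
have tc : t_ n @[n --> \oo] --> 0.
  rewrite -(mulr0 t1); apply: cvgMr; exact: cvg_harmonic.
have : 0 <= gauss_mass R * L f.
  have lc : intab (- (r + 1)) (r + 1) (g n) - C * t_ n @[n --> \oo] --> 0.
    rewrite -(subr0 0) -{2}(mulr0 C); apply: cvgB => //; exact: cvgMr.
  rewrite -(cvg_lim _ lc)//; apply: limr_le; first by apply/cvg_ex; exists 0.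
  by near=> n.
by rewrite pmulr_rge0// gauss_mass_gt0.
Unshelve. all: by end_near. Qed.

End fatou_step.

(** * Positivity *)

Section gluing.
Variable R : realType.
Implicit Types (f g : R -> R) (x y a b c d t z r e : R) (m n k N j : nat).
Local Notation mu := (@lebesgue_measure R).
Variable L : (R -> R) -> R.
Hypothesis cL : cdistr L.

Definition pos_within l u := forall f, smooth f -> (forall x, 0 <= f x) ->
  (forall x, f x != 0 -> l <= x <= u) -> 0 <= L f.

(** Positivity on the open interval, expressed by a margin [e] at both ends; [pos_within] is the
    version for a closed interval, which is the one that glues. *)
Definition pos_on a b := forall f, smooth f -> (forall x, 0 <= f x) ->
  (exists2 e, 0 < e & forall x, f x != 0 -> a + e <= x <= b - e) -> 0 <= L f.

Lemma pos_on_within a b l u : pos_on a b -> a < l -> u < b -> pos_within l u.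
Proof.
move=> H al ub f sf f0 fl; apply: H => //.
exists (Num.min (l - a) (b - u)); first by rewrite lt_min !subr_gt0 al.
have H1 : Num.min (l - a) (b - u) <= l - a by rewrite ge_min lexx.
have H2 : Num.min (l - a) (b - u) <= b - u by rewrite ge_min lexx orbT.
by move=> x /fl; lra.
Qed.

Lemma pos_onW a b c d : pos_on a b -> a <= c -> d <= b -> pos_on c d.
Proof.
move=> H ac db f sf f0 [e e0 fl]; apply: H => //; exists e => // x /fl; lra.
Qed.

(** A step that rises across the overlap from [l'] to [u] splits [f] into one part for each
    interval. *)
Lemma pos_within_glue l l' u u' : l' < u -> pos_within l u -> pos_within l' u' ->
  pos_within l u'.
Proof.
move=> lu H H' f sf f0 fl.
pose s y := step ((y - l') / (u - l')).
have ss : smooth s := @smooth_dil R _ l' (u - l') (@smooth_step R).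
have s1 : smooth (fun y => 1 - s y) := smoothB (@smooth_cst R 1) ss.
have ul : 0 < u - l' by rewrite subr_gt0.
have -> : f = (fun y => f y * s y + f y * (1 - s y)) by apply/funext => y; ring.
rewrite (cdistrD cL (smoothM sf ss) (smoothM sf s1)) addr_ge0//.
  apply: H' => [|y|y]; first exact: smoothM sf ss.
    by rewrite mulr_ge0// step_ge0.
  move=> H1; have fy : f y != 0 by apply: contraNneq H1 => ->; rewrite mul0r.
  have /andP[_ ->] := fl y fy; rewrite andbT leNgt; apply/negP => yl.
  move/eqP: H1; apply; rewrite /s step0 ?mulr0// ler_pdivrMr// mul0r; lra.
apply: H => [|y|y]; first exact: smoothM sf s1.
  by rewrite mulr_ge0// subr_ge0 step_le1.
move=> H1; have fy : f y != 0 by apply: contraNneq H1 => ->; rewrite mul0r.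
have /andP[-> _] := fl y fy; rewrite /= leNgt; apply/negP => yl.
move/eqP: H1; apply; rewrite /s step1 ?subrr ?mulr0// ler_pdivlMr// mul1r; lra.
Qed.

(** A connectedness argument: if positivity holds from [m] up to points close to the supremum of all
    such end points, gluing with a neighbourhood of the supremum carries it further, unless the
    supremum is [M]. *)
Lemma pos_on_local a b :
  (forall x, a < x < b -> exists2 r, 0 < r & pos_on (x - r) (x + r)) -> pos_on a b.
Proof.
move=> Hloc f sf f0 [e e0 fl].
pose m := a + e; pose M := b - e.
have [mM|Mm] := leP m M; last first.
  have -> : f = cst 0; last by rewrite (cdistr0 cL).
  apply/funext => x; apply/eqP; apply: contraT => /fl; rewrite -/m -/M => /andP[h1 h2].
  by have := le_lt_trans (le_trans h1 h2) Mm; rewrite ltxx.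
suff H : pos_within m M by exact: H.
pose S := [set y | m <= y <= M /\ pos_within m y].
have loc x : m <= x <= M -> exists2 r, 0 < r & pos_within (x - r) (x + r).
  move=> xm; have [|r r0 Hr] := Hloc x; first by move: xm; rewrite /m /M; lra.
  exists (r / 2); first by rewrite divr_gt0.
  by apply: (pos_on_within Hr); lra.
have sub l u l' u' : pos_within l u -> l <= l' -> u' <= u -> pos_within l' u'.
  by move=> H ll uu g sg g0 gl; apply: H => // x /gl; lra.
have Sm : S m.
  split; first by rewrite lexx.
  by have [|r r0 Hr] := loc m; [rewrite lexx|apply: (sub _ _ _ _ Hr); lra].
have hS : has_sup S by split; [exists m|exists M => y [/andP[]]].
have ms : m <= sup S by apply: ub_le_sup => //; case: hS.
have sM : sup S <= M by apply: ge_sup; [exists m|move=> y [/andP[]]].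
have [|r r0 Hr] := loc (sup S); first by rewrite ms.
have [|y [ym Hy] sy] := @sup_adherent R S (r / 2) _ hS; first by rewrite divr_gt0.
pose z := Num.min (sup S + r / 2) M.
have zM : z <= M by rewrite ge_min lexx orbT.
have zs : z <= sup S + r / 2 by rewrite ge_min lexx.
have Hz : pos_within m z.
  have Q : pos_within (sup S - r) z by apply: (sub _ _ _ _ Hr); lra.
  apply: (pos_within_glue _ Hy Q); lra.
have mz : m <= z by rewrite le_min mM andbT; lra.
have zS : z <= sup S by apply: ub_le_sup; [case: hS|split => //; rewrite mz].
have -> : M = z.
  move: zS; rewrite /z; case: (leP (sup S + r / 2) M) => //; lra.
exact: Hz.
Qed.

Definition small_at c := forall f, test1 f -> forall e, 0 < e ->
  exists2 d, 0 < d & forall t, t != 0 -> `|t| <= d -> `|L (dil f c t)| <= e.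

Lemma small_at_local_bound c : small_at c -> local_bound L 0 c.
Proof.
move=> H f tf; have [d d0 Hd] := H f tf 1 ltr01; exists d => //; exists 1 => t t0 td.
by rewrite expr0 mulr1; exact: Hd.
Qed.

(** Removal of a point. At scale [t], the part of [f] near [c] is [f c] times a dilated bump, small
    by hypothesis, plus the dilate of a function that is [O(t)] with all its derivatives, small by
    the uniform bound. The rest splits into a left and a right part away from [c]. *)
Lemma pos_on_isolated c r : 0 < r -> small_at c -> pos_on (c - r) c -> pos_on c (c + r) ->
  pos_on (c - r) (c + r).
Proof.
move=> r0 sc Hl Hr f sf f0 [e e0 fl].
have [C [N [C0 HC]]] := cdistr_ubp cL (small_at_local_bound sc) 1.
have tb : test1 (@bumpf R) by split; [exact: smooth_bump|move=> x /ltW; exact: bump0].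
have [Bb Bb0 HBb] := test1_bounded N tb.
have [B B0 HB] := @smooth_bounded R f N.+1 (`|c| + 1) sf.
pose K := C * (2 ^+ N * (B * Bb)).
have K0 : 0 <= K by rewrite !mulr_ge0// exprn_ge0.
suff main e' : 0 < e' -> - e' <= L f.
  rewrite leNgt; apply/negP => Lf; have := main (- L f / 2); rewrite divr_gt0 ?oppr_gt0// => /(_ isT); lra.
move=> e'0.
have e'1 : 0 < e' / (2 * (`|f c| + 1)) by rewrite divr_gt0// mulr_gt0// ltr_wpDl.
have [d d0 Hd] := sc _ tb _ e'1.
pose t := Num.min (Num.min d 1) (e' / (2 * (K + 1))).
have K1 : 0 < K + 1 by rewrite ltr_wpDl.
have t0 : 0 < t by rewrite !lt_min d0 ltr01 divr_gt0// mulr_gt0.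
have td : t <= d by rewrite !ge_min lexx.
have t1 : t <= 1 by rewrite !ge_min lexx orbT.
have tK : K * t <= e' / 2.
  apply: (@le_trans _ _ (K * (e' / (2 * (K + 1))))).
    by rewrite ler_wpM2l// ge_min lexx orbT.
  have -> : K * (e' / (2 * (K + 1))) = e' / 2 * (K / (K + 1)) by field; rewrite gt_eqF.
  by rewrite ler_piMr ?ler_pdivrMr// ?mul1r ?lerDl// divr_ge0 ?(ltW e'0).
have tn : t != 0 by rewrite gt_eqF.
pose be y := bumpf ((y - c) / t).
pose s y := step ((y - (c - t / 4)) / (t / 2)).
have sbe : smooth be := @smooth_dil R _ c t (@smooth_bump R).
have ss : smooth s := @smooth_dil R _ (c - t / 4) (t / 2) (@smooth_step R).
have sb1 : smooth (fun y => 1 - be y) := smoothB (@smooth_cst R 1) sbe.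
have ss1 : smooth (fun y => 1 - s y) := smoothB (@smooth_cst R 1) ss.
pose fr y := f y * (1 - be y) * s y.
pose flf y := f y * (1 - be y) * (1 - s y).
have sfr : smooth fr := smoothM (smoothM sf sb1) ss.
have sfl : smooth flf := smoothM (smoothM sf sb1) ss1.
pose ft y := f y * be y.
have sft : smooth ft := smoothM sf sbe.
have fE : f = (fun y => fr y + flf y + ft y) by apply/funext => y; rewrite /fr /flf /ft; ring.
have be1 y : `|y - c| <= t / 2 -> be y = 1.
  move=> yc; rewrite /be bump1// normrM normfV (ger0_norm (ltW t0)) ler_pdivrMr//; lra.
have Lr : 0 <= L fr.
  apply: Hr => // [y|].
    rewrite /fr /be /s; apply: mulr_ge0; last exact: step_ge0.
    by apply: mulr_ge0 => //; rewrite subr_ge0 bump_le1.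
  exists (Num.min e (t / 2)) => [|y Hy]; first by rewrite lt_min e0 divr_gt0.
  have h1 : Num.min e (t / 2) <= e by rewrite ge_min lexx.
  have h2 : Num.min e (t / 2) <= t / 2 by rewrite ge_min lexx orbT.
  have fy : f y != 0 by apply: contraNneq Hy => fy0; rewrite /fr fy0 !mul0r.
  have := fl y fy => yce.
  suff : c + t / 2 <= y by lra.
  rewrite leNgt; apply/negP => yt; move/eqP: Hy; apply.
  have [yc|yc] := leP (c - t / 2) y.
    by rewrite /fr be1 ?subrr ?mulr0 ?mul0r// ler_norml; lra.
  by rewrite /fr /s step0 ?mulr0// ler_pdivrMr ?mul0r ?divr_gt0//; lra.
have Ll : 0 <= L flf.
  apply: Hl => // [y|].
    rewrite /flf /be /s; apply: mulr_ge0; last by rewrite subr_ge0 step_le1.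
    by apply: mulr_ge0 => //; rewrite subr_ge0 bump_le1.
  exists (Num.min e (t / 2)) => [|y Hy]; first by rewrite lt_min e0 divr_gt0.
  have h1 : Num.min e (t / 2) <= e by rewrite ge_min lexx.
  have h2 : Num.min e (t / 2) <= t / 2 by rewrite ge_min lexx orbT.
  have fy : f y != 0 by apply: contraNneq Hy => fy0; rewrite /flf fy0 !mul0r.
  have := fl y fy => yce.
  suff : y <= c - t / 2 by lra.
  rewrite leNgt; apply/negP => yt; move/eqP: Hy; apply.
  have [yc|yc] := leP y (c + t / 2).
    by rewrite /flf be1 ?subrr ?mulr0 ?mul0r// ler_norml; lra.
  by rewrite /flf /s step1 ?subrr ?mulr0// ler_pdivlMr ?mul1r ?divr_gt0//; lra.
pose h (u : R) := (f (t * u + c) - f c) * bumpf u.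
have sft' : smooth (fun u : R => f (t * u + c)) := @smooth_compZ R f t c sf.
have sfd : smooth (fun u : R => f (t * u + c) - f c) := smoothB sft' (@smooth_cst R (f c)).
have th : test1 h.
  split; first exact: (smoothM sfd (@smooth_bump R)).
  by move=> u u1; rewrite /h bump0 ?mulr0// ltW.
have Lt : `|L ft| <= e'.
  have E : ft = (fun y => f c * dil (@bumpf R) c t y + dil h c t y).
    apply/funext => y; rewrite /ft /be /dil /h.
    have -> : t * ((y - c) / t) + c = y by field.
    by ring.
  have sdb := @smooth_dil R _ c t (@smooth_bump R).
  have sdh := @smooth_dil R _ c t th.1.
  rewrite E (@cdistr_linear R L cL (f c) _ _ sdb sdh).
  have nt : `|t| = t by rewrite ger0_norm// ltW.
  have b1 : `|f c * L (dil (@bumpf R) c t)| <= e' / 2.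
    have := Hd t tn; rewrite nt => /(_ td) H1.
    rewrite normrM; apply: (@le_trans _ _ ((`|f c| + 1) * (e' / (2 * (`|f c| + 1))))).
      by apply: ler_pM => //; rewrite lerDl.
    rewrite le_eqVlt; apply/orP; left; apply/eqP; field.
    by rewrite gt_eqF// ltr_wpDl.
  have b2 : `|L (dil h c t)| <= e' / 2.
    apply: le_trans tK; rewrite /K -!mulrA.
    have := HC t h (2 ^+ N * (B * t * Bb)) tn; rewrite nt expr0 mulr1.
    move=> /(_ t1 th) H1; apply: (le_trans (H1 _)); last first.
      by rewrite le_eqVlt; apply/orP; left; apply/eqP; ring.
    move=> m u mN.
    have [u1|u1] := leP `|u| 1; last first.
      by rewrite (test1_derive1n0 _ th u1) normr0 !mulr_ge0 ?exprn_ge0 ?(ltW t0).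
    have Bt : 0 <= B * t by rewrite mulr_ge0// ltW.
    have := @leibniz_bound R N _ (@bumpf R) u (B * t) Bb 1 sfd (@smooth_bump R) Bt Bb0 ler01.
    move=> /(_ _ _ m mN); rewrite expr1n mulr1 => H2; apply: (le_trans (H2 _ _)).
    - move=> i iN; rewrite expr1n mulr1.
      have uc v : `|v - c| <= t * `|u| -> `|v| <= `|c| + 1.
        move=> vc; have := ler_normD (v - c) c; rewrite subrK => h1.
        have : t * `|u| <= 1 by rewrite mulr_ile1// ltW.
        lra.
      case: i iN => [|i] iN.
        rewrite derive1n0.
        have [u0|u0] := leP 0 u.
          have tu0 : c <= t * u + c by rewrite lerDr mulr_ge0// ltW.
          apply: (@le_trans _ _ (B * (t * u + c - c))).
            apply: (@MVT_bound R f (derive1 f) B _ _ tu0).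
              by move=> v _; exact: smooth_is_derive0.
            move=> v vu; have := HB 1%N v isT; rewrite derive1n1; apply.
            apply: uc; rewrite (ger0_norm u0) ler_norml; lra.
          rewrite addrK ler_wpM2l// ler_piMr ?(ltW t0)//.
          by rewrite -(ger0_norm u0).
        have tu0 : t * u + c <= c by rewrite gerDr pmulr_rle0// ltW.
        rewrite distrC; apply: (@le_trans _ _ (B * (c - (t * u + c)))).
          apply: (@MVT_bound R f (derive1 f) B _ _ tu0).
            by move=> v _; exact: smooth_is_derive0.
          move=> v vu; have := HB 1%N v isT; rewrite derive1n1; apply.
          apply: uc; rewrite (ltr0_norm u0) ler_norml; nra.
        rewrite opprD addrCA subrr addr0 -mulrN ler_wpM2l// ler_piMr ?(ltW t0)//.
        by rewrite -(ltr0_norm u0).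
      rewrite (derive1nB i.+1 sft' (@smooth_cst R (f c))) derive1n_cst subr0.
      rewrite (@derive1n_comp_affine R f t c i.+1 sf) normrM mulrC; apply: ler_pM => //.
        apply: (HB i.+1); first exact: leqW.
        by apply: uc; rewrite addrK normrM nt.
      rewrite normrX nt exprS ler_piMr ?(ltW t0)//.
      by apply: exprn_ile1 => //; exact: ltW.
    - by move=> i iN; rewrite expr1n mulr1; apply: HBb.
    by apply: ler_wpM2r; [exact: mulr_ge0|apply: ler_weXn2l => //; rewrite ler1n].
  by apply: (le_trans (ler_normD _ _)); rewrite [leRHS](splitr e') lerD.
rewrite fE (cdistrD cL (smoothD sfr sfl) sft) (cdistrD cL sfr sfl).
move: Lt; rewrite ler_norml; lra.
Qed.


End gluing.

(** * The bad set and the positivity theorem *)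

Section core.
Variable R : realType.
Implicit Types (f g : R -> R) (x y a b c d t z r e : R) (m n k N j : nat).
Local Notation mu := (@lebesgue_measure R).
Variable L : (R -> R) -> R.
Hypothesis cL : cdistr L.
Local Notation pos_on := (pos_on L).
Local Notation small_at := (small_at L).

Section positivity.
Variables A B : R.
Hypothesis small : forall c, A < c < B -> small_at c.

Definition bad x := A < x < B /\ forall r, 0 < r -> ~ pos_on (x - r) (x + r).

Lemma good_ball x : A < x < B -> ~ bad x -> exists2 r, 0 < r & pos_on (x - r) (x + r).
Proof.
move=> xAB /not_andP[//|] /existsNP[r] /not_implyP[r0 /contrapT H]; by exists r.
Qed.

Lemma good_open x : A < x < B -> ~ bad x ->
  exists2 r, 0 < r & forall y, `|y - x| < r -> ~ bad y.
Proof.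
move=> xAB /(good_ball xAB)[r r0 Hr]; exists (r / 2); first by rewrite divr_gt0.
have r20 : 0 < r / 2 by rewrite divr_gt0.
move=> y yx [_ /(_ _ r20)]; apply.
by move: yx; rewrite ltr_norml => yx; apply: (pos_onW Hr); lra.
Qed.

Lemma pos_on_good a b : A <= a -> b <= B ->
  (forall x, a < x < b -> ~ bad x) -> pos_on a b.
Proof.
by move=> Aa bB H; apply: (pos_on_local cL) => x xab; apply: good_ball; [lra|exact: H].
Qed.

Lemma bad_not_isolated x r : bad x -> 0 < r ->
  exists y, [/\ bad y, y != x & `|y - x| < r].
Proof.
move=> bx r0; apply: contrapT => H.
have xAB := bx.1.
pose s := Num.min r (Num.min (x - A) (B - x)).
have s0 : 0 < s by rewrite !lt_min r0 !subr_gt0.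
have sr : s <= r by rewrite ge_min lexx.
have sA : s <= x - A by rewrite ge_min [X in _ || X]ge_min lexx orbT.
have sB : s <= B - x by rewrite ge_min [X in _ || X]ge_min lexx !orbT.
apply: (bx.2 s s0).
have G y : y != x -> `|y - x| < s -> ~ bad y.
  by move=> yx yr byy; apply: H; exists y; split => //; exact: lt_le_trans sr.
apply: (pos_on_isolated cL s0 (small xAB)); apply: pos_on_good; try lra;
  move=> y /andP[y1 y2]; apply: G.
- by rewrite lt_eqF.
- by rewrite ltr_norml; lra.
- by rewrite gt_eqF.
- by rewrite ltr_norml; lra.
Qed.

Variable E : set R.
Hypothesis countableE : countable E.
Hypothesis HE : forall x, A < x < B -> ~ E x -> exists M : R, \forall t \near 0^'+, - M <= heat L 0 x t.

(* Baire's theorem by nested intervals, which avoid the points of E in turn. *)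
Lemma bad_baire p0 : bad p0 -> exists n p r, [/\ 0 < r, bad p &
  forall y t, bad y -> `|y - p| <= r -> 0 < t <= n.+1%:R^-1 -> - n%:R <= heat L 0 y t].
Proof.
move=> bp0; apply: contrapT => H.
have [i inji] : exists i : R -> nat, {in E &, injective i} by apply/countable_injP.
(* A point of the nested intervals satisfies [good_ n] for all [n]: it then avoids [E], and the heat
   extension is unbounded below there as [t] tends to 0, against [HE]. *)
pose good_ n z := ~ (E z /\ i z = n) /\
  exists2 t, 0 < t <= n.+1%:R^-1 & heat L 0 z t < - n%:R.
have refine_ n p r : 0 < r -> bad p -> exists p' r', [/\ 0 < r', bad p',
    (forall z, `|z - p'| <= r' -> `|z - p| <= r) &
    (forall z, `|z - p'| <= r' -> good_ n z)].
  move=> r0 bp.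
  have [y [t [by1 yp tn ht]]] : exists y t, [/\ bad y, `|y - p| <= r / 2,
      0 < t <= n.+1%:R^-1 & heat L 0 y t < - n%:R].
    apply: contrapT => H1; apply: H; exists n, p, (r / 2); split => //.
      by rewrite divr_gt0.
    by move=> y t by1 yp tn; rewrite leNgt; apply/negP => ht; apply: H1; exists y, t.
  have t0 : 0 < t by case/andP: tn.
  have [d d0 Hd] : exists2 d : R, 0 < d & forall z, `|z - y| < d -> heat L 0 z t < - n%:R.
    have cy : {for y, continuous (fun z => heat L 0 z t)}.
      by apply: derivable_cont; have [] := heat_dx cL 0 y t0.
    have : \forall z \near y, heat L 0 z t < - n%:R by apply: (cvgr_lt _ cy).
    move=> /nbhs_ballP[d /= d0 Hd]; exists d => // z zy; apply: Hd.
    by rewrite /ball/= distrC.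
  (* If [y] is the [n]-th point of [E], a nearby bad point takes its place; there is one because the
     bad set has no isolated points. *)
  have [p' [bp' py pe]] : exists p', [/\ bad p', `|p' - y| < Num.min d (r / 2) & ~ (E p' /\ i p' = n)].
    have [[Ey iy]|ny] := pselect (E y /\ i y = n); last first.
      by exists y; split => //; rewrite subrr normr0 lt_min d0 divr_gt0.
    have [|w [bw wy wd]] := @bad_not_isolated y (Num.min d (r / 2)) by1.
      by rewrite lt_min d0 divr_gt0.
    exists w; split => // -[Ew iw]; move/eqP: wy; apply.
    by apply: inji; rewrite ?inE// iw iy.
  have [e e0 He] : exists2 e : R, 0 < e & forall z, `|z - p'| <= e -> ~ (E z /\ i z = n).
    have [[w [Ew iw]]|nw] := pselect (exists w, E w /\ i w = n); last first.
      by exists 1 => // z _ Hz; apply: nw; exists z.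
    have wp : p' != w by apply/eqP => wp; apply: pe; rewrite wp.
    exists (`|w - p'| / 2) => [|z zp [Ez iz]].
      by rewrite divr_gt0// normr_gt0 subr_eq0 eq_sym.
    have zw : z = w by apply: inji; rewrite ?inE// iz iw.
    have wp0 : 0 < `|w - p'| by rewrite normr_gt0 subr_eq0 eq_sym.
    by move: zp; rewrite zw; lra.
  have [pd pr] : `|p' - y| < d /\ `|p' - y| < r / 2.
    by move: py; rewrite lt_min => /andP[].
  pose r' := Num.min e (Num.min ((d - `|p' - y|) / 2) (r / 2 - `|p' - y|)).
  have r'e : r' <= e by rewrite ge_min lexx.
  have r'd : r' <= (d - `|p' - y|) / 2 by rewrite ge_min [X in _ || X]ge_min lexx orbT.
  have r'r : r' <= r / 2 - `|p' - y| by rewrite ge_min [X in _ || X]ge_min lexx !orbT.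
  have r'0 : 0 < r' by rewrite !lt_min e0 divr_gt0 ?subr_gt0.
  have tri z : `|z - p'| <= r' -> `|z - y| <= r' + `|p' - y|.
    by move=> zp; have := ler_distD p' z y; lra.
  exists p', r'; split => // z zp; have zy := tri z zp.
    by have := ler_distD y z p; lra.
  split; first by apply: He; lra.
  by exists t => //; apply: Hd; lra.
have refine2 n (s : {s : R * R | 0 < s.2 /\ bad s.1}) :
    {s' : {s : R * R | 0 < s.2 /\ bad s.1} |
      (forall z, `|z - (sval s').1| <= (sval s').2 -> `|z - (sval s).1| <= (sval s).2) /\
      (forall z, `|z - (sval s').1| <= (sval s').2 -> good_ n z)}.
  apply: cid; case: s => -[p r] /= [r0 bp].
  have [p' [r' [r'0 bp' h1 h2]]] := refine_ n p r r0 bp.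
  by exists (exist _ (p', r') (conj r'0 bp')).
pose ri := Num.min (p0 - A) (B - p0) / 2.
have pAB := bp0.1.
have ri0 : 0 < ri by rewrite divr_gt0// lt_min !subr_gt0.
pose S := fix S n : {s : R * R | 0 < s.2 /\ bad s.1} :=
  if n is m.+1 then sval (refine2 m (S m)) else exist _ (p0, ri) (conj ri0 bp0).
pose p n := (sval (S n)).1; pose r n := (sval (S n)).2.
have r0 n : 0 < r n by rewrite /r; case: (svalP (S n)).
have HS n : (forall z, `|z - p n.+1| <= r n.+1 -> `|z - p n| <= r n) /\
  (forall z, `|z - p n.+1| <= r n.+1 -> good_ n z) by exact: (svalP (refine2 n (S n))).
have nest n m z : (n <= m)%N -> `|z - p m| <= r m -> `|z - p n| <= r n.
  move=> /subnK <-; elim: (m - n)%N => // k IH h; apply: IH.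
  by move: h; rewrite addSn; case: (HS (k + n)%N) => h _; exact: h.
pose D := range (fun n => p n - r n).
have lohi n m : p n - r n <= p m + r m.
  have [nm|/ltnW mn] := leqP n m.
    have := nest n m (p m) nm; rewrite subrr normr0 (ltW (r0 m)) => /(_ isT).
    by rewrite ler_norml; have := r0 m; lra.
  have := nest m n (p n) mn; rewrite subrr normr0 (ltW (r0 n)) => /(_ isT).
  by rewrite ler_norml; have := r0 n; lra.
have hA : has_sup D.
  by split; [exists (p 0%N - r 0%N); exists 0%N|exists (p 0%N + r 0%N) => _ [n _ <-]].
pose z := sup D.
have zn n : `|z - p n| <= r n.
  have h1 : p n - r n <= z by apply: ub_le_sup; [case: hA|exists n].
  have h2 : z <= p n + r n by apply: ge_sup; [case: hA|move=> _ [m _ <-]].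
  by rewrite ler_norml; lra.
have G n : good_ n z by apply: (HS n).2.
have nEz : ~ E z by move=> Ez; have [[]] := G (i z).
have zAB : A < z < B.
  have h1 : Num.min (p0 - A) (B - p0) <= p0 - A by rewrite ge_min lexx.
  have h2 : Num.min (p0 - A) (B - p0) <= B - p0 by rewrite ge_min lexx orbT.
  have := zn 0%N; rewrite /p /r /= /ri ler_norml; lra.
have [M /near_0_rightP[e e0 He]] := HE zAB nEz.
pose n1 := Num.bound `|M|; pose n2 := Num.bound e^-1.
have Mn : M <= (n1 + n2)%:R.
  apply: (le_trans (ler_norm _)); apply: (le_trans (ltW (archi_boundP (normr_ge0 _)))).
  by rewrite ler_nat leq_addr.
have ne : (n1 + n2).+1%:R^-1 < e.
  rewrite -(invrK e) ltf_pV2 ?posrE ?invr_gt0//.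
  have e1 : 0 <= e^-1 by rewrite invr_ge0 ltW.
  apply: (lt_trans (archi_boundP e1)); by rewrite ltr_nat ltnS leq_addl.
have [_ [t /andP[t0 tn] ht]] := G (n1 + n2)%N.
have H3 : - M <= heat L 0 z t by apply: He; rewrite t0 /=; exact: le_lt_trans tn ne.
have H4 : - (n1 + n2)%:R <= - M by rewrite lerN2.
by have := lt_le_trans ht (le_trans H4 H3); rewrite ltxx.
Qed.

Theorem positivity : {ae mu, forall x, A < x < B -> forall e, 0 < e ->
    \forall t \near 0^'+, - e <= heat L 0 x t} ->
  pos_on A B.
Proof.
move=> Hae; apply: pos_on_good => // x0 _ bx0.
have [n [p [r [r0 bp Hp]]]] := bad_baire bx0.
(* Three bad points in the portion: the outer two bound an interval on which positivity is proved,
   which contradicts badness of the middle one. *)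
have [lo [mid [hi [lm mh [bl bm bh] rl rh]]]] : exists lo mid hi,
   [/\ lo < mid, mid < hi, [/\ bad lo, bad mid & bad hi], p - r <= lo & hi <= p + r].
  have [y [by1 yp yr]] := bad_not_isolated bp r0.
  have yp0 : 0 < `|y - p| by rewrite normr_gt0 subr_eq0.
  have [w [bw wp wr]] := bad_not_isolated bp yp0.
  move: yr wr; rewrite ltr_norml.
  case: (ltgtP y p) yp => // yp _; case: (ltgtP w p) wp => // wp _ yr.
  - rewrite (ltr0_norm (x := y - p)) ?subr_lt0// ltr_norml => wr.
    by exists y, w, p; split => //; lra.
  - rewrite (ltr0_norm (x := y - p)) ?subr_lt0// ltr_norml => wr.
    by exists y, p, w; split => //; lra.
  - rewrite (gtr0_norm (x := y - p)) ?subr_gt0// ltr_norml => wr.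
    by exists w, p, y; split => //; lra.
  - rewrite (gtr0_norm (x := y - p)) ?subr_gt0// ltr_norml => wr.
    by exists p, w, y; split => //; lra.
have t1 : 0 < n.+1%:R^-1 :> R by rewrite invr_gt0.
have bnd x t : lo <= x <= hi -> 0 < t <= n.+1%:R^-1 -> - n%:R <= heat L 0 x t.
  move=> xlh tn; have [bx|nbx] := pselect (bad x).
    by apply: Hp => //; rewrite ler_norml; lra.
  (* The nearest bad points on either side of [x] delimit its gap. They are bad because the bad set
     is closed, so the bound holds on both sides of the gap. *)
  pose S := [set y | bad y /\ y <= x]; pose T := [set y | bad y /\ x <= y].
  have hS : has_sup S by split; [exists lo; split => //; lra|exists x => y []].
  have hT : has_inf T by split; [exists hi; split => //; lra|exists x => y []].
  have lS : lo <= sup S by apply: ub_le_sup; [case: hS|split => //; lra].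
  have Sx : sup S <= x by apply: ge_sup; [case: hS|move=> y []].
  have hTi : inf T <= hi by apply: ge_inf; [case: hT|split => //; lra].
  have xT : x <= inf T by apply: lb_le_inf; [case: hT|move=> y []].
  have lAB := bl.1; have hAB := bh.1.
  have bS : bad (sup S).
    apply: contrapT => /good_open -/(_ ltac:(lra))[e e0 He].
    have [y [by1 yx] ys] := sup_adherent e0 hS; apply: (He y) => //.
    have : y <= sup S by apply: ub_le_sup; [case: hS|split].
    rewrite ltr_norml; lra.
  have bT : bad (inf T).
    apply: contrapT => /good_open -/(_ ltac:(lra))[e e0 He].
    have [y [by1 yx] ys] := inf_adherent e0 hT; apply: (He y) => //.
    have : inf T <= y by apply: ge_inf; [case: hT|split].
    rewrite ltr_norml; lra.
  have Sx' : sup S < x.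
    by rewrite lt_neqAle Sx andbT; apply/eqP => sx; apply: nbx; rewrite -sx.
  have xT' : x < inf T.
    by rewrite lt_neqAle xT andbT; apply/eqP => sx; apply: nbx; rewrite sx.
  apply: (@heat_gap R L cL (sup S) (inf T) n%:R n.+1%:R^-1) => //.
  - lra.
  - by apply: small_at_local_bound; apply: small; lra.
  - by apply: small_at_local_bound; apply: small; lra.
  - apply: pos_on_good => [||y /andP[y1 y2] byy]; try lra.
    have [yx|/ltW xy] := leP y x.
      have : y <= sup S by apply: ub_le_sup; [case: hS|split].
      lra.
    have : inf T <= y by apply: ge_inf; [case: hT|split].
    lra.
  - by move=> s sn; apply: Hp => //; rewrite ler_norml; lra.
  - by move=> s sn; apply: Hp => //; rewrite ler_norml; lra.
  - by rewrite Sx xT.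
have Hpos : pos_on lo hi.
  move=> f sf f0 [e e0 fl].
  apply: (heat_fatou cL sf f0 _ t1 bnd); first by move=> x /fl; lra.
  apply: (@filterS _ _ (ae_filter_ringOfSetsType mu) _ _ _ Hae) => x Hx xlh.
  by apply: Hx; have := bl.1; have := bh.1; lra.
apply: (bm.2 (Num.min (mid - lo) (hi - mid))); first by rewrite lt_min !subr_gt0 lm.
apply: (pos_onW Hpos).
  have : Num.min (mid - lo) (hi - mid) <= mid - lo by rewrite ge_min lexx.
  lra.
have : Num.min (mid - lo) (hi - mid) <= hi - mid by rewrite ge_min lexx orbT.
lra.
Qed.

End positivity.
End core.

(** * Distributions *)

Section tests.
Variable R : realType.
Implicit Types (f psi : R -> R) (x y a b c d t z r e : R) (m n k N j : nat).
Implicit Types g h : sdistr R.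

Lemma fsupport_sub f (K : set R) : closed K -> (forall x, f x != 0 -> K x) ->
  fsupport f `<=` K.
Proof. by move=> cK fK; rewrite ((closure_id _).1 cK); apply: closureS. Qed.

Lemma test_functionP f : test_function f <->
  smooth f /\ exists2 r : R, 0 < r & forall x, f x != 0 -> `|x| <= r.
Proof.
split=> [[sf /compact_bounded[M [_ HM]]]|[sf [r r0 fr]]].
  split => //; have M1 : M < `|M| + 1 by rewrite (le_lt_trans (ler_norm M))// ltrDl.
  exists (`|M| + 1); first by rewrite ltr_wpDl.
  by move=> x fx; apply: HM => //; exact: subset_closure.
split => //; apply: (@subclosed_compact _ _ `[- r, r]%classic).
- exact: closed_closure.
- exact: segment_compact.
apply: fsupport_sub; first exact: interval_closed.
by move=> x /fr; rewrite /= in_itv/= ler_norml.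
Qed.

Lemma test_functionI f a b : smooth f -> (forall x, f x != 0 -> a <= x <= b) ->
  test_function f.
Proof.
move=> sf fab; apply/test_functionP; split => //; exists (`|a| + `|b| + 1).
  by rewrite ltr_wpDl// addr_ge0.
move=> x /fab; have := ler_norm b; have := ler_norm (- a); rewrite normrN ler_norml.
have := normr_ge0 a; have := normr_ge0 b; lra.
Qed.

Lemma test_functionW f psi : smooth f -> test_function psi ->
  (forall x, f x != 0 -> psi x != 0) -> test_function f.
Proof.
move=> sf /test_functionP[_ [r r0 pr]] fp; apply/test_functionP; split => //.
by exists r => // x /fp /pr.
Qed.

Lemma test_functionM f psi : smooth f -> test_function psi ->
  test_function (fun x => psi x * f x).
Proof.
move=> sf tp; apply: (test_functionW (smoothM tp.1 sf) tp) => x.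
by apply: contraNneq => ->; rewrite mul0r.
Qed.

Lemma test_functionL c f psi : test_function f -> test_function psi ->
  test_function (fun x => c * f x + psi x).
Proof.
move=> /test_functionP[sf [r r0 fr]] /test_functionP[sp [s s0 ps]].
apply/test_functionP; split; first exact: (smoothD (@smoothZ R c f sf) sp).
exists (r + s) => [|x]; first exact: addr_gt0.
have [f0|/fr xr _] := eqVneq (f x) 0; last by lra.
by rewrite f0 mulr0 add0r => /ps; lra.
Qed.

Lemma test_functionZ c f : test_function f -> test_function (fun x => c * f x).
Proof.
move=> tf; apply: (test_functionW (@smoothZ R c f tf.1) tf) => x.
by apply: contraNneq => ->; rewrite mulr0.
Qed.

Lemma test_function0 : test_function (cst 0 : R -> R).
Proof. by apply: (@test_functionI _ 0 0); [exact: smooth_cst|move=> x; rewrite eqxx]. Qed.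

Lemma test_functionB f psi : test_function f -> test_function psi ->
  test_function (fun x => f x - psi x).
Proof.
move=> tf tp; have := test_functionL (-1) tp tf; congr test_function.
by apply/funext => x; rewrite mulN1r addrC.
Qed.

Lemma test_functionD f psi : test_function f -> test_function psi ->
  test_function (fun x => f x + psi x).
Proof.
move=> tf tp; have := test_functionL 1 tf tp; congr test_function.
by apply/funext => x; rewrite mul1r.
Qed.

Lemma test_function_dil f c t : t != 0 -> test_function f ->
  test_function (fun y => f ((y - c) / t)).
Proof.
move=> t0 /test_functionP[sf [r r0 fr]]; apply/test_functionP.
split; first exact: (@smooth_dil R f c t sf).
exists (r * `|t| + `|c|) => [|x /fr].
  by rewrite ltr_pwDl// mulr_gt0// normr_gt0.
rewrite normrM normfV ler_pdivrMr ?normr_gt0// => h.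
by have := ler_normD (x - c) c; rewrite subrK; lra.
Qed.

Lemma test_function_dilate f c t : t != 0 -> test_function f ->
  test_function (dilate f c t).
Proof.
move=> t0 tf; exact: (@test_functionZ `|t|^-1 _ (test_function_dil c t0 tf)).
Qed.

Lemma smooth_dilate f c t : smooth f -> smooth (dilate f c t).
Proof. by move=> sf; exact: (@smoothZ R `|t|^-1 _ (@smooth_dil R f c t sf)). Qed.

Lemma test_function_bump : test_function (@bumpf R).
Proof.
apply: (@test_functionI _ (-1) 1); first exact: smooth_bump.
move=> x; apply: contraNT => H; rewrite bump0//.
by move: H; rewrite -ler_norml -ltNge => /ltW.
Qed.

Section linear.
Variable g : sdistr R.

Lemma sdistr0 : g (cst 0) = 0.
Proof.
have := spair_linear g 1 test_function0 test_function0.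
have -> : (fun x : R => (1 : R) * cst 0 x + cst 0 x) = cst 0.
  by apply/funext => x; rewrite /= mulr0 addr0.
by rewrite mul1r -[LHS]addr0 => /addrI <-.
Qed.

Lemma sdistrZ c f : test_function f -> g (fun x => c * f x) = c * g f.
Proof.
move=> tf; have := spair_linear g c tf test_function0; rewrite sdistr0 addr0 => <-.
by congr (spair g); apply/funext => x; rewrite addr0.
Qed.

Lemma sdistrD f psi : test_function f -> test_function psi ->
  g (fun x => f x + psi x) = g f + g psi.
Proof.
move=> tf tp; have := spair_linear g 1 tf tp; rewrite mul1r => <-.
by congr (spair g); apply/funext => x; rewrite mul1r.
Qed.

Lemma sdistrB f psi : test_function f -> test_function psi ->
  g (fun x => f x - psi x) = g f - g psi.
Proof.
move=> tf tp; have := spair_linear g (-1) tp tf; rewrite mulN1r addrC => <-.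
by congr (spair g); apply/funext => x; rewrite mulN1r addrC.
Qed.

Lemma supported_out a b psi : supported_in g `[a, b] -> test_function psi ->
  (exists2 e : R, 0 < e & forall x, a - e <= x <= b + e -> psi x = 0) -> g psi = 0.
Proof.
move=> sg tp [e e0 He]; apply: sg => //.
rewrite -subset0 => x [/=]; rewrite in_itv/= => fx xab.
have /fsupport_sub : closed (~` [set y : R | a - e < y < b + e]).
  apply: open_closedC; rewrite [X in open X](_ : _ = `]a - e, b + e[%classic).
    exact: interval_open.
  by apply/seteqP; split => y /=; rewrite in_itv.
move=> /(_ psi)/(_ _ _ fx); apply => [y py /= yab|/=]; last lra.
by move/eqP: py; apply; apply: He; lra.
Qed.

End linear.

Section sdlin.
Variables (c : R) (g h : sdistr R).
Let p f := c * g f + h f.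

Let p_linear d f psi : test_function f -> test_function psi ->
  p (fun x => d * f x + psi x) = d * p f + p psi.
Proof. by move=> tf tp; rewrite /p !spair_linear//; ring. Qed.

Let p_continuous (K : set R) : compact K ->
  exists (C : R) (N : nat), forall f (B : R),
    test_function f -> fsupport f `<=` K ->
    (forall (m : nat) (x : R), (m <= N)%N -> `|derive1n m f x| <= B) ->
    `|p f| <= C * B.
Proof.
move=> cK; have [C1 [N1 H1]] := spair_continuous g cK.
have [C2 [N2 H2]] := spair_continuous h cK.
exists (`|c| * C1 + C2), (maxn N1 N2) => f B tf fK fB.
rewrite mulrDl; apply: (le_trans (ler_normD _ _)); rewrite normrM -mulrA lerD//.
  rewrite ler_wpM2l//; apply: H1 => // m x mN; apply: fB.
  by rewrite (leq_trans mN)// leq_maxl.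
by apply: H2 => // m x mN; apply: fB; rewrite (leq_trans mN)// leq_maxr.
Qed.

Definition sdlin : sdistr R := SDistr p_linear p_continuous.

End sdlin.

Lemma sdlin_dderiv c g h psi : dderiv (sdlin c g h) psi = sdlin c (dderiv g) (dderiv h) psi.
Proof. by rewrite /= /sdlin/=; ring. Qed.

Definition plateau r : R -> R := fun x => bumpf ((x - 0) / (2 * r)).

Lemma test_plateau r : 0 < r -> test_function (plateau r).
Proof.
move=> r0; apply: test_function_dil; last exact: test_function_bump.
by rewrite mulf_neq0// gt_eqF.
Qed.

Lemma plateau1 r x : 0 < r -> `|x| <= r -> plateau r x = 1.
Proof.
move=> r0 xr; rewrite /plateau subr0 bump1// normrM normfV (ger0_norm (x := 2 * r)).
  by rewrite ler_pdivrMr ?mulr_gt0//; lra.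
by rewrite mulr_ge0// ltW.
Qed.

Lemma plateau0 r x : 0 < r -> 2 * r <= `|x| -> plateau r x = 0.
Proof.
move=> r0 xr; rewrite /plateau subr0 bump0// normrM normfV (ger0_norm (x := 2 * r)).
  by rewrite ler_pdivlMr ?mulr_gt0// mul1r.
by rewrite mulr_ge0// ltW.
Qed.

(** Multiplication by a plateau turns [g] into a compactly supported functional, to which the
    results on [cdistr] apply. *)
Definition cutd g r : (R -> R) -> R := fun psi => g (fun x => plateau r x * psi x).

Lemma cdistr_cut g r : 0 < r -> cdistr (cutd g r).
Proof.
move=> r0; have tc := test_plateau r0; split.
  move=> c f psi sf sp; rewrite /cutd.
  rewrite -(spair_linear g c (test_functionM sf tc) (test_functionM sp tc)).
  by congr (spair g); apply/funext => x; ring.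
have [C [N HC]] := spair_continuous g tc.2.
have [B B0 HB] := @smooth_bounded R (plateau r) N (2 * r) tc.1.
exists (2 * r), (`|C| * (2 ^+ N * B)), N => f D sf HD.
have D0 : 0 <= D.
  by apply: le_trans (HD 0%N 0 isT _); rewrite ?normr0 ?mulr_ge0// ltW.
have H : `|cutd g r f| <= C * (2 ^+ N * (B * D)).
  apply: HC; first exact: test_functionM.
    apply: fsupport_sub; first exact: closed_closure.
    move=> x px; apply: subset_closure => /=; apply: contraNneq px => ->.
    by rewrite mul0r.
  move=> m x mN; have [xr|xr] := leP `|x| (2 * r); last first.
    rewrite (@derive1n_eq_open _ [set y | 2 * r < `|y - 0|] _ (cst 0)).
    - by rewrite derive1n_cst; case: m mN => *; rewrite normr0 !mulr_ge0// exprn_ge0.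
    - exact: open_norm_gt.
    - by move=> y /=; rewrite subr0 => yr; rewrite plateau0 ?mul0r// ltW.
    - by rewrite /= subr0.
  have := @leibniz_bound R N _ _ x B D 1 tc.1 sf B0 D0 ler01.
  move=> /(_ _ _ m mN); rewrite expr1n mulr1 => H; apply: (le_trans (H _ _)).
  - by move=> i iN; rewrite expr1n mulr1; apply: HB.
  - by move=> i iN; rewrite expr1n mulr1; apply: HD.
  by apply: ler_wpM2r; [exact: mulr_ge0|apply: ler_weXn2l => //; rewrite ler1n].
apply: (le_trans H); rewrite -!mulrA; apply: ler_wpM2r; last exact: ler_norm.
by rewrite !mulr_ge0// exprn_ge0.
Qed.

Lemma cut_on g r psi : 0 < r -> (forall x, psi x != 0 -> `|x| <= r) -> cutd g r psi = g psi.
Proof.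
move=> r0 pr; congr (spair g); apply/funext => x.
have [->|/pr xr] := eqVneq (psi x) 0; first by rewrite mulr0.
by rewrite plateau1// mul1r.
Qed.

Lemma supported_compact g (K O : set R) psi : supported_in g K -> open O -> K `<=` O ->
  test_function psi -> (forall x, O x -> psi x = 0) -> g psi = 0.
Proof.
move=> sg oO KO tp pO; apply: sg => //; rewrite -subset0 => x [/= fx /KO Ox].
have H : fsupport psi `<=` ~` O.
  apply: fsupport_sub; first exact: open_closedC.
  by move=> y py Oy; move/eqP: py; apply; exact: pO.
exact: (H x fx Ox).
Qed.

(** Whichever [chi] the choice operator selects, both sides equal the pairing with
    [chi * plateau r * psi], since each cut-off is 1 near a set that supports [g]. *)
Lemma cpair_cut g a b r psi : supported_in g `[a, b] -> 0 < r -> - r < a -> b < r ->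
  smooth psi -> cpair g psi = cutd g r psi.
Proof.
move=> sg r0 ra br sp; rewrite /cpair.
have tc := test_plateau r0.
case: xgetP => [y yE|H]; last first.
  exfalso; apply: (H (cutd g r psi)).
  exists `[a, b]%classic, `](- r), r[%classic, (plateau r); split => //.
  - exact: segment_compact.
  - by move=> x /=; rewrite !in_itv/= => /andP[h1 h2]; apply/andP; split; lra.
  - split => // x /=; rewrite in_itv/= => xr; apply: plateau1 => //.
    by rewrite ler_norml; lra.
case=> K [ O [chi [_ sK oO KO [tchi chi1 E]]]].
rewrite {}E {y yE}.
apply/eqP; rewrite -subr_eq0; apply/eqP.
have t1 := test_functionM sp tchi; have t2 := test_functionM sp tc.
have t3 := test_functionM t2.1 tchi.
have E1 : g (fun x => chi x * psi x) = g (fun x => chi x * (plateau r x * psi x)).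
  apply/eqP; rewrite -subr_eq0 -(sdistrB g t1 t3); apply/eqP.
  have oI : open (`](- r), r[%classic : set R) by exact: interval_open.
  have sI : `[a, b]%classic `<=` (`](- r), r[%classic : set R).
    by move=> x /=; rewrite !in_itv/= => /andP[h1 h2]; apply/andP; split; lra.
  have z x : `](- r), r[%classic x -> chi x * psi x - chi x * (plateau r x * psi x) = 0.
    rewrite /= in_itv/= => xr; rewrite plateau1//; first by ring.
    by rewrite ler_norml; lra.
  exact: (supported_compact sg oI sI (test_functionB t1 t3) z).
have E2 : cutd g r psi = g (fun x => chi x * (plateau r x * psi x)).
  apply/eqP; rewrite -subr_eq0 -(sdistrB g t2 t3); apply/eqP.
  have z x : O x -> plateau r x * psi x - chi x * (plateau r x * psi x) = 0.
    by move=> Ox; rewrite chi1//; ring.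
  exact: (supported_compact sK oO KO (test_functionB t2 t3) z).
by rewrite E1 E2 subrr.
Qed.

End tests.

(** * Integrals of test functions, test classes, lower and upper limits *)

Section classes.
Variable R : realType.
Implicit Types (f psi phi : R -> R) (x y a b c d t z r e : R) (m n k N j : nat).
Implicit Types (g h : sdistr R) (A B : R -> R).
Local Notation mu := (@lebesgue_measure R).

Lemma Rintegral_supp a b f : (forall x, f x != 0 -> a <= x <= b) ->
  \int[mu]_x f x = intab a b f.
Proof.
move=> fab; rewrite /intab [RHS]Rintegral_mkcond; congr Rintegral.
apply/funext => x; rewrite patchE; case: ifPn => // xab.
apply/eqP; apply: contraNT xab => /fab xab; rewrite inE/= in_itv/=.
by move: xab.
Qed.

Lemma test_supp2 f psi : test_function f -> test_function psi ->
  exists2 r : R, 0 < r & (forall x, f x != 0 -> - r <= x <= r) /\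
    (forall x, psi x != 0 -> - r <= x <= r).
Proof.
move=> /test_functionP[_ [r r0 fr]] /test_functionP[_ [s s0 ps]].
exists (r + s); first exact: addr_gt0.
by split => x; [move=> /fr|move=> /ps]; rewrite ler_norml; lra.
Qed.

Lemma integral_testL c f psi : test_function f -> test_function psi ->
  \int[mu]_x (c * f x + psi x) = c * \int[mu]_x f x + \int[mu]_x psi x.
Proof.
move=> tf tp; have [r r0 [fr pr]] := test_supp2 tf tp.
rewrite (Rintegral_supp fr) (Rintegral_supp pr) (@Rintegral_supp (- r) r); last first.
  move=> x; have [f0|/fr//] := eqVneq (f x) 0; by rewrite f0 mulr0 add0r => /pr.
have cf := smooth_continuous tf.1; have cp := smooth_continuous tp.1.
rewrite -(intZ _ _ c cf).
have -> : (fun x => c * f x + psi x) = (fun x => c * f x - (-1 * psi x)).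
  by apply/funext => x; ring.
have := @intB R (- r) r _ _ (@cont_scale R c f cf) (@cont_scale R (-1) psi cp).
by move=> ->; rewrite (intZ _ _ (-1) cp); ring.
Qed.

Lemma integral_testZ c f : test_function f ->
  \int[mu]_x (c * f x) = c * \int[mu]_x f x.
Proof.
move=> tf; have /test_functionP[_ [r r0 fr]] := tf.
have fr' x : f x != 0 -> - r <= x <= r by move=> /fr; rewrite ler_norml.
rewrite (Rintegral_supp fr') -intZ; last exact: smooth_continuous tf.1.
by apply: Rintegral_supp => x; have [->|/fr'//] := eqVneq (f x) 0; rewrite mulr0 eqxx.
Qed.

Lemma integral_test_ge0 f : test_function f -> (forall x, 0 <= f x) -> 0 <= \int[mu]_x f x.
Proof. by move=> _ f0; apply: Rintegral_ge0. Qed.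

Lemma integral_derive1 f : test_function f -> \int[mu]_x derive1 f x = 0.
Proof.
move=> /test_functionP[sf [r r0 fr]].
have f0 x : r < `|x| -> f x = 0.
  by move=> xr; apply/eqP; apply: contraTT xr => /fr; rewrite -leNgt.
rewrite (@Rintegral_supp (- (r + 1)) (r + 1)).
  have r1 : - (r + 1) < r + 1 by lra.
  have fd x : - (r + 1) <= x <= r + 1 -> is_derive x 1 f (derive1 f x).
    by move=> _; exact: smooth_is_derive0.
  rewrite (int_FTC r1 fd (smooth_continuous (smooth_derive1 sf))).
  by rewrite !f0 ?subrr// ?normrN ger0_norm ?ltrDl//; lra.
move=> x; apply: contraNT => xr; apply/eqP.
have := @derive1n_eq_open R [set y | r < `|y - 0|] f (cst 0) 1 x (@open_norm_gt R r 0).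
rewrite !derive1n1 derive1_cst /= subr0; apply => [y|]; first by rewrite subr0; exact: f0.
by rewrite ltNge ler_norml; apply: contra xr; lra.
Qed.

Lemma derive1_step_supp x : derive1 (@step R) x != 0 -> 0 <= x <= 1.
Proof.
apply: contraNT; rewrite negb_and -!ltNge => /orP[x0|x1]; apply/eqP.
  have := @derive1n_eq_open R [set y | y < 0] (@step R) (cst 0) 1 x (@open_lt R 0).
  rewrite !derive1n1 derive1_cst /=; apply => // y y0; exact: step0 (ltW y0).
have := @derive1n_eq_open R [set y | 1 < y] (@step R) (cst 1) 1 x (@open_gt R 1).
rewrite !derive1n1 derive1_cst /=; apply => // y y0; exact: step1 (ltW y0).
Qed.

(** A mollifier of integral 1 supported in [[s, s + 1]]; the shift decides on which side of a point
    its dilates lie. *)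
Definition pulse s : R -> R := fun z => derive1 (@step R) (z - s).

Lemma smooth_pulse s : smooth (pulse s).
Proof.
have := @smooth_compZ R _ 1 (- s) (smooth_derive1 (@smooth_step R)).
by congr smooth; apply/funext => x; rewrite mul1r.
Qed.

Lemma pulse_supp s x : pulse s x != 0 -> s <= x <= s + 1.
Proof. by rewrite /pulse => /derive1_step_supp; lra. Qed.

Lemma test_pulse s : test_function (pulse s).
Proof. by apply: test_functionI; [exact: smooth_pulse|exact: pulse_supp]. Qed.

Lemma pulse_is_derive s x : is_derive x 1 (fun x => step (x - s)) (pulse s x).
Proof.
have sS : smooth (fun x : R => step (1 * x + (- s))) := @smooth_compZ R _ 1 (- s) (@smooth_step R).
have := smooth_is_derive0 x sS.
have := @derive1n_comp_affine R (@step R) 1 (- s) 1 (@smooth_step R).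
rewrite derive1n1 => ->; rewrite expr1 mul1r derive1n1 mul1r.
rewrite (_ : (fun x : R => step (1 * x + - s)) = (fun x => step (x - s)))//.
by apply/funext => y; rewrite mul1r.
Qed.

Lemma integral_pulse s : \int[mu]_x pulse s x = 1.
Proof.
rewrite (@Rintegral_supp s (s + 1)); last exact: pulse_supp.
have s1 : s < s + 1 by rewrite ltrDl.
have pd x : s <= x <= s + 1 -> is_derive x 1 (fun x => step (x - s)) (pulse s x).
  by move=> _; exact: pulse_is_derive.
rewrite (int_FTC s1 pd (smooth_continuous (@smooth_pulse s))).
by rewrite step1 ?step0 ?subrr ?subr0//; lra.
Qed.

(** The bump dominates a small multiple of a pulse placed where the bump equals 1, and the integral
    of a pulse is known. *)
Lemma integral_bump_gt0 : 0 < \int[mu]_x @bumpf R x.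
Proof.
have [B B0 HB] := @step_derive_bounded R 1.
have B1 : 0 < B + 1 by rewrite ltr_wpDl.
pose p x := bumpf x + (- (B + 1)^-1) * pulse (- (1 / 2)) x.
have tp : test_function p.
  have := test_functionL (- (B + 1)^-1) (test_pulse (- (1 / 2))) (test_function_bump R).
  by congr test_function; apply/funext => x; rewrite /p addrC.
have p0 x : 0 <= p x.
  rewrite /p mulNr subr_ge0.
  have [->|px] := eqVneq (pulse (- (1 / 2)) x) 0; first by rewrite mulr0 bump_ge0.
  have xh := pulse_supp px.
  rewrite bump1; last by rewrite ler_norml; lra.
  rewrite mulrC ler_pdivrMr// /pulse; have := HB 1%N (x - - (1 / 2)) isT.
  by rewrite derive1n1 ler_norml; lra.
have := integral_test_ge0 tp p0.
have -> : \int[mu]_x p x = - (B + 1)^-1 * 1 + \int[mu]_x @bumpf R x.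
  rewrite -[X in _ * X + _](integral_pulse (- (1 / 2))).
  rewrite -(integral_testL _ (test_pulse _) (test_function_bump R)).
  by congr Rintegral; apply/funext => x; rewrite /p addrC.
by rewrite mulr1 addrC subr_ge0; apply: lt_le_trans; rewrite invr_gt0.
Qed.

Lemma test_T0 f : test_function f -> (forall x, 0 <= f x) -> 0 < \int[mu]_x f x ->
  T0 (fun x => (\int[mu]_x f x)^-1 * f x).
Proof.
move=> tf f0 i0; have tz := test_functionZ (\int[mu]_x f x)^-1 tf; split.
- exact: tz.1.
- by move=> x; rewrite mulr_ge0// invr_ge0 ltW.
- by rewrite integral_testZ// mulVf// gt_eqF.
exists (-2); first by lra.
move=> m; have /test_functionP[sz [r r0 zr]] := tz; exists 0, (r + 1) => x xr.
rewrite mul0r (@derive1n_eq_open R [set y | r < `|y - 0|] _ (cst 0)).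
- by rewrite derive1n_cst; case: m; rewrite normr0.
- exact: open_norm_gt.
- move=> y /=; rewrite subr0 => yr; apply/eqP.
  by apply: contraTT yr => /zr; rewrite -leNgt.
- by rewrite /= subr0; lra.
Qed.

Definition bumpn : R -> R := fun x => (\int[mu]_x @bumpf R x)^-1 * bumpf x.

Lemma T1_bumpn : T1 bumpn.
Proof.
split; first exact: test_T0 (test_function_bump R) (@bump_ge0 R) integral_bump_gt0.
move=> x; have := @derive1nZ R (\int[mu]_x @bumpf R x)^-1 _ 1 (@smooth_bump R).
rewrite !derive1n1 /bumpn => ->; rewrite mulrCA pmulr_rle0 ?bump_unimodal//.
by rewrite invr_gt0 integral_bump_gt0.
Qed.

Definition gaussn : R -> R := fun x => (gauss_mass R)^-1 * gauss_fun x.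

Lemma T1_gaussn : T1 gaussn.
Proof.
have g0 := gauss_mass_gt0 R; split; first split.
- exact: (@smoothZ R _ _ (@smooth_gauss R)).
- by move=> x; rewrite mulr_ge0 ?invr_ge0 ?(ltW g0)// expR_ge0.
- have E : gaussn = (fun x => (gauss_mass R)^-1 * gaussc 0 1 x).
    by apply/funext => x; rewrite /gaussn /gaussc subr0 divr1.
  rewrite E RintegralZl//; last exact: gaussc_integrable.
  by rewrite Rintegral_gaussc// mul1r mulVf// gt_eqF.
- exists (-2) => [|m]; first by lra.
  have [C C0 HC] := @gauss_decay R m m.+2.
  exists ((gauss_mass R)^-1 * C), 1 => x x1.
  rewrite (@derive1nZ R _ _ m (@smooth_gauss R)) normrM ger0_norm ?invr_ge0 ?(ltW g0)//.
  rewrite -mulrA ler_wpM2l ?invr_ge0 ?(ltW g0)//.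
  have x0 : 0 < `|x| by lra.
  have -> : -2 - m%:R = - (m.+2)%:R :> R by rewrite -addn2 natrD; ring.
  rewrite powR_invn// ler_pdivlMr ?exprn_gt0//; apply: le_trans (HC x).
  rewrite mulrC ler_wpM2r// lerXn2r ?nnegrE ?addr_ge0// lerDr//.
move=> x; have := @derive1nZ R (gauss_mass R)^-1 _ 1 (@smooth_gauss R).
rewrite !derive1n1 /gaussn => ->; rewrite derive1_gauss mulrCA pmulr_rle0 ?invr_gt0//.
have -> : x * (- 2 * x * gauss_fun x) = - (2 * x ^+ 2 * gauss_fun x) by ring.
rewrite oppr_le0; apply: mulr_ge0; last exact: gauss_fun_ge0.
by rewrite mulr_ge0 ?sqr_ge0.
Qed.

Lemma dilate_gaussn x t : 0 < t -> dilate gaussn x t = (fun y => (gauss_mass R)^-1 * kap 0 x t y).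
Proof.
move=> t0; apply/funext => y; rewrite /dilate /gaussn /kap expr1 derive1n0 (gtr0_norm t0).
by rewrite mulrCA.
Qed.

Lemma ereal_lt_dense (l k : \bar R) : (l < k)%E -> exists r : R, (l < r%:E < k)%E.
Proof.
case: l k => [l| |] [k| |] //=.
- by rewrite lte_fin => lk; exists ((l + k) / 2); rewrite !lte_fin; apply/andP; split; lra.
- by move=> _; exists (l + 1); rewrite lte_fin ltry andbT; lra.
- by move=> _; exists (k - 1); rewrite lte_fin ltNyr /=; lra.
- by move=> _; exists 0; rewrite ltNyr ltry.
Qed.

Section limf.
Variables (F : set_system R) (FF : ProperFilter F).

Lemma einf_gt A r : (r%:E < limf_einf (fun t => (A t)%:E) F)%E -> \forall t \near F, r < A t.
Proof.
rewrite limf_einfE => /ereal_sup_gt[_ [V FV <-] rV]; apply: filterS FV => t Vt.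
by rewrite -lte_fin; apply: (lt_le_trans rV); apply: ereal_inf_lbound; exists t.
Qed.

Lemma einf_ge A (l : \bar R) : (forall r, (r%:E < l)%E -> \forall t \near F, r <= A t) ->
  (l <= limf_einf (fun t => (A t)%:E) F)%E.
Proof.
move=> H; rewrite leNgt; apply/negP => /ereal_lt_dense[r /andP[h1 h2]].
have FV := H r h2; move: h1; rewrite ltNge => /negP; apply.
rewrite limf_einfE.
apply: (@le_trans _ _ (ereal_inf [set (A t)%:E | t in [set t | r <= A t]])).
  by apply: le_ereal_inf_tmp => _ [t rt <-]; rewrite lee_fin.
by apply: ereal_sup_ubound; exists [set t | r <= A t].
Qed.

Lemma esup_opp A : limf_esup (fun t => (A t)%:E) F = (- limf_einf (fun t => (- A t)%:E) F)%E.
Proof. by rewrite -limf_esupN; congr limf_esup; apply/funext => t; rewrite /= opprK. Qed.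

Lemma esup_lt A r : (limf_esup (fun t => (A t)%:E) F < r%:E)%E -> \forall t \near F, A t < r.
Proof.
rewrite esup_opp lteNl -EFinN => /einf_gt; apply: filterS => t.
by rewrite ltrN2.
Qed.

End limf.

Lemma T0_decay phi N : T0 phi -> exists2 alpha : R, alpha < -1 & exists2 K : R, 0 <= K &
  forall m, (m <= N)%N -> forall z, K <= `|z| ->
    `|derive1n m phi z| <= K * `|z| `^ (alpha - m%:R).
Proof.
move=> [_ _ _ [alpha al H]]; exists alpha => //.
apply: (@exists_uniform R N (fun m K => forall z, K <= `|z| ->
    `|derive1n m phi z| <= K * `|z| `^ (alpha - m%:R))).
  move=> m; have [C [M HCM]] := H m; exists (`|C| + `|M|); first exact: addr_ge0.
  move=> z Mz; apply: (le_trans (HCM z _)).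
    by have := ler_norm M; have := normr_ge0 C; lra.
  apply: ler_wpM2r; first exact: powR_ge0.
  by have := ler_norm C; have := normr_ge0 M; lra.
move=> m C C' CC H1 z Cz; apply: (le_trans (H1 z (le_trans CC Cz))).
by apply: ler_wpM2r => //; exact: powR_ge0.
Qed.

End classes.

(** * Locality of lower and upper values *)

Section tail.
Variable R : realType.
Implicit Types (f psi phi : R -> R) (x y a b c d t z r e : R) (m n k N j : nat).

Lemma powR_neg_le alpha x y : alpha <= 0 -> 0 < x -> x <= y -> y `^ alpha <= x `^ alpha :> R.
Proof.
move=> a0 x0 xy; rewrite -[alpha]opprK !(powRN _ (- alpha)).
rewrite lef_pV2 ?posrE ?powR_gt0//; last exact: lt_le_trans xy.
by apply: ge0_ler_powR => //; rewrite ?nnegrE ?oppr_ge0// ltW// (lt_le_trans x0).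
Qed.

(** Away from [x], the [m]-th derivative of the dilate is [t^(- 1 - m)] times
    [O((|y - x| / t)^(alpha - m))], that is [O(t^(- 1 - alpha))], which tends to 0 as [alpha < -1].
    So the tails in [T0] do not disturb local information. *)
Lemma tail_vanish (L : (R -> R) -> R) x e phi : cdistr L -> 0 < e ->
  (forall psi, smooth psi -> (forall y, psi y != 0 -> `|y - x| <= e) -> L psi = 0) ->
  T0 phi -> forall h, 0 < h -> \forall t \near 0^'+, `|L (dilate phi x t)| <= h.
Proof.
move=> cL e0 Lx tphi h h0.
have [r [C [N [r0 C0 HC]]]] := cdistr_continuous cL.
have [alpha al [K K0 HK]] := T0_decay N tphi.
have sphi : smooth phi by case: tphi.
pose w y := 1 - bumpf ((y - x) / e).
have sw : smooth w := smoothB (@smooth_cst R 1) (@smooth_dil R _ x e (@smooth_bump R)).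
have [B B0 HB] := @smooth_bounded R w N r sw.
pose Q := (e / 2) `^ alpha * (1 + 2 / e) ^+ N.
have e2 : 0 < e / 2 by rewrite divr_gt0.
have e1 : 1 <= 1 + 2 / e by rewrite lerDl divr_ge0// ltW.
have Q0 : 0 <= Q by rewrite mulr_ge0 ?powR_ge0// exprn_ge0// (le_trans ler01).
pose D t := K * Q * t `^ (- 1 - alpha).
have D0 t : 0 <= D t by apply: mulr_ge0; [exact: mulr_ge0|exact: powR_ge0].
have dec t m y : 0 < t -> K * t <= e / 2 -> (m <= N)%N -> e / 2 <= `|y - x| ->
    `|derive1n m (dilate phi x t) y| <= D t.
  move=> t0 Kt mN yx; have tn : t != 0 by rewrite gt_eqF.
  rewrite /dilate (@derive1nZ R _ _ m (@smooth_dil R phi x t sphi)).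
  rewrite (@derive1n_dil R phi x t m sphi) !normrM !normfV normr_id normrX (gtr0_norm t0).
  have y0 : 0 < `|y - x| by exact: lt_le_trans yx.
  have zE : `|(y - x) / t| = `|y - x| / t by rewrite normrM normfV (gtr0_norm t0).
  have z0 : 0 < `|(y - x) / t| by rewrite zE divr_gt0.
  have zK : K <= `|(y - x) / t|.
    by rewrite zE ler_pdivlMr//; exact: le_trans yx.
  have H1 := HK m mN _ zK.
  apply: (@le_trans _ _ (t^-1 * ((t ^+ m)^-1 * (K * `|(y - x) / t| `^ (alpha - m%:R))))).
    by rewrite ler_pM2l ?invr_gt0// ler_pM2l// invr_gt0 exprn_gt0.
  rewrite powRB; last by apply/implyP => _; rewrite gt_eqF.
  rewrite powR_mulrn; last exact: ltW.
  have E1 : (t ^+ m)^-1 / `|(y - x) / t| ^+ m = `|y - x| ^- m.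
    rewrite zE exprMn exprVn; field.
    by rewrite !expf_neq0// gt_eqF.
  have -> : t^-1 * ((t ^+ m)^-1 * (K * (`|(y - x) / t| `^ alpha / `|(y - x) / t| ^+ m)))
      = K * (t^-1 * `|(y - x) / t| `^ alpha * `|y - x| ^- m).
    by rewrite -E1; ring.
  rewrite /D -[X in _ <= X]mulrA; apply: ler_wpM2l => //.
  have H2 : `|(y - x) / t| `^ alpha <= (e / 2) `^ alpha * t `^ (- alpha).
    apply: (@le_trans _ _ ((e / 2 * t^-1) `^ alpha)).
      apply: powR_neg_le; [lra|by rewrite divr_gt0|].
      by rewrite zE ler_pM2r// invr_gt0.
    rewrite powRM ?(ltW e2) ?invr_ge0 ?(ltW t0)//.
    by rewrite -[X in _ * X `^ _](powR_inv1 (ltW t0)) -powRrM mulN1r.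
  have H3 : `|y - x| ^- m <= (1 + 2 / e) ^+ N.
    apply: (@le_trans _ _ ((1 + 2 / e) ^+ m)); last by apply: ler_weXn2l.
    rewrite -exprVn; apply: lerXn2r; rewrite ?nnegrE ?invr_ge0//; first lra.
    apply: (@le_trans _ _ (e / 2)^-1); first by rewrite lef_pV2.
    by rewrite invf_div; lra.
  have -> : t `^ (-1 - alpha) = t^-1 * t `^ (- alpha).
    rewrite powRD; last by apply/implyP => _.
    by rewrite powR_inv1// ltW.
  have -> : Q * (t^-1 * t `^ (- alpha)) =
    t^-1 * ((e / 2) `^ alpha * t `^ (- alpha)) * (1 + 2 / e) ^+ N by rewrite /Q; ring.
  apply: ler_pM => //; first by rewrite mulr_ge0 ?invr_ge0 ?powR_ge0// ltW.
  by rewrite ler_pM2l// invr_gt0.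
pose k := C * (2 ^+ N * B) * (K * Q).
have k0 : 0 <= k.
  apply: mulr_ge0; last exact: mulr_ge0.
  by apply: mulr_ge0 => //; apply: mulr_ge0 => //; exact: exprn_ge0.
have main t : 0 < t -> K * t <= e / 2 -> `|L (dilate phi x t)| <= k * t `^ (- 1 - alpha).
  move=> t0 Kt; pose be y := bumpf ((y - x) / e).
  have sbe : smooth be := @smooth_dil R _ x e (@smooth_bump R).
  have sd : smooth (dilate phi x t) := @smooth_dilate R phi x t sphi.
  have s1 := smoothM sbe sd; have s2 := smoothM sw sd.
  have -> : dilate phi x t = (fun y => be y * dilate phi x t y + w y * dilate phi x t y).
    by apply/funext => y; rewrite /w /be; ring.
  rewrite (cdistrD cL s1 s2) (Lx _ s1) ?add0r; last first.
    move=> y; apply: contraNT; rewrite -ltNge => ye; rewrite /be bump0 ?mul0r//.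
    by rewrite normrM normfV (gtr0_norm e0) ler_pdivlMr// mul1r ltW.
  have -> : k * t `^ (- 1 - alpha) = C * (2 ^+ N * (B * D t)) by rewrite /k /D; ring.
  apply: HC => // m y mN yr; have [ye|ye] := ltP `|y - x| (e / 2).
    rewrite (@derive1n_eq_open R [set u | `|u - x| < e / 2] _ (cst 0)).
    - have H0 : 0 <= 2 ^+ N * (B * D t).
        by apply: mulr_ge0; [exact: exprn_ge0|exact: mulr_ge0].
      by rewrite derive1n_cst; case: m mN => *; rewrite normr0.
    - rewrite [X in open X](_ : _ = ball x (e / 2)); first exact: ball_open.
      by apply/seteqP; split => u; rewrite /ball/= distrC.
    - move=> u /= ux; rewrite /w bump1 ?subrr ?mul0r//.
      by rewrite normrM normfV (gtr0_norm e0) ler_pdivrMr//; lra.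
    - by [].
  have := @leibniz_bound R N _ _ y B (D t) 1 sw sd B0 (D0 t) ler01.
  move=> /(_ _ _ m mN); rewrite expr1n mulr1 => H; apply: (le_trans (H _ _)).
  - by move=> i iN; rewrite expr1n mulr1; apply: HB.
  - by move=> i iN; rewrite expr1n mulr1; apply: dec.
  by apply: ler_wpM2r; [rewrite mulr_ge0|apply: ler_weXn2l => //; rewrite ler1n].
have al0 : 0 < - 1 - alpha by lra.
have k1 : 0 < k + 1 by rewrite ltr_wpDl.
have hk : 0 < h / (k + 1) by rewrite divr_gt0.
have K1 : 0 < K + 1 by rewrite ltr_wpDl.
near=> t.
have t0 : 0 < t by near: t; exact: nbhs_right_gt.
apply: (le_trans (main t t0 _)).
  have : t <= e / 2 / (K + 1) by near: t; apply: nbhs_right_le; rewrite divr_gt0.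
  by rewrite ler_pdivlMr//; apply: le_trans; rewrite mulrDr mulr1 mulrC lerDl ltW.
have : t `^ (- 1 - alpha) < h / (k + 1).
  by near: t; have := cvgr_lt _ (@powR_cvg0 R _ al0); apply.
rewrite ltr_pdivlMr// => H; apply: ltW; apply: le_lt_trans H.
by rewrite mulrDr mulr1 mulrC lerDl powR_ge0.
Unshelve. all: by end_near.
Qed.

End tail.

(** * Major minus minor is nonnegative *)

Section distr_positivity.
Variable R : realType.
Implicit Types (f psi phi : R -> R) (x y a b c d t z r e : R) (m n k N j : nat).
Implicit Types (g h w u v U V W G : sdistr R) (E Z : set R).
Local Notation mu := (@lebesgue_measure R).

Lemma cut_out g a b r x e psi : a <= b -> supported_in g `[a, b] -> 0 < r -> 0 < e ->
  (forall y, `|y - x| <= 2 * e -> ~ (a <= y <= b)) ->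
  smooth psi -> (forall y, psi y != 0 -> `|y - x| <= e) -> cutd g r psi = 0.
Proof.
move=> ab sg r0 e0 He sp px; apply: (supported_out sg).
  exact: test_functionM sp (test_plateau r0).
exists e => // y yab; have [->|/px yx] := eqVneq (psi y) 0; first by rewrite mulr0.
exfalso; have [ya|ya] := ltP y a.
  by apply: (He a); [move: yx; rewrite !ler_norml; lra|lra].
have [yb|yb] := ltP b y; last by apply: (He y); [lra|lra].
by apply: (He b); [move: yx; rewrite !ler_norml; lra|lra].
Qed.

Definition vanishing_at w c := forall psi, test_function psi -> forall e, 0 < e ->
  exists2 d : R, 0 < d & forall t, t != 0 -> `|t| <= d ->
    `|w (fun y => psi ((y - c) / t))| <= e.

Lemma distr_positivity w r A B E : 0 < r -> - r <= A -> B <= r ->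
  (forall c, A < c < B -> vanishing_at w c) -> countable E ->
  (forall x, A < x < B -> ~ E x -> exists M : R,
     \forall t \near 0^'+, - M <= cutd w r (dilate (@gaussn R) x t)) ->
  {ae mu, forall x, A < x < B -> forall e, 0 < e ->
     \forall t \near 0^'+, - e <= cutd w r (dilate (@gaussn R) x t)} ->
  forall psi, smooth psi -> (forall x, 0 <= psi x) ->
  (exists2 e, 0 < e & forall x, psi x != 0 -> A + e <= x <= B - e) -> 0 <= w psi.
Proof.
move=> r0 rA Br sw cE HE Hae psi sp p0 [e e0 pe].
have g0 := gauss_mass_gt0 R.
have -> : w psi = cutd w r psi.
  by rewrite cut_on// => x /pe; rewrite ler_norml; lra.
have cL := cdistr_cut w r0.
have heatE x t : 0 < t -> heat (cutd w r) 0 x t = gauss_mass R * cutd w r (dilate (@gaussn R) x t).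
  move=> t0; rewrite dilate_gaussn// (cdistrZ cL _ (@smooth_kap R 0 x t)).
  by rewrite mulrA mulfV ?mul1r// gt_eqF.
apply: (@positivity R (cutd w r) cL A B _ E cE) => //; last by exists e.
- move=> c cAB f tf h h0; have tf' : test_function f.
    apply: (@test_functionI _ f (-1) 1 tf.1) => x; apply: contraNT => x1; apply/eqP.
    by apply: tf.2; rewrite ltNge ler_norml.
  have [d d0 Hd] := sw c cAB f tf' h h0.
  (* Dilates this small are supported in [(A, B)], where the plateau equals 1 and the cut-off has no
     effect. *)
  pose d' := Num.min d (Num.min (c - A) (B - c)).
  have d'0 : 0 < d' by rewrite !lt_min d0 !subr_gt0.
  have d'd : d' <= d by rewrite ge_min lexx.
  have d'A : d' <= c - A by rewrite ge_min [X in _ || X]ge_min lexx orbT.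
  have d'B : d' <= B - c by rewrite ge_min [X in _ || X]ge_min lexx !orbT.
  exists d' => // t tn td; rewrite cut_on//; first by apply: Hd => //; exact: le_trans d'd.
  rewrite /dil => x; apply: contraNT => xr; apply/eqP; apply: tf.2.
  rewrite normrM normfV ltr_pdivlMr ?normr_gt0// mul1r ltNge; apply: contra xr => xt.
  have := le_trans xt td; rewrite !ler_norml; lra.
- move=> x xAB nE; have [M HM] := HE x xAB nE; exists (gauss_mass R * M).
  near=> t; rewrite heatE; last by near: t; exact: nbhs_right_gt.
  by rewrite -mulrN ler_pM2l//; near: t.
- apply: (@filterS _ _ (ae_filter_ringOfSetsType mu) _ _ _ Hae) => x Hx xAB h h0.
  have hg : 0 < h / gauss_mass R by rewrite divr_gt0.
  have Hn := Hx xAB _ hg.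
  near=> t; rewrite heatE; last by near: t; exact: nbhs_right_gt.
  by rewrite mulrC -ler_pdivrMr// mulNr; near: t.
Unshelve. all: by end_near.
Qed.

Lemma pairing_dil W psi c t : t != 0 -> test_function psi ->
  W (fun y => psi ((y - c) / t)) = `|t| * W (dilate psi c t).
Proof.
move=> t0 tp; rewrite -sdistrZ; last exact: test_function_dilate.
congr (spair W); apply/funext => y.
by rewrite /dilate mulrA mulfV ?mul1r// normr_eq0.
Qed.

Lemma dderiv_dil W psi c t : t != 0 -> test_function psi ->
  dderiv W (fun y => psi ((y - c) / t)) = - (t^-1 * (`|t| * W (dilate (derive1 psi) c t))).
Proof.
move=> t0 tp; have tp' := test_function_derive1 tp.
rewrite -pairing_dil// -sdistrZ; last exact: test_function_dil.
congr (- _); congr (spair W); have := @derive1n_dil R psi c t 1 tp.1.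
by rewrite !derive1n1 expr1.
Qed.

Lemma point_value_bound W c gam psi e : point_value W c gam -> test_function psi -> 0 < e ->
  exists2 d : R, 0 < d & forall t, t != 0 -> `|t| <= d ->
    `|W (dilate psi c t) - gam * \int[mu]_y psi y| <= e.
Proof.
move=> Hp tp e0; have := Hp psi tp => /cvgrPdist_le /(_ e e0).
rewrite near_withinE => /nbhs_ballP[d /= d0 Hd]; exists (d / 2); first by rewrite divr_gt0.
move=> t t0 td; rewrite distrC; apply: Hd => //.
by rewrite /ball/= sub0r normrN; lra.
Qed.

(** The derivative moves to [psi] and its factor [t^-1] normalises the dilate, so the limit is [gam]
    times the integral of [derive1 psi], up to sign, which is 0. This excludes point masses. *)
Lemma dderiv_vanishing W c gam : point_value W c gam -> vanishing_at (dderiv W) c.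
Proof.
move=> Hp psi tp e e0.
have [d d0 Hd] := point_value_bound Hp (test_function_derive1 tp) e0; exists d => // t t0 td.
rewrite dderiv_dil// normrN normrM normfV normrM normr_id mulrA mulVf ?normr_eq0// mul1r.
by have := Hd t t0 td; rewrite integral_derive1// mulr0 subr0.
Qed.

Lemma point_value_vanishing W c gam : point_value W c gam -> vanishing_at W c.
Proof.
move=> Hp psi tp e e0; have [d d0 Hd] := point_value_bound Hp tp ltr01.
pose K := `|gam * \int[mu]_y psi y| + 1.
have K0 : 0 < K by rewrite ltr_wpDl.
exists (Num.min d (e / K)) => [|t t0]; first by rewrite lt_min d0 divr_gt0.
rewrite le_min => /andP[td te]; rewrite pairing_dil// normrM normr_id.
have := Hd t t0 td => H1.
have H2 : `|W (dilate psi c t)| <= K.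
  rewrite -[W _](subrK (gam * \int[mu]_y psi y)) (le_trans (ler_normD _ _))//.
  by rewrite addrC lerD2l.
apply: (le_trans (ler_pM _ _ te H2)) => //.
by rewrite mulrAC -mulrA mulfV ?mulr1// gt_eqF.
Qed.

Lemma point_value_lin c W V x gam del : point_value W x gam -> point_value V x del ->
  point_value (sdlin c W V) x (c * gam + del).
Proof.
move=> HW HV phi tp; rewrite mulrDl -mulrA.
apply: cvgD; last exact: HV.
by apply: cvgMr; exact: HW.
Qed.

Lemma vanishing_eq w w' c : eq_sdistr w w' -> vanishing_at w c -> vanishing_at w' c.
Proof.
move=> E H psi tp e e0; have [d d0 Hd] := H psi tp e e0; exists d => // t t0 td.
by rewrite -E; [exact: Hd|exact: test_function_dil].
Qed.

Definition nonneg_distr w := forall psi, test_function psi -> (forall x, 0 <= psi x) -> 0 <= w psi.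

Lemma sdlin_supported c u v (K : set R) : supported_in u K -> supported_in v K ->
  supported_in (sdlin c u v) K.
Proof. by move=> su sv psi tp pK; rewrite /sdlin/= su// sv// mulr0 addr0. Qed.

Lemma countable_setU E Z : countable E -> countable Z -> countable (E `|` Z).
Proof.
move=> cE cZ; rewrite -bigcup2E; apply: bigcup_countable => // -[|[|i]] _ //=.
Qed.

Lemma countable_negligible E : countable E -> mu.-negligible E.
Proof.
move=> cE; exists E; split => //; last exact: countable_lebesgue_measure0.
by apply: countable_measurable.
Qed.

Lemma major_minor_nonneg a b (f : R -> \bar R) u U v V : a <= b ->
  major_pair a b f u U -> minor_pair a b f v V -> nonneg_distr (sdlin (-1) v u).
Proof.
move=> ab [su lU eU _ [E [Z [cE nZ uZ uE]]]] [sv lV eV _ [E' [Z' [cE' nZ' vZ vE]]]].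
move=> psi /[dup] tp /test_functionP[sp [s s0 ps]] p0.
set w := sdlin (-1) v u.
have sw : supported_in w `[a, b] by exact: sdlin_supported.
pose r := s + `|a| + `|b| + 1.
have := normr_ge0 a; have := normr_ge0 b => b0 a0.
have aN := ler_norm (- a); rewrite normrN in aN.
have bN := ler_norm b.
have r0 : 0 < r by rewrite /r; lra.
have ra : - r < a by rewrite /r; lra.
have rb : b < r by rewrite /r; lra.
have T := T1_gaussn R.
have sg x t : smooth (dilate (@gaussn R) x t) := @smooth_dilate R _ x t (let: And4 s _ _ _ := T.1 in s).
have cw x t : cutd w r (dilate (@gaussn R) x t) =
   cpair u (dilate (@gaussn R) x t) - cpair v (dilate (@gaussn R) x t).
  rewrite (cpair_cut su r0 ra rb (sg x t)) (cpair_cut sv r0 ra rb (sg x t)).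
  by rewrite /cutd /w /sdlin/=; ring.
(* Outside of [[a, b]] the difference vanishes near [x], and only the Gaussian tail meets its
   support. *)
have out x : ~ (a <= x <= b) -> forall e, 0 < e ->
    \forall t \near 0^'+, - e <= cutd w r (dilate (@gaussn R) x t).
  move=> xab e e0.
  have [d d0 Hd] : exists2 d : R, 0 < d & forall y, `|y - x| <= 2 * d -> ~ (a <= y <= b).
    have [xa|xa] := ltP x a.
      exists ((a - x) / 4) => [|y]; first by rewrite divr_gt0// subr_gt0.
      by rewrite ler_norml; lra.
    have [xb|xb] := ltP b x; last by exfalso; apply: xab; rewrite xa.
    exists ((x - b) / 4) => [|y]; first by rewrite divr_gt0// subr_gt0.
    by rewrite ler_norml; lra.
  have := @tail_vanish R (cutd w r) x d (@gaussn R) (cdistr_cut w r0) d0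
    (fun psi sp px => cut_out ab sw r0 d0 Hd sp px) T.1 e e0.
  by apply: filterS => t; rewrite ler_norml => /andP[].
have in_ x e : a <= x <= b -> ~ E x -> ~ E' x -> ~ Z x -> ~ Z' x -> 0 < e ->
    \forall t \near 0^'+, - e <= cutd w r (dilate (@gaussn R) x t).
  move=> xab nE nE' nZx nZ'x e0.
  have xab' : x \in `[a, b] by rewrite in_itv.
  have h1 := uZ x _ xab' nZx T.1; have h2 := vZ x _ xab' nZ'x T.1.
  have h3 := uE x _ xab' nE T; have h4 := vE x _ xab' nE' T.
  (* The value [f x] may be infinite, but the conditions for [T1] exclude a lower value [-oo] and an
     upper value [+oo], which leaves room for a real [q]. *)
  have [q [q1 q2]] : exists q : R, ((q - e / 2)%:E < lower_value u (@gaussn R) x)%E /\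
      (upper_value v (@gaussn R) x < (q + e / 2)%:E)%E.
    move: h1 h2 h3 h4; case: (lower_value u _ x) => [l| |]; case: (upper_value v _ x) => [k| |] //.
    - move=> h1 h2 _ _; have := le_trans h2 h1; rewrite lee_fin => kl.
      by exists l; rewrite !lte_fin; split; lra.
    - by move=> *; exists l; rewrite ltNyr lte_fin; split => //; lra.
    - by move=> *; exists k; rewrite ltry lte_fin; split => //; lra.
    - by move=> *; exists 0; rewrite ltry ltNyr.
  have n1 := einf_gt _ q1; have n2 := esup_lt _ q2.
  near=> t; rewrite cw.
  have : q - e / 2 < cpair u (dilate (@gaussn R) x t) by near: t; exact: n1.
  have : cpair v (dilate (@gaussn R) x t) < q + e / 2 by near: t; exact: n2.
  lra.
have wE : eq_sdistr (dderiv (sdlin (-1) V U)) w.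
  by move=> phi tphi; rewrite sdlin_dderiv /w /sdlin/= -eU// -eV.
apply: (@distr_positivity w r (- r) r (E `|` E') r0) => //.
- move=> c _; have [gU HU] := lU c; have [gV HV] := lV c.
  exact: (@vanishing_eq _ w c wE (@dderiv_vanishing _ c _ (@point_value_lin (-1) V U c _ _ HV HU))).
- exact: countable_setU.
- move=> x _ /not_orP[nE nE'].
  have [xab|xab] := pselect (a <= x <= b); last first.
    by exists 1; exact: out.
  have xab' : x \in `[a, b] by rewrite in_itv.
  have /ereal_lt_dense[k /andP[_ k1]] := uE x _ xab' nE T.
  have /ereal_lt_dense[l /andP[l1 _]] := vE x _ xab' nE' T.
  have n1 := einf_gt _ k1; have n2 := esup_lt _ l1.
  exists (l - k); near=> t; rewrite cw.
  have : k < cpair u (dilate (@gaussn R) x t) by near: t; exact: n1.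
  have : cpair v (dilate (@gaussn R) x t) < l by near: t; exact: n2.
  lra.
- have nE := countable_negligible (countable_setU cE cE').
  have nall := negligibleU nE (negligibleU nZ nZ').
  apply: (negligibleS _ nall) => x /= Hx.
  apply: contrapT => /not_orP[/not_orP[h1 h2] /not_orP[h3 h4]]; apply: Hx => _ e e0.
  have [xab|xab] := pselect (a <= x <= b); first exact: in_.
  exact: out.
- by exists 1 => // x /ps; rewrite ler_norml /r; lra.
Unshelve. all: by end_near.
Qed.

End distr_positivity.
Arguments point_value_lin {R} c {W V x gam del}.

(** * Distributions with nonnegative point values *)

Section values.
Variable R : realType.
Implicit Types (f psi phi : R -> R) (x y a b c d t z r e : R) (m n k N j : nat).
Implicit Types (g h w u v U V W G : sdistr R) (E Z : set R).
Local Notation mu := (@lebesgue_measure R).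

Lemma cutd_dilate G r x t psi s : 0 < r -> t != 0 -> (forall y, psi y != 0 -> `|y| <= s) ->
  `|x| + s * `|t| <= r -> cutd G r (dilate psi x t) = G (dilate psi x t).
Proof.
move=> r0 t0 ps xr; apply: cut_on => // y; rewrite /dilate mulf_eq0 negb_or => /andP[_ /ps].
rewrite normrM normfV ler_pdivrMr ?normr_gt0// => h.
by have := ler_normD (y - x) x; rewrite subrK; lra.
Qed.

(** Pairing with an unnormalised dilate gains a factor [|t|] over the convergent pairing, whence the
    exponent 1. *)
Lemma point_value_local_bound G r x gam : 0 < r -> `|x| < r -> point_value G x gam ->
  local_bound (cutd G r) 1 x.
Proof.
move=> r0 xr Hp f tf.
have fs y : f y != 0 -> `|y| <= 1.
  by move=> fy; rewrite leNgt; apply/negP => /tf.2 f0; rewrite f0 eqxx in fy.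
have tf' : test_function f by apply/test_functionP; split; [exact: tf.1|exists 1].
have [d d0 Hd] := point_value_bound Hp tf' ltr01.
exists (Num.min d (r - `|x|)); first by rewrite lt_min d0 subr_gt0.
exists (1 + `|gam * \int[mu]_y f y|) => t t0; rewrite le_min => /andP[td tr].
have -> : dil f x t = (fun y => `|t| * dilate f x t y).
  by apply/funext => y; rewrite /dil /dilate mulrA mulfV ?mul1r// normr_eq0.
rewrite (cdistrZ (cdistr_cut G r0)); last exact: smooth_dilate tf.1.
rewrite (@cutd_dilate G r x t f 1 r0 t0 fs); last by rewrite mul1r; lra.
rewrite normrM normr_id expr1 mulrC ler_wpM2r//.
rewrite -[G _](subrK (gam * \int[mu]_y f y)) (le_trans (ler_normD _ _))//.
by rewrite lerD2r; exact: Hd.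
Qed.

Definition gauss_tail r : R -> R := fun y => (1 - plateau r y) * gaussn y.

Lemma smooth_gaussn : smooth (@gaussn R).
Proof. exact: (@smoothZ R _ _ (@smooth_gauss R)). Qed.

Lemma smooth_gauss_tail r : 0 < r -> smooth (gauss_tail r).
Proof.
move=> r0; exact: smoothM (smoothB (@smooth_cst R 1) (test_plateau r0).1) smooth_gaussn.
Qed.

(** The Gaussian has one more power of decay than the weight asks for, which gains [1 / (1 + |y|)]
    outside of the plateau. The weight is the one required by [cdistr_decay] with [q = 1]. *)
Lemma gauss_tail_small N e : 0 < e -> exists2 r : R, 1 <= r & forall m y, (m <= N)%N ->
  (1 + `|y|) ^+ (2 + N) * `|derive1n m (gauss_tail r) y| <= e.
Proof.
move=> e0.
have [B B0 HB] : exists2 B : R, 0 <= B & forall m y, (m <= N)%N -> `|derive1n m (@bumpf R) y| <= B.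
  apply: test1_bounded; split; first exact: smooth_bump.
  by move=> y /ltW; exact: bump0.
have [C C0 HC] := @exists_uniform R N
   (fun m C => forall y, (1 + `|y|) ^+ (3 + N) * `|derive1n m (@gauss_fun R) y| <= C)
   (fun m => gauss_decay R m (3 + N)) (fun m C C' CC H y => le_trans (H y) CC).
pose k := (gauss_mass R)^-1.
have k0 : 0 <= k by rewrite invr_ge0 ltW// gauss_mass_gt0.
pose D := 2 ^+ N * ((1 + B) * (k * C)).
have D0 : 0 <= D.
  by apply: mulr_ge0; [exact: exprn_ge0|apply: mulr_ge0; [lra|exact: mulr_ge0]].
pose r := 1 + D / e.
have r1 : 1 <= r by rewrite lerDl divr_ge0// ltW.
have r0 : 0 < r by exact: lt_le_trans r1.
exists r => // m y mN.
have [yr|yr] := ltP `|y| r.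
  rewrite (@derive1n_eq_open R [set u | `|u| < r] _ (cst 0)).
  - by rewrite derive1n_cst; case: m mN => *; rewrite normr0 mulr0 ltW.
  - rewrite [X in open X](_ : _ = ball 0 r); first exact: ball_open.
    by apply/seteqP; split => u; rewrite /ball/= sub0r normrN.
  - by move=> u /= ur; rewrite /gauss_tail plateau1 ?subrr ?mul0r// ltW.
  - by [].
have y1 : 0 < 1 + `|y| by rewrite ltr_pwDl.
have pN : 0 < (1 + `|y|) ^+ (3 + N) by exact: exprn_gt0.
have sp := (test_plateau r0).1.
have s1 : smooth (fun y => 1 - plateau r y) := smoothB (@smooth_cst R 1) sp.
have B1 : 0 <= 1 + B by lra.
have kC : 0 <= k * C / (1 + `|y|) ^+ (3 + N).
  by rewrite divr_ge0// ?mulr_ge0// ltW.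
have := @leibniz_bound R N _ _ y (1 + B) (k * C / (1 + `|y|) ^+ (3 + N)) 1 s1 smooth_gaussn
  B1 kC ler01.
move=> /(_ _ _ m mN); rewrite expr1n mulr1 => H.
apply: (@le_trans _ _ ((1 + `|y|) ^+ (2 + N) * (D / (1 + `|y|) ^+ (3 + N)))).
  rewrite ler_wpM2l ?exprn_ge0 ?(ltW y1)//; apply: (le_trans (H _ _)).
  - move=> i iN; rewrite expr1n mulr1 (derive1nB i (@smooth_cst R 1) sp).
    apply: (le_trans (ler_normB _ _)); apply: lerD.
      by rewrite derive1n_cst; case: i iN => *; rewrite ?normr1 ?normr0.
    rewrite (@derive1n_dil R (@bumpf R) 0 (2 * r) i (@smooth_bump R)) normrM.
    apply: (@le_trans _ _ (1 * B)); last by rewrite mul1r.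
    apply: ler_pM => //; last by apply: HB.
    rewrite normfV normrX (gtr0_norm (x := 2 * r)) ?mulr_gt0//.
    by rewrite invf_le1 ?exprn_gt0 ?mulr_gt0//; apply: exprn_ege1; lra.
  - move=> i iN; rewrite expr1n mulr1 (@derive1nZ R _ _ i (@smooth_gauss R)) normrM.
    rewrite (ger0_norm k0) -mulrA ler_wpM2l// ler_pdivlMr// mulrC.
    exact: HC.
  rewrite /D -[X in _ <= X]mulrA -[X in _ <= _ * X]mulrA.
  apply: ler_wpM2r; first exact: mulr_ge0.
  by apply: ler_weXn2l => //; rewrite ler1n.
have -> : (1 + `|y|) ^+ (2 + N) * (D / (1 + `|y|) ^+ (3 + N)) = D / (1 + `|y|).
  rewrite [(3 + N)%N]addSn exprS; field.
  by rewrite !gt_eqF// exprn_gt0.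
rewrite ler_pdivrMr//; have : D / e <= 1 + `|y| by rewrite /r in yr; lra.
by rewrite ler_pdivrMr// mulrC.
Qed.

(** Point values speak of compactly supported test functions only. The Gaussian is cut at a large
    radius: the inner part is a nonnegative test function, and the tail is small uniformly in [t]
    because its bound is proportional to [t], which cancels the normalisation [t^-1]. *)
Lemma gaussn_value_ge0 G r x gam : 0 < r -> `|x| < r -> 0 <= gam -> point_value G x gam ->
  forall e, 0 < e -> \forall t \near 0^'+, - e <= cutd G r (dilate (@gaussn R) x t).
Proof.
move=> r0 xr g0 Hp e e0.
have cL := cdistr_cut G r0.
have [C [N [C0 HC]]] := cdistr_decay cL (point_value_local_bound r0 xr Hp).
have C1 : 0 < C + 1 by rewrite ltr_wpDl.
have e1 : 0 < e / 2 / (C + 1) by rewrite !divr_gt0.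
have [s s1 Hs] := gauss_tail_small N e1.
have s0 : 0 < s by exact: lt_le_trans s1.
pose p y := plateau s y * gaussn y.
have tp : test_function p := test_functionM smooth_gaussn (test_plateau s0).
have p0 y : 0 <= p y.
  by apply: mulr_ge0; [exact: bump_ge0|case: (T1_gaussn R) => -[]].
have ps y : p y != 0 -> `|y| <= 2 * s.
  by apply: contraNT; rewrite -ltNge => /ltW ys; rewrite /p plateau0 ?mul0r.
have e20 : 0 < e / 2 by rewrite divr_gt0.
have [d d0 Hd] := point_value_bound Hp tp e20.
have rx : 0 < (r - `|x|) / (2 * s) by rewrite divr_gt0 ?mulr_gt0 ?subr_gt0.
near=> t.
have t0 : 0 < t by near: t; exact: nbhs_right_gt.
have td : t <= d by near: t; exact: nbhs_right_le.
have t1 : t <= 1 by near: t; exact: nbhs_right_le.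
have tr : t <= (r - `|x|) / (2 * s) by near: t; exact: nbhs_right_le.
have tn : t != 0 by rewrite gt_eqF.
have -> : dilate (@gaussn R) x t = (fun y => t^-1 * dil (gauss_tail s) x t y + dilate p x t y).
  by apply/funext => y; rewrite /dilate /dil /gauss_tail /p (gtr0_norm t0); ring.
have st := smooth_gauss_tail s0.
rewrite (cdistr_linear cL _ (@smooth_dilE R _ x t st) (@smooth_dilate R p x t tp.1)).
rewrite (@cutd_dilate G r x t p (2 * s) r0 tn ps); last first.
  rewrite (gtr0_norm t0); move: tr; rewrite ler_pdivlMr ?mulr_gt0//; lra.
have H1 : - (e / 2) <= G (dilate p x t).
  have := Hd t tn; rewrite (gtr0_norm t0) => /(_ td).
  rewrite ler_norml => /andP[H _].
  rewrite lerBrDr in H; apply: le_trans H; rewrite lerDl.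
  by rewrite mulr_ge0// integral_test_ge0.
have H2 : `|t^-1 * cutd G r (dil (gauss_tail s) x t)| <= e / 2.
  have := HC t (gauss_tail s) (e / 2 / (C + 1)) tn; rewrite (gtr0_norm t0) expr1.
  move=> /(_ t1 st Hs) H; rewrite normrM normfV (gtr0_norm t0) mulrC ler_pdivrMr//.
  apply: (le_trans H).
  have -> : C * t * (e / 2 / (C + 1)) = e / 2 * t * (C / (C + 1)) by field; rewrite gt_eqF.
  rewrite ler_piMr ?ler_pdivrMr// ?mul1r ?lerDl//.
  by rewrite mulr_ge0// ltW.
move: H2; rewrite ler_norml; lra.
Unshelve. all: by end_near.
Qed.

(** The positivity theorem applied to [G] itself, with no exceptional points: unnormalised dilates
    are small wherever [G] has a value. *)
Lemma values_nonneg G A B : (forall x, A < x < B -> exists2 gam, 0 <= gam & point_value G x gam) ->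
  forall psi, smooth psi -> (forall x, 0 <= psi x) ->
  (exists2 e, 0 < e & forall x, psi x != 0 -> A + e <= x <= B - e) -> 0 <= G psi.
Proof.
move=> H; pose r := `|A| + `|B| + 1.
have r0 : 0 < r by rewrite ltr_wpDl// addr_ge0.
have := ler_norm (- A); have := ler_norm B; rewrite normrN => hB hA.
have nA := normr_ge0 A; have nB := normr_ge0 B.
have near_ x : A < x < B -> forall e, 0 < e ->
    \forall t \near 0^'+, - e <= cutd G r (dilate (@gaussn R) x t).
  move=> xAB; have [gam g0 Hp] := H x xAB.
  by apply: gaussn_value_ge0 Hp => //; rewrite ltr_norml /r; lra.
apply: (@distr_positivity R G r A B set0 r0) => //.
- by rewrite /r; lra.
- by rewrite /r; lra.
- by move=> c /H[gam _]; exact: point_value_vanishing.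
- by move=> x xAB _; exists 1; exact: near_.
- by apply: aeW => x xAB; exact: near_.
Qed.

Lemma values_nonneg_distr G : (forall x, exists2 gam, 0 <= gam & point_value G x gam) ->
  nonneg_distr G.
Proof.
move=> H psi /test_functionP[sp [r r0 pr]] p0.
apply: (@values_nonneg G (- (r + 1)) (r + 1)) => //.
by exists 1 => // x /pr; rewrite ler_norml; lra.
Qed.

End values.

(** * Increments of point values as masses of the derivative *)

Section increments.
Variable R : realType.
Implicit Types (f psi phi : R -> R) (x y a b c d t z r e s : R) (m n k N j : nat).
Implicit Types (w u v U V W G : sdistr R) (E Z : set R).
Local Notation mu := (@lebesgue_measure R).

Lemma is_derive_dil f l x t y : t != 0 -> is_derive ((y - x) / t) 1 f l ->
  is_derive y 1 (fun y => f ((y - x) / t)) (t^-1 * l).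
Proof.
move=> t0 df; have d1 : is_derive y 1 (fun y : R => (y - x) / t) t^-1.
  have := @is_derive_lin R t^-1 (- (x / t)) y; congr (is_derive _ _ _ _).
  by apply/funext => v; ring.
have H := @is_derive1_comp R f (fun y => (y - x) / t) y _ _ df d1.
by apply: (is_derive_eq H); rewrite mulrC.
Qed.

Lemma integral_dilate phi x t : test_function phi -> t != 0 ->
  \int[mu]_y dilate phi x t y = \int[mu]_y phi y.
Proof.
move=> tp t0; have /test_functionP[sp [r r0 pr]] := tp.
have cp := smooth_continuous sp.
have pr' y : phi y != 0 -> - r <= y <= r by move=> /pr; rewrite ler_norml.
pose P y := intab (- (r + 1)) y phi.
have dP y : - r <= y <= r -> is_derive y 1 P (phi y).
  by move=> yr; apply: int_is_derive => //; lra.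
have nt : 0 < `|t| by rewrite normr_gt0.
have dr : x - r * `|t| < x + r * `|t| by have := mulr_gt0 r0 nt; lra.
have zr y : x - r * `|t| <= y <= x + r * `|t| -> - r <= (y - x) / t <= r.
  move=> yr; rewrite -ler_norml normrM normfV ler_pdivrMr// ler_norml; lra.
rewrite (Rintegral_supp pr') (@Rintegral_supp R (x - r * `|t|) (x + r * `|t|)); last first.
  move=> y; rewrite /dilate mulf_eq0 negb_or => /andP[_ /pr].
  by rewrite normrM normfV ler_pdivrMr// ler_norml; lra.
have rr : - r < r by lra.
rewrite (int_FTC rr dP cp).
have dD y : x - r * `|t| <= y <= x + r * `|t| ->
    is_derive y 1 (fun y => `|t|^-1 * t * P ((y - x) / t)) (dilate phi x t y).
  move=> /zr /dP /(is_derive_dil t0) /(is_derive_scale (`|t|^-1 * t)) H.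
  by apply: (is_derive_eq H); rewrite /dilate mulrA -[_ * t * _]mulrA mulfV// mulr1.
have sd := @smooth_dilate R phi x t sp.
rewrite (int_FTC dr dD (smooth_continuous sd)).
have -> : (x + r * `|t| - x) / t = r * (`|t| / t) by ring.
have -> : (x - r * `|t| - x) / t = - (r * (`|t| / t)) by ring.
have [tp0|tn] := ltP 0 t.
  by rewrite gtr0_norm// mulVf// mulfV// mulr1 !mul1r.
have E1 : `|t|^-1 * t = -1 by rewrite ler0_norm// invrN mulNr mulVf.
have E2 : `|t| / t = -1 by rewrite ler0_norm// mulNr mulfV.
by rewrite E1 E2 mulrN1 opprK; ring.
Qed.

Section sconst.
Variable c : R.
Let p f := c * \int[mu]_y f y.

Let p_linear d f psi : test_function f -> test_function psi ->
  p (fun x => d * f x + psi x) = d * p f + p psi.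
Proof. by move=> tf tp; rewrite /p integral_testL// mulrDr mulrCA. Qed.

Let p_continuous (K : set R) : compact K ->
  exists (C : R) (N : nat), forall f (B : R),
    test_function f -> fsupport f `<=` K ->
    (forall (m : nat) (x : R), (m <= N)%N -> `|derive1n m f x| <= B) ->
    `|p f| <= C * B.
Proof.
move=> /compact_bounded[M [_ HM]].
have M1 : M < `|M| + 1 by rewrite (le_lt_trans (ler_norm M))// ltrDl.
pose r := `|M| + 1; have r0 : 0 < r by rewrite ltr_wpDl.
exists (`|c| * (r - - r)), 0%N => f B tf fK fB.
have fr x : f x != 0 -> - r <= x <= r.
  by move=> fx; rewrite -ler_norml; apply: HM => //; apply: fK; exact: subset_closure.
rewrite /p normrM -mulrA ler_wpM2l// (Rintegral_supp fr) mulrC.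
apply: int_bound; first lra.
  exact: smooth_continuous tf.1.
by move=> x _; exact: (fB 0%N).
Qed.

Definition sconst : sdistr R := SDistr p_linear p_continuous.

Lemma point_value_const x : point_value sconst x c.
Proof.
move=> phi tp; apply: cvg_near_cst; near=> t; rewrite /sconst/= /p integral_dilate//.
by near: t; exact: nbhs_dnbhs_neq.
Unshelve. all: by end_near.
Qed.

End sconst.

(** A smoothed indicator of [[x1, x2]] whose derivative is a difference of two mollifiers, so that
    pairing it with a derivative gives an increment. The shift [s], in units of [t], places both
    flanks. *)
Definition ramp s x1 x2 t y := step ((y - x1) / t - s) - step ((y - x2) / t - s).

Lemma smooth_ramp_half s x t : smooth (fun y : R => step ((y - x) / t - s)).
Proof.
have := @smooth_dil R _ x t (@smooth_compZ R _ 1 (- s) (@smooth_step R)).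
by congr smooth; apply/funext => y; rewrite mul1r.
Qed.

Lemma smooth_ramp s x1 x2 t : smooth (ramp s x1 x2 t).
Proof. exact: smoothB (@smooth_ramp_half s x1 t) (@smooth_ramp_half s x2 t). Qed.

Lemma ramp_supp s x1 x2 t y : 0 < t -> x1 <= x2 -> ramp s x1 x2 t y != 0 ->
  x1 + t * s <= y <= x2 + t * (s + 1).
Proof.
move=> t0 x12; apply: contraNT; rewrite negb_and -!ltNge => /orP[yx|yx]; apply/eqP.
  rewrite /ramp !step0 ?subrr// subr_le0 ler_pdivrMr//; lra.
rewrite /ramp !step1 ?subrr// lerBrDr ler_pdivlMr//; lra.
Qed.

Lemma test_ramp s x1 x2 t : 0 < t -> x1 <= x2 -> test_function (ramp s x1 x2 t).
Proof.
move=> t0 x12; apply: (@test_functionI _ _ (x1 + t * s) (x2 + t * (s + 1))).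
  exact: smooth_ramp.
by move=> y; exact: ramp_supp.
Qed.

Lemma ramp_ge0 s x1 x2 t y : 0 < t -> x1 <= x2 -> 0 <= ramp s x1 x2 t y.
Proof.
move=> t0 x12; rewrite /ramp subr_ge0; apply: step_homo.
by rewrite lerD2r ler_pM2r ?invr_gt0//; lra.
Qed.

Lemma ramp1 s x1 x2 t y : 0 < t -> x1 + t * (s + 1) <= y <= x2 + t * s ->
  ramp s x1 x2 t y = 1.
Proof.
move=> t0 /andP[h1 h2]; rewrite /ramp step1 ?step0 ?subr0//.
  by rewrite subr_le0 ler_pdivrMr//; lra.
by rewrite lerBrDr ler_pdivlMr//; lra.
Qed.

Lemma derive1_ramp s x1 x2 t : 0 < t ->
  derive1 (ramp s x1 x2 t) = (fun y => dilate (pulse s) x1 t y - dilate (pulse s) x2 t y).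
Proof.
move=> t0; have tn : t != 0 by rewrite gt_eqF.
have H x y : is_derive y 1 (fun y => step ((y - x) / t - s)) (dilate (pulse s) x t y).
  rewrite /dilate (gtr0_norm t0).
  exact: (@is_derive_dil (fun z => step (z - s)) _ x t y tn (pulse_is_derive s _)).
by apply: is_derive_derive1 => y; apply: is_deriveB.
Qed.

Lemma increment W s x1 x2 t : 0 < t -> x1 <= x2 ->
  W (dilate (pulse s) x2 t) - W (dilate (pulse s) x1 t) = dderiv W (ramp s x1 x2 t).
Proof.
move=> t0 x12; rewrite /dderiv/= derive1_ramp// sdistrB ?opprB//;
  by apply: test_function_dilate; [rewrite gt_eqF|exact: test_pulse].
Qed.

Lemma pulse_values W s x1 x2 g1 g2 e : 0 < e -> point_value W x1 g1 -> point_value W x2 g2 ->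
  exists2 d, 0 < d & forall t, 0 < t <= d ->
   `|W (dilate (pulse s) x2 t) - W (dilate (pulse s) x1 t) - (g2 - g1)| <= e.
Proof.
move=> e0 H1 H2; have e20 : 0 < e / 2 by rewrite divr_gt0.
have [d1 d10 Hd1] := point_value_bound H1 (test_pulse s) e20.
have [d2 d20 Hd2] := point_value_bound H2 (test_pulse s) e20.
exists (Num.min d1 d2) => [|t /andP[t0]]; first by rewrite lt_min d10.
rewrite le_min => /andP[td1 td2]; have tn : t != 0 by rewrite gt_eqF.
have := Hd1 t tn; have := Hd2 t tn; rewrite (gtr0_norm t0) integral_pulse !mulr1.
move=> /(_ td2) h2 /(_ td1) h1; rewrite [e]splitr.
apply: le_trans (lerD h2 h1); apply: le_trans (ler_normB _ _).
have gen (A B : R) : A - B - (g2 - g1) = A - g2 - (B - g1) by ring.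
by rewrite gen.
Qed.

Lemma values_le W x1 x2 g1 g2 : nonneg_distr (dderiv W) -> x1 <= x2 ->
  point_value W x1 g1 -> point_value W x2 g2 -> g1 <= g2.
Proof.
move=> pW x12 H1 H2; apply/ler_addgt0Pr => e e0.
have [d d0 Hd] := pulse_values 0 e0 H1 H2.
have := Hd d; rewrite d0 lexx => /(_ isT); rewrite increment//.
have := pW _ (test_ramp 0 d0 x12) (fun y => ramp_ge0 0 y d0 x12).
by rewrite ler_norml; lra.
Qed.

Lemma values_constant W a b x1 x2 g1 g2 : supported_in (dderiv W) `[a, b] -> x1 <= x2 ->
  x2 <= a \/ b <= x1 -> point_value W x1 g1 -> point_value W x2 g2 -> g1 = g2.
Proof.
move=> sW x12 xab H1 H2.
(* The support of the ramp lies in [[x1 - 2 t, x2 - t]] in the first case and in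
   [[x1 + t, x2 + 2 t]] in the second, at distance at least [t] from [[a, b]]. *)
pose s : R := if x2 <= a then - 2 else 1.
apply/eqP; rewrite -subr_eq0 -normr_le0; apply/ler_addgt0Pr => e e0; rewrite add0r.
have [d d0 Hd] := pulse_values s e0 H1 H2.
have := Hd d; rewrite d0 lexx => /(_ isT); rewrite increment//.
rewrite (supported_out sW (test_ramp s d0 x12)) ?sub0r ?normrN 1?distrC//.
exists (d / 2) => [|y yab]; first by rewrite divr_gt0.
apply/eqP; apply: contraT => /(ramp_supp d0 x12); rewrite /s.
by case: ifPn => [xa|/negP xa]; [lra|case: xab => // bx; lra].
Qed.

(** For small [t] the ramp equals 1 where [psi] lives and so dominates it, and the pairing with the
    ramp tends to the increment. *)
Lemma mass_bound W psi x1 x2 g1 g2 e : nonneg_distr (dderiv W) -> x1 <= x2 -> 0 < e ->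
  point_value W x1 g1 -> point_value W x2 g2 -> test_function psi ->
  (forall y, psi y <= 1) -> (forall y, psi y != 0 -> x1 + e <= y <= x2) ->
  dderiv W psi <= g2 - g1.
Proof.
move=> pW x12 e0 H1 H2 tp p1 ps; apply/ler_addgt0Pr => h h0.
have [d d0 Hd] := pulse_values 0 h0 H1 H2.
pose t := Num.min d e; have t0 : 0 < t by rewrite lt_min d0.
have := Hd t; rewrite t0 ge_min lexx => /(_ isT); rewrite increment//.
have tr := test_ramp 0 t0 x12.
have := pW _ (test_functionB tr tp); rewrite sdistrB// => /(_ _) H.
have : 0 <= dderiv W (ramp 0 x1 x2 t) - dderiv W psi.
  apply: H => y; rewrite subr_ge0; have [->|/ps yx] := eqVneq (psi y) 0.
    exact: ramp_ge0.
  have te : t <= e by rewrite ge_min lexx orbT.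
  by rewrite ramp1//; lra.
by rewrite ler_norml; lra.
Qed.

End increments.
Arguments point_value_const {R} c x.

(** * Restriction of a pair to a subinterval *)

Section restriction.
Variable R : realType.
Implicit Types (f psi phi : R -> R) (x y a b t z r e s l : R) (m n k N j : nat).
Implicit Types (w u v V G : sdistr R).
Local Notation mu := (@lebesgue_measure R).

Definition leftcut c e y : R := 1 - step ((y - c) / e - - 1).

Lemma smooth_leftcut c e : smooth (leftcut c e).
Proof. exact: smoothB (@smooth_cst R 1) (@smooth_ramp_half R (-1) c e). Qed.

Lemma leftcut1 c e y : 0 < e -> y <= c - e -> leftcut c e y = 1.
Proof.
move=> e0 yc; rewrite /leftcut step0 ?subr0// opprK -lerBrDr sub0r ler_pdivrMr//; lra.
Qed.

Lemma leftcut0 c e y : 0 < e -> c <= y -> leftcut c e y = 0.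
Proof.
move=> e0 yc; by rewrite /leftcut step1 ?subrr// opprK lerDr divr_ge0 ?subr_ge0 ?(ltW e0).
Qed.

Variables (W : sdistr R) (c : R).
Hypothesis W0 : point_value W c 0.

Definition cdil phi t y : R := phi ((y - c) / t).

(* As W has the value 0 at c, its dyadic pieces near c are as small as their scale. *)
Lemma leftcut_close : exists (C : R) (N : nat), 0 <= C /\
  forall phi (K e e' t : R), test_function phi -> 0 <= K ->
   (forall m z, (m <= N)%N -> `|z| <= 1 -> `|derive1n m phi z| <= K) ->
   0 < e' <= e -> e <= `|t| <= 1 ->
   `|W (fun y => leftcut c e' y * cdil phi t y) - W (fun y => leftcut c e y * cdil phi t y)|
     <= C * e * K.
Proof.
pose r := `|c| + 1; have r0 : 0 < r by rewrite ltr_wpDl.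
have cr : `|c| < r by rewrite ltrDl.
have cL := cdistr_cut W r0.
have [C [N [C0 HC]]] := cdistr_ubp cL (point_value_local_bound r0 cr W0) 1.
have [B B0 HB] := @step_derive_bounded R N.
pose D := (1 + 2 ^+ N) * B.
have D0 : 0 <= D by apply: mulr_ge0 => //; rewrite addr_ge0// exprn_ge0.
pose M := C * (2 ^+ N * D).
have M0 : 0 <= M by apply: mulr_ge0 => //; apply: mulr_ge0 => //; exact: exprn_ge0.
exists (2 * M), N; split; first exact: mulr_ge0.
move=> phi K e e' t tphi K0 HK.
have tl e1 : t != 0 -> test_function (fun y => leftcut c e1 y * cdil phi t y).
  move=> tn; have := test_functionM (@smooth_leftcut c e1) (@test_function_dil R phi c t tn tphi).
  by congr test_function; apply/funext => y; rewrite mulrC.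
(* For two cuts at comparable scales the difference is a dilate at scale [e1] of a function with
   bounded derivatives, on which [W] is of order [e1] because of its point value at [c]. *)
have single e1 e2 : 0 < e2 -> e2 <= e1 -> e1 <= 2 * e2 -> e1 <= `|t| <= 1 ->
  `|W (fun y => leftcut c e2 y * cdil phi t y) - W (fun y => leftcut c e1 y * cdil phi t y)|
     <= M * e1 * K.
  move=> e20 e21 e12 /andP[e1t t1].
  have e10 : 0 < e1 by exact: lt_le_trans e21.
  have e1n : e1 != 0 by rewrite gt_eqF.
  have e2n : e2 != 0 by rewrite gt_eqF.
  have t0 : 0 < `|t| by exact: lt_le_trans e1t.
  have tn : t != 0 by rewrite -normr_gt0.
  (* In units of [e1] the second cut is the first one compressed by [l <= 2], and [phi] is stretched
     by [|k| <= 1], so no derivative deteriorates. *)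
  pose l := e1 / e2; pose k := e1 / t.
  have l0 : 0 <= l by rewrite divr_ge0// ltW.
  have l2 : l <= 2 by rewrite ler_pdivrMr.
  have k1 : `|k| <= 1 by rewrite normrM normfV (gtr0_norm e10) ler_pdivrMr// mul1r.
  pose dl z := step (1 * z + 1) - step (l * z + 1).
  have sl1 : smooth (fun z : R => step (1 * z + 1)) := @smooth_compZ R _ 1 1 (@smooth_step R).
  have sl2 : smooth (fun z : R => step (l * z + 1)) := @smooth_compZ R _ l 1 (@smooth_step R).
  have sdl : smooth dl := smoothB sl1 sl2.
  have sk : smooth (fun z : R => phi (k * z + 0)) := @smooth_compZ R _ k 0 tphi.1.
  pose h z := dl z * phi (k * z + 0).
  have sh : smooth h := smoothM sdl sk.
  have th : test1 h.
    split=> // z z1; rewrite /h; suff -> : dl z = 0 by rewrite mul0r.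
    have l1 : 1 <= l by rewrite ler_pdivlMr// mul1r.
    rewrite /dl; have [z0|z0] := ltP z 0.
      have zn : z < - 1 by move: z1; rewrite ltr0_norm//; lra.
      by rewrite !step0 ?subrr//; nra.
    have zp : 1 < z by move: z1; rewrite ger0_norm.
    by rewrite !step1 ?subrr//; nra.
  have Hh m z : (m <= N)%N -> `|derive1n m h z| <= 2 ^+ N * (D * K).
    move=> mN; have DK : 0 <= 2 ^+ N * (D * K).
      by apply: mulr_ge0; [exact: exprn_ge0|exact: mulr_ge0].
    have [z1|z1] := leP `|z| 1; last by rewrite test1_derive1n0// normr0.
    have := @leibniz_bound R N _ _ z D K 1 sdl sk D0 K0 ler01.
    move=> /(_ _ _ m mN); rewrite expr1n mulr1 => H; apply: (le_trans (H _ _)).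
    - move=> i iN; rewrite expr1n mulr1 /dl (derive1nB i sl1 sl2).
      rewrite (@derive1n_comp_affine R (@step R) 1 1 i (@smooth_step R)).
      rewrite (@derive1n_comp_affine R (@step R) l 1 i (@smooth_step R)).
      rewrite expr1n !mul1r /D mulrDl [X in _ <= X + _]mul1r; apply: (le_trans (ler_normB _ _)).
      apply: lerD; first exact: HB.
      rewrite normrM; apply: ler_pM => //; last exact: HB.
      rewrite normrX (ger0_norm l0); apply: (@le_trans _ _ (2 ^+ i)).
        by apply: lerXn2r; rewrite ?nnegrE.
      by apply: ler_weXn2l => //; rewrite ler1n.
    - move=> i iN; rewrite expr1n mulr1.
      rewrite (@derive1n_comp_affine R phi k 0 i tphi.1) normrM.
      have kz : `|k * z + 0| <= 1 by rewrite addr0 normrM mulr_ile1.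
      apply: (@le_trans _ _ (1 * K)); last by rewrite mul1r.
      apply: ler_pM => //; last exact: HK.
      by rewrite normrX exprn_ile1.
    by apply: ler_wpM2r; [exact: mulr_ge0|apply: ler_weXn2l => //; rewrite ler1n].
  rewrite -sdistrB; [|exact: tl|exact: tl].
  have -> : (fun y => leftcut c e2 y * cdil phi t y - leftcut c e1 y * cdil phi t y) = dil h c e1.
    apply/funext => y; rewrite /dil /h /dl /leftcut /cdil !opprK mul1r addr0.
    have -> : l * ((y - c) / e1) = (y - c) / e2 by rewrite /l; field; rewrite e1n e2n.
    have -> : k * ((y - c) / e1) = (y - c) / t by rewrite /k; field; rewrite e1n tn.
    by ring.
  have := HC e1 h (2 ^+ N * (D * K)) e1n; rewrite (gtr0_norm e10) expr1.
  have e11 : e1 <= 1 by exact: le_trans t1.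
  move=> /(_ e11 th Hh).
  have -> : C * e1 * (2 ^+ N * (D * K)) = M * e1 * K by rewrite /M; ring.
  rewrite cut_on// => y; rewrite /dil => hy.
  have : `|(y - c) / e1| <= 1.
    by rewrite leNgt; apply/negP => /th.2 h0; rewrite h0 eqxx in hy.
  rewrite normrM normfV (gtr0_norm e10) ler_pdivrMr// mul1r => yc.
  by have := ler_normD (y - c) c; rewrite subrK /r; lra.
move=> /andP[e'0 e'e] et.
(* The induction halves [e] until it is comparable to [e']; the errors form a geometric series,
   whence the factor 2 in the constant. *)
have [n en] : exists n : nat, e <= 2 ^+ n.+1 * e'.
  pose n := Num.bound (e / e').
  exists n; rewrite -ler_pdivrMr//.
  have ee : 0 <= e / e' by rewrite divr_ge0// ltW// (lt_le_trans e'0).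
  apply: (le_trans (ltW (archi_boundP ee))); rewrite -natrX ler_nat.
  by apply: (leq_trans (leqnSn _)); apply: ltnW; exact: ltn_expl.
elim: n e e'e et en => [|n IH] e e'e et en.
  have e0 : 0 < e by exact: lt_le_trans e'e.
  rewrite expr1 in en; apply: (le_trans (single _ _ e'0 e'e en et)).
  by apply: ler_wpM2r => //; apply: ler_wpM2r; [exact: ltW|lra].
have e0 : 0 < e by exact: lt_le_trans e'e.
have [ee|ee] := leP e (2 * e').
  apply: (le_trans (single _ _ e'0 e'e ee et)).
  by apply: ler_wpM2r => //; apply: ler_wpM2r; [exact: ltW|lra].
have h1 : e' <= e / 2 by lra.
have h2 : e / 2 <= `|t| <= 1 by move: et; lra.
have h3 : e / 2 <= 2 ^+ n.+1 * e'.
  by rewrite ler_pdivrMr// mulrAC -exprSr.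
have H1 := IH _ h1 h2 h3.
have e20 : 0 < e / 2 by rewrite divr_gt0.
have h4 : e / 2 <= e by lra.
have h5 : e <= 2 * (e / 2) by lra.
have H2 := single _ _ e20 h4 h5 et.
rewrite -[X in `|X|](subrKA (W (fun y => leftcut c (e / 2) y * cdil phi t y))).
apply: (le_trans (ler_normD _ _)).
apply: (le_trans (lerD H1 H2)).
by rewrite le_eqVlt; apply/orP; left; apply/eqP; field.
Qed.

End restriction.

(** * The part of a distribution to the left of a point *)

Section left_part.
Variable R : realType.
Implicit Types (f psi phi : R -> R) (x y a b t z r e s l : R) (m n k N j : nat).
Implicit Types (w u v V G : sdistr R).
Local Notation mu := (@lebesgue_measure R).
Variables (W : sdistr R) (c : R).
Hypothesis W0 : point_value W c 0.

Let lcut e psi : R -> R := fun y => leftcut c e y * psi y.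
(** This is [W] multiplied by the indicator of the half-line to the left of [c]. A distribution has
    no such product in general; the limit exists here because [W] has the value 0 at [c]. *)
Let p psi : R := lim (W (lcut e psi) @[e --> 0^'+]).

Let test_lcut e psi : test_function psi -> test_function (lcut e psi).
Proof.
move=> tp; have := test_functionM (@smooth_leftcut R c e) tp.
by congr test_function; apply/funext => y; rewrite mulrC.
Qed.

Let W_close := leftcut_close W0.

Let cdil1 psi : psi = cdil c (fun z => psi (1 * z + c)) 1.
Proof. by apply/funext => y; rewrite /cdil divr1 mul1r subrK. Qed.

Let test_shift psi : test_function psi -> test_function (fun z => psi (1 * z + c)).
Proof.
move=> tp; have := test_function_dil (- c) (@oner_neq0 R) tp.
by congr test_function; apply/funext => y; rewrite divr1 opprK mul1r.
Qed.

Let cvg_p psi : test_function psi -> W (lcut e psi) @[e --> 0^'+] --> p psi.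
Proof.
move=> tp; apply: cauchy_cvg; apply: cauchy_exP => h h0.
have [C [N [C0 HC]]] := W_close.
have tp' := test_shift tp.
have [K K0 HK] := @smooth_bounded R _ N 1 tp'.1.
pose e := Num.min 1 (h / 2 / (C * K + 1)).
have CK : 0 < C * K + 1 by rewrite ltr_wpDl// mulr_ge0.
have e0 : 0 < e by rewrite lt_min ltr01 !divr_gt0.
have e1 : e <= 1 by rewrite ge_min lexx.
have eh : e <= h / 2 / (C * K + 1) by rewrite ge_min lexx orbT.
exists (W (lcut e psi)).
suff : \forall e' \near 0^'+, ball (W (lcut e psi)) h (W (lcut e' psi)) by [].
near=> e'; have ee : 0 < e' <= e.
  by apply/andP; split; near: e'; [exact: nbhs_right_gt|exact: nbhs_right_le].
have ee1 : e <= `|1 : R| <= 1 by rewrite normr1 e1 lexx.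
have := HC _ K e e' 1 tp' K0 HK ee ee1.
rewrite -cdil1 => H; rewrite /ball/= distrC; apply: (le_lt_trans H).
have : e * (C * K + 1) <= h / 2 by rewrite -ler_pdivlMr.
have -> : e * (C * K + 1) = C * e * K + e by ring.
lra.
Unshelve. all: by end_near.
Qed.

Lemma left_part_close : exists (C : R) (N : nat), 0 <= C /\
  forall phi (K e t : R), test_function phi -> 0 <= K ->
   (forall m z, (m <= N)%N -> `|z| <= 1 -> `|derive1n m phi z| <= K) ->
   0 < e -> e <= `|t| <= 1 -> `|p (cdil c phi t) - W (lcut e (cdil c phi t))| <= C * e * K.
Proof.
have [C [N [C0 HC]]] := W_close; exists C, N; split => // phi K e t tphi K0 HK e0 et.
have tn : t != 0 by rewrite -normr_gt0; case/andP: et => + _; exact: lt_le_trans.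
apply/ler_addgt0Pr => h h0.
have tc : test_function (cdil c phi t) := test_function_dil c tn tphi.
have [e' [e'0 e'e H]] : exists e', [/\ 0 < e', e' <= e &
    `|p (cdil c phi t) - W (lcut e' (cdil c phi t))| <= h].
  apply: (@filter_ex _ (0^'+ : set_system R)); near=> e'; split; near: e'.
  - exact: nbhs_right_gt.
  - exact: nbhs_right_le.
  - by have /cvgrPdist_le := cvg_p tc; apply.
rewrite -(subrKA (W (lcut e' (cdil c phi t)))).
apply: (le_trans (ler_normD _ _)); rewrite addrC; apply: lerD => //.
by apply: (HC phi K e e' t) => //; rewrite e'0.
Unshelve. all: by end_near.
Qed.

Let p_linear d f psi : test_function f -> test_function psi ->
  p (fun x => d * f x + psi x) = d * p f + p psi.
Proof.
move=> tf tp; apply: cvg_lim => //.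
have -> : (fun e => W (lcut e (fun x => d * f x + psi x))) =
    (fun e => d * W (lcut e f) + W (lcut e psi)).
  apply/funext => e; rewrite -spair_linear; [|exact: test_lcut..].
  by congr (spair W); apply/funext => y; rewrite /lcut; ring.
by apply: cvgD; [apply: cvgMr; exact: cvg_p|exact: cvg_p].
Qed.

Let p_continuous (K : set R) : compact K ->
  exists (C : R) (N : nat), forall f (B : R),
    test_function f -> fsupport f `<=` K ->
    (forall (m : nat) (x : R), (m <= N)%N -> `|derive1n m f x| <= B) ->
    `|p f| <= C * B.
Proof.
move=> /(spair_continuous W)[C1 [N1 H1]].
have [C [N [C0 HC]]] := left_part_close.
have [B B0 HB] := @step_derive_bounded R N1.
pose M := `|C1| * (2 ^+ N1 * (1 + B)).
exists (C + M), (maxn N N1) => f D tf fK fD.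
have D0 : 0 <= D by apply: le_trans (fD 0%N 0 isT).
have tf' := test_shift tf.
rewrite -[p f](subrK (W (lcut 1 f))) mulrDl; apply: (le_trans (ler_normD _ _)).
apply: lerD.
  have := HC _ D 1 1 tf' D0; rewrite -cdil1 mulr1; apply => //.
    move=> m z mN _; rewrite (@derive1n_comp_affine R f 1 c m tf.1) expr1n mul1r.
    by apply: fD; rewrite (leq_trans mN)// leq_maxl.
  by rewrite normr1 lexx.
have DB : 0 <= 2 ^+ N1 * ((1 + B) * D).
  by apply: mulr_ge0; [exact: exprn_ge0|apply: mulr_ge0 => //; lra].
apply: (@le_trans _ _ (C1 * (2 ^+ N1 * ((1 + B) * D)))); last first.
  by rewrite /M -!mulrA; apply: ler_wpM2r => //; exact: ler_norm.
apply: H1; first exact: test_lcut.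
  apply: subset_trans fK; apply: fsupport_sub; first exact: closed_closure.
  move=> x px; apply: subset_closure => /=; apply: contraNneq px => fx.
  by rewrite /lcut fx mulr0.
move=> m x mN; have B1 : 0 <= 1 + B by lra.
have sS := @smooth_ramp_half R (-1) c 1.
have := @leibniz_bound R N1 _ _ x (1 + B) D 1 (@smooth_leftcut R c 1) tf.1 B1 D0 ler01.
move=> /(_ _ _ m mN); rewrite expr1n mulr1 => H; apply: (le_trans (H _ _)).
- move=> i iN; rewrite expr1n mulr1 /leftcut (derive1nB i (@smooth_cst R 1) sS).
  apply: (le_trans (ler_normB _ _)); apply: lerD.
    by rewrite derive1n_cst; case: i iN => *; rewrite ?normr1 ?normr0.
  have -> : (fun y : R => step ((y - c) / 1 - -1)) = (fun y => step (1 * y + (1 - c))).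
    by apply/funext => y; congr step; rewrite divr1; ring.
  rewrite (@derive1n_comp_affine R (@step R) 1 (1 - c) i (@smooth_step R)) expr1n mul1r.
  exact: HB.
- by move=> i iN; rewrite expr1n mulr1; apply: fD; rewrite (leq_trans iN)// leq_maxr.
apply: ler_wpM2r; first exact: mulr_ge0.
by apply: ler_weXn2l => //; rewrite ler1n.
Qed.

Definition left_part : sdistr R := SDistr p_linear p_continuous.

Lemma left_part_on psi e : test_function psi -> 0 < e ->
  (forall y, psi y != 0 -> y <= c - e) -> left_part psi = W psi.
Proof.
move=> tp e0 pe; apply: cvg_lim => //; apply: cvg_near_cst; near=> e'.
have ee : e' <= e by near: e'; exact: nbhs_right_le.
have e'0 : 0 < e' by near: e'; exact: nbhs_right_gt.
congr (spair W); apply/funext => y; rewrite /lcut.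
have [->|/pe ye] := eqVneq (psi y) 0; first by rewrite mulr0.
by rewrite leftcut1 ?mul1r//; lra.
Unshelve. all: by end_near.
Qed.

Lemma left_part_right psi : test_function psi -> (forall y, psi y != 0 -> c <= y) ->
  left_part psi = 0.
Proof.
move=> tp pe; apply: cvg_lim => //; apply: cvg_near_cst; near=> e'.
have e'0 : 0 < e' by near: e'; exact: nbhs_right_gt.
rewrite -(sdistr0 W); congr (spair W); apply/funext => y; rewrite /lcut.
have [->|/pe ye] := eqVneq (psi y) 0; first by rewrite mulr0.
by rewrite leftcut0// mul0r.
Unshelve. all: by end_near.
Qed.

(** All cuts at scales below [e] agree where [psi] lives, so the limit is attained. *)
Lemma left_part_cut psi e : test_function psi -> 0 < e ->
  (forall y, psi y != 0 -> ~ (c - e <= y <= c)) ->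
  left_part psi = W (fun y => leftcut c e y * psi y).
Proof.
move=> tp e0 pe; apply: cvg_lim => //; apply: cvg_near_cst; near=> e'.
have ee : e' <= e by near: e'; exact: nbhs_right_le.
have e'0 : 0 < e' by near: e'; exact: nbhs_right_gt.
congr (spair W); apply/funext => y; rewrite /lcut.
have [->|/pe ye] := eqVneq (psi y) 0; first by rewrite !mulr0.
have [yc|yc] := leP c y; first by rewrite !leftcut0.
have yce : y < c - e by rewrite ltNge; apply/negP => h; apply: ye; rewrite h ltW.
by rewrite !leftcut1//; lra.
Unshelve. all: by end_near.
Qed.

Lemma point_value_near G V x gam d : 0 < d ->
  (forall psi, test_function psi -> (forall y, psi y != 0 -> `|y - x| <= d) -> G psi = V psi) ->
  point_value V x gam -> point_value G x gam.
Proof.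
move=> d0 GV HV phi tp; have /test_functionP[_ [r r0 pr]] := tp.
apply: cvg_trans (HV phi tp); apply: near_eq_cvg; near=> t.
have tn : t != 0 by near: t; exact: nbhs_dnbhs_neq.
have td : `|t| <= d / r.
  near: t; apply: dnbhs0_le; by rewrite divr_gt0.
rewrite GV//; first exact: test_function_dilate.
move=> y; rewrite /dilate mulf_eq0 negb_or => /andP[_ /pr].
rewrite normrM normfV ler_pdivrMr ?normr_gt0// => H; apply: (le_trans H).
by move: td; rewrite ler_pdivlMr// mulrC.
Unshelve. all: by end_near.
Qed.

Lemma left_part_value_left x gam : x < c -> point_value W x gam -> point_value left_part x gam.
Proof.
move=> xc; have d0 : 0 < (c - x) / 2 by rewrite divr_gt0// subr_gt0.
apply: (point_value_near d0) => psi tp px; apply: (left_part_on tp d0) => y /px.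
by rewrite ler_norml; lra.
Qed.

Lemma point_value0 x : point_value (sconst 0) x 0.
Proof. exact: point_value_const. Qed.

Lemma left_part_value_right x : c < x -> point_value left_part x 0.
Proof.
move=> xc; have d0 : 0 < (x - c) / 2 by rewrite divr_gt0// subr_gt0.
apply: (point_value_near d0 _ (point_value0 x)) => psi tp px.
rewrite left_part_right//= ?mul0r// => y /px; rewrite ler_norml; lra.
Qed.

(** At scale [t] the limit is replaced by the cut at distance [d |t|], with an error of at most
    [C d K |t|], small relative to [|t|] by the choice of [d]. After rescaling, this cut times [phi]
    is a fixed test function, to which the point value of [W] applies. *)
Lemma left_part_value_at : point_value left_part c 0.
Proof.
move=> phi tp; rewrite mul0r.
have [C [N [C0 HC]]] := left_part_close.
have [K K0 HK] := @smooth_bounded R phi N 1 tp.1.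
apply/cvgrPdist_le => h h0.
have CK : 0 < C * K + 1 by rewrite ltr_wpDl// mulr_ge0.
pose d := Num.min 1 (h / 2 / (C * K + 1)).
have d0 : 0 < d by rewrite lt_min ltr01 !divr_gt0.
have d1 : d <= 1 by rewrite ge_min lexx.
have dh : C * d * K <= h / 2.
  have : d <= h / 2 / (C * K + 1) by rewrite ge_min lexx orbT.
  rewrite ler_pdivlMr//; apply: le_trans; have -> : d * (C * K + 1) = C * d * K + d by ring.
  by rewrite lerDl ltW.
(* Here [s] stands for the sign of [t]: a negative dilation reverses the side on which the cut
   acts. *)
pose pp s z := leftcut 0 d (s * z + 0) * phi z.
have tpp s : test_function (pp s).
  have := test_functionM (@smooth_compZ R _ s 0 (@smooth_leftcut R 0 d)) tp.
  by congr test_function; apply/funext => y; rewrite /pp mulrC.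
have h20 : 0 < h / 2 by rewrite divr_gt0.
have [e1 e10 H1] := point_value_bound W0 (tpp 1) h20.
have [e2 e20 H2] := point_value_bound W0 (tpp (-1)) h20.
near=> t.
have tn : t != 0 by near: t; exact: nbhs_dnbhs_neq.
have t0 : 0 < `|t| by rewrite normr_gt0.
have te1 : `|t| <= e1 by near: t; exact: dnbhs0_le.
have te2 : `|t| <= e2 by near: t; exact: dnbhs0_le.
have t1 : `|t| <= 1 by near: t; exact: dnbhs0_le.
have tc : test_function (cdil c phi t) := test_function_dil c tn tp.
have -> : left_part (dilate phi c t) = `|t|^-1 * p (cdil c phi t).
  by rewrite -(sdistrZ left_part).
have td : 0 < d * `|t| by exact: mulr_gt0.
have td1 : d * `|t| <= `|t| <= 1 by rewrite t1 andbT ler_piMl.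
have Hc := HC phi K _ t tp K0 HK td td1.
have Hp s : s * `|t| = t -> s ^+ 2 = 1 ->
    W (lcut (d * `|t|) (cdil c phi t)) = `|t| * W (dilate (pp s) c t).
  move=> st s2; rewrite -pairing_dil//; congr (spair W); apply/funext => y.
  rewrite /lcut /pp /leftcut /cdil; congr ((1 - step (_ - -1)) * _).
  have tE : t^-1 = s * `|t|^-1.
    rewrite -{1}st invfM; congr (_ * _); apply: (@mulfI _ s).
      by apply: contra_eq_neq s2 => ->; rewrite expr0n eq_sym oner_neq0.
    rewrite -expr2 s2 mulfV//.
    by apply: contra_eq_neq s2 => ->; rewrite expr0n eq_sym oner_neq0.
  rewrite subr0 addr0 tE invfM.
  have -> : s * ((y - c) * (s * `|t|^-1)) / d = s ^+ 2 * ((y - c) * (d^-1 * `|t|^-1)) by ring.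
  by rewrite s2 mul1r.
have Hw : `|W (lcut (d * `|t|) (cdil c phi t))| <= `|t| * (h / 2).
  have Hs s : s * `|t| = t -> s ^+ 2 = 1 -> `|W (dilate (pp s) c t)| <= h / 2 ->
      `|W (lcut (d * `|t|) (cdil c phi t))| <= `|t| * (h / 2).
    by move=> st s2 H; rewrite (Hp s st s2) normrM normr_id ler_pM2l.
  have [tp0|tn0] := ltP 0 t.
    apply: (Hs 1); rewrite ?expr1n//; first by rewrite mul1r gtr0_norm.
    by have := H1 t tn te1; rewrite mul0r subr0.
  apply: (Hs (-1)); rewrite ?sqrrN ?expr1n//; first by rewrite mulN1r ler0_norm// opprK.
  by have := H2 t tn te2; rewrite mul0r subr0.
rewrite sub0r normrN normrM normfV normr_id mulrC ler_pdivrMr//.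
rewrite -[p _](subrK (W (lcut (d * `|t|) (cdil c phi t)))).
apply: (le_trans (ler_normD _ _)); apply: (le_trans (lerD Hc Hw)).
have -> : C * (d * `|t|) * K = C * d * K * `|t| by ring.
rewrite [`|t| * _]mulrC -mulrDl ler_pM2r//; lra.
Unshelve. all: by end_near.
Qed.

End left_part.

(** * Restriction and negation of pairs *)

Section restrict.
Variable R : realType.
Implicit Types (psi phi : R -> R) (x y a b c t z r e s : R) (m n k N j : nat).
Implicit Types (w u v U V W G : sdistr R) (E Z : set R) (f : R -> \bar R).
Local Notation mu := (@lebesgue_measure R).

Lemma T0_smooth phi : T0 phi -> smooth phi.
Proof. by case. Qed.

Lemma point_value_unique G x (gam del : R) : point_value G x gam -> point_value G x del -> gam = del.
Proof.
move=> H1 H2; have h1 := H1 _ (test_pulse 0); have h2 := H2 _ (test_pulse 0).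
have := cvg_unique _ h1 h2; rewrite integral_pulse !mulr1; exact.
Qed.

Lemma supported_sub G (K K' : set R) : K `<=` K' -> supported_in G K -> supported_in G K'.
Proof.
move=> KK sG psi tp pK; apply: sG => //; rewrite -subset0 => x [px /KK Kx].
by rewrite -pK; split.
Qed.

Lemma exists_radius a b : exists2 r : R, 0 < r & - r < a /\ b < r.
Proof.
exists (`|a| + `|b| + 1); first by rewrite ltr_wpDl// addr_ge0.
have := ler_norm (- a); have := ler_norm b; rewrite normrN.
have := normr_ge0 a; have := normr_ge0 b; lra.
Qed.

(** The difference of the two distributions vanishes near [x], so its pairings with the dilates tend
    to 0. *)
Lemma lower_value_local u u' a b x d phi : supported_in u `[a, b] -> supported_in u' `[a, b] ->
  0 < d -> (forall psi, test_function psi -> (forall y, psi y != 0 -> `|y - x| <= d) ->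
     u' psi = u psi) -> T0 phi ->
  (lower_value u phi x <= lower_value u' phi x)%E.
Proof.
move=> su su' d0 uu tphi; have [r r0 [ra br]] := exists_radius a b.
have sd t := @smooth_dilate R phi x t (T0_smooth tphi).
apply: einf_ge => q /ereal_lt_dense[q' /andP[]]; rewrite lte_fin => qq' q'u.
have n1 := einf_gt _ q'u.
pose w := sdlin (-1) u u'.
have wE t : cutd w r (dilate phi x t) = cpair u' (dilate phi x t) - cpair u (dilate phi x t).
  rewrite (cpair_cut su r0 ra br (sd t)) (cpair_cut su' r0 ra br (sd t)).
  by rewrite /cutd /w /sdlin/=; ring.
have q0 : 0 < q' - q by rewrite subr_gt0.
have := @tail_vanish R (cutd w r) x d phi (cdistr_cut w r0) d0 _ tphi _ q0 => n2.
near=> t.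
have h1 : q' < cpair u (dilate phi x t) by near: t; exact: n1.
have : `|cutd w r (dilate phi x t)| <= q' - q.
  near: t; apply: n2 => psi sp px; rewrite /cutd /w /sdlin/= uu ?mulN1r ?addNr//.
    exact: test_functionM sp (test_plateau r0).
  by move=> y; rewrite mulf_eq0 negb_or => /andP[_ /px].
by rewrite wE ler_norml; lra.
Unshelve. all: by end_near.
Qed.

Lemma derive1_leftcut c e y : 0 < e -> derive1 (@leftcut R c e) y != 0 -> c - e <= y <= c.
Proof.
move=> e0; have en : e != 0 by rewrite gt_eqF.
have D : is_derive y 1 (leftcut c e) (0 - e^-1 * pulse (-1) ((y - c) / e)).
  apply: is_deriveB.
  exact: (@is_derive_dil R (fun z => step (z - -1)) _ c e y en (pulse_is_derive (-1) _)).
rewrite derive1E derive_val sub0r oppr_eq0 mulf_eq0 negb_or => /andP[_ /pulse_supp].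
by rewrite ler_pdivlMr// ler_pdivrMr//; lra.
Qed.

(** The new primitive is the part of [U - gam] to the left of [c], plus [gam]: it is frozen at [gam]
    from [c] on. Subtracting [gam] first gives the value 0 at [c] that the cut needs. *)
Lemma restrict_major a b c f u U gam : a <= b -> a <= c <= b ->
  major_pair a b f u U -> point_value U c gam ->
  exists u' U', major_pair a c f u' U' /\ point_value U' c gam.
Proof.
move=> ab /andP[ac cb] [su lU eU Ua [E [Z [cE nZ uZ uE]]]] Uc.
pose W := sdlin 1 (sconst (- gam)) U.
have W0 : point_value W c 0.
  have := point_value_lin 1 (point_value_const (- gam) c) Uc.
  by rewrite mul1r addNr.
have dW psi : test_function psi -> dderiv W psi = u psi.
  move=> tp; rewrite -eU// /dderiv/= /sdlin/= integral_derive1//; ring.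
pose L := left_part W0; pose U' := sdlin 1 L (sconst gam); pose u' := dderiv U'.
have u'E psi : test_function psi -> u' psi = - L (derive1 psi).
  move=> tp; rewrite /u' /dderiv/= /U' /sdlin integral_derive1// mulr0 addr0 mul1r//.
have u'u psi e : test_function psi -> 0 < e -> (forall y, psi y != 0 -> y <= c - e) ->
    u' psi = u psi.
  move=> tp e0 pe; rewrite u'E// /L (left_part_on W0 (test_function_derive1 tp) (e := e / 2)).
  - by rewrite -dW.
  - by rewrite divr_gt0.
  - move=> y; apply: contraNT; rewrite -ltNge => yc; apply/eqP.
    have := @derive1n_eq_open R [set z | c - e < z] psi (cst 0) 1 y (@open_gt R _).
    rewrite !derive1n1 derive1_cst /=; apply; last by lra.
    by move=> z cz; apply/eqP; apply: contraTT cz => /pe; rewrite -leNgt.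
(* A test function whose support avoids [[a, c]] vanishes near [c], where the derivative of the cut
   lives. So cutting commutes with differentiation, and [u'] acts as [u] on the cut function. *)
have su' : supported_in u' `[a, c].
  move=> psi tp pac; rewrite u'E//.
  have nc : ~ fsupport psi c.
    move=> pc; suff : set0 c by [].
    by rewrite -pac; split => //=; rewrite in_itv/= ac lexx.
  have oc : nbhs c (~` fsupport psi).
    by apply: open_nbhs_nbhs; split => //; apply: closed_openC; exact: closed_closure.
  have [d dp Hd] := (nbhs_ballP _ _).1 oc.
  have d0 : 0 < d := dp.
  have psi0 y : `|y - c| < d -> ~ fsupport psi y.
    by move=> yc; apply: Hd; rewrite /ball/= distrC.
  have e0 : 0 < d / 2 by rewrite divr_gt0.
  have tp' := test_function_derive1 tp.
  have tl : test_function (fun y => leftcut c (d / 2) y * psi y).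
    have := test_functionM (@smooth_leftcut R c (d / 2)) tp.
    by congr test_function; apply/funext => y; rewrite mulrC.
  rewrite /L (left_part_cut W0 tp' e0); last first.
    move=> y py ye; apply: (psi0 y); first by rewrite ltr_norml; lra.
    by apply: (@fsupport_derive1 R psi); exact: subset_closure.
  have -> : (fun y => leftcut c (d / 2) y * derive1 psi y) =
      derive1 (fun y => leftcut c (d / 2) y * psi y).
    apply/funext => y; rewrite (derive1M _ (@smooth_leftcut R c (d / 2)) tp.1).
    have [->|dl] := eqVneq (derive1 (leftcut c (d / 2)) y) 0; first by rewrite mul0r add0r.
    have yc := derive1_leftcut e0 dl.
    have -> : psi y = 0; last by rewrite mulr0 add0r.
    apply/eqP; apply: contraT => py; exfalso; apply: (psi0 y).
      by rewrite ltr_norml; lra.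
    exact: subset_closure.
  have := dW _ tl; rewrite {1}/dderiv/= => ->; apply: su => //.
  rewrite -subset0 => x [/= fx]; rewrite in_itv/= => xab.
  have [px xc] : fsupport psi x /\ x <= c.
    have : fsupport (fun y => leftcut c (d / 2) y * psi y) `<=`
        fsupport psi `&` [set y | y <= c].
      apply: fsupport_sub; first by apply: closedI; [exact: closed_closure|exact: closed_le].
      move=> y; rewrite mulf_eq0 negb_or => /andP[ly py]; split; first exact: subset_closure.
      by rewrite /= leNgt; apply: contra ly => /ltW cy; rewrite leftcut0.
    by move=> /(_ x fx).
  suff : set0 x by [].
  by rewrite -pac; split => //=; rewrite in_itv/= xc andbT; case/andP: xab.
have cab x : x \in `[a, c] -> x \in `[a, b] by rewrite !in_itv/=; lra.
have lower_ x phi : x \in `[a, c] -> x <> c -> T0 phi ->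
    (lower_value u phi x <= lower_value u' phi x)%E.
  rewrite in_itv/= => xac xc tphi.
  have xc' : x < c by rewrite lt_neqAle; apply/andP; split; [exact/eqP|case/andP: xac].
  have d0 : 0 < (c - x) / 2 by rewrite divr_gt0// subr_gt0.
  apply: (lower_value_local su _ d0) => //.
    apply: supported_sub su' => y /=; rewrite !in_itv/=; lra.
  move=> psi tp px; apply: (u'u _ ((c - x) / 2)) => // y /px; rewrite ler_norml; lra.
have val x : x < c -> forall del, point_value U x del -> point_value U' x del.
  move=> xc del Ux.
  have h1 := point_value_lin 1 (point_value_const (- gam) x) Ux.
  have := point_value_lin 1 (left_part_value_left W0 xc h1) (point_value_const gam x).
  by have -> : 1 * (1 * - gam + del) + gam = del by ring.
have valc : point_value U' c gam.
  have := point_value_lin 1 (left_part_value_at W0) (point_value_const gam c).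
  by rewrite mulr0 add0r.
exists u', U'; split => //; split => //.
- move=> x; have [xc|cx|->] := ltgtP x c; last by exists gam.
    by have [del Ux] := lU x; exists del; exact: val.
  exists gam; have := point_value_lin 1 (left_part_value_right W0 cx) (point_value_const gam x).
  by rewrite mulr0 add0r.
- have [ac'|ca] := ltP a c; first exact: val.
  have ca' : c = a by apply/eqP; rewrite eq_le ca.
  by rewrite ca' in Uc valc *; rewrite (point_value_unique Ua Uc).
(* At [c] itself the lower value of the restriction is not controlled, so [c] joins both exceptional
   sets. *)
exists (E `|` [set c]), (Z `|` [set c]); split.
- by apply: countable_setU => //; exact: countable1.
- by apply: negligibleU => //; apply: countable_negligible; exact: countable1.
- move=> x phi xac /not_orP[nZx xc] tphi.
  by apply: le_trans (lower_ x phi xac xc tphi); exact: uZ (cab x xac) nZx tphi.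
- move=> x phi xac /not_orP[nEx xc] tphi.
  by apply: lt_le_trans (lower_ x phi xac xc tphi.1); exact: uE (cab x xac) nEx tphi.
Qed.

(* - G, as - 2 G + G. *)
Definition sopp G := sdlin (-2) G G.

Lemma soppE G psi : sopp G psi = - G psi.
Proof. by rewrite /sopp /sdlin/=; ring. Qed.

Lemma sopp_supported G (K : set R) : supported_in G K -> supported_in (sopp G) K.
Proof. by move=> sG psi tp pK; rewrite soppE sG// oppr0. Qed.

Lemma point_value_opp G x (gam : R) : point_value G x gam -> point_value (sopp G) x (- gam).
Proof.
move=> H; have := point_value_lin (-2) H H.
by have -> : -2 * gam + gam = - gam by ring.
Qed.

Lemma cpair_opp G a b psi : supported_in G `[a, b] -> smooth psi ->
  cpair (sopp G) psi = - cpair G psi.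
Proof.
move=> sG sp; have [r r0 [ra br]] := exists_radius a b.
rewrite (cpair_cut sG r0 ra br sp) (cpair_cut (sopp_supported sG) r0 ra br sp).
by rewrite /cutd soppE.
Qed.

Lemma upper_value_opp G a b phi x : supported_in G `[a, b] -> smooth phi ->
  upper_value (sopp G) phi x = (- lower_value G phi x)%E.
Proof.
move=> sG sp; rewrite /upper_value esup_opp /lower_value; congr (- limf_einf _ _)%E.
apply/funext => t; by rewrite (cpair_opp sG (@smooth_dilate R phi x t sp)) opprK.
Qed.

Lemma lower_value_opp G a b phi x : supported_in G `[a, b] -> smooth phi ->
  lower_value (sopp G) phi x = (- upper_value G phi x)%E.
Proof.
move=> sG sp; rewrite /upper_value esup_opp oppeK /lower_value; congr (limf_einf _ _)%E.
apply/funext => t; by rewrite (cpair_opp sG (@smooth_dilate R phi x t sp)).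
Qed.

Lemma lojasiewicz_opp G : lojasiewicz_distr G -> lojasiewicz_distr (sopp G).
Proof. by move=> lG x; have [gam H] := lG x; exists (- gam); exact: point_value_opp. Qed.

Lemma dderiv_opp V v : eq_sdistr (dderiv V) v -> eq_sdistr (dderiv (sopp V)) (sopp v).
Proof. by move=> e psi tp; rewrite soppE -e// sdlin_dderiv /sdlin/=; ring. Qed.

Lemma minor_opp a b f v V : minor_pair a b f v V ->
  major_pair a b (fun x => - f x)%E (sopp v) (sopp V).
Proof.
move=> [sv lV eV Va [E [Z [cE nZ vZ vE]]]]; split.
- exact: sopp_supported.
- exact: lojasiewicz_opp.
- exact: dderiv_opp.
- by rewrite -oppr0; exact: point_value_opp.
exists E, Z; split => // x phi xab nx tphi.
  by rewrite (lower_value_opp x sv (T0_smooth tphi)) leeN2; exact: vZ.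
rewrite (lower_value_opp x sv (T0_smooth tphi.1)) -[-oo%E]/(- +oo)%E lteN2; exact: vE.
Qed.

Lemma major_opp a b f v V : major_pair a b (fun x => - f x)%E v V ->
  minor_pair a b f (sopp v) (sopp V).
Proof.
move=> [sv lV eV Va [E [Z [cE nZ vZ vE]]]]; split.
- exact: sopp_supported.
- exact: lojasiewicz_opp.
- exact: dderiv_opp.
- by rewrite -oppr0; exact: point_value_opp.
exists E, Z; split => // x phi xab nx tphi.
  by rewrite (upper_value_opp x sv (T0_smooth tphi)) leeNl; exact: vZ.
rewrite (upper_value_opp x sv (T0_smooth tphi.1)) -[+oo%E]/(- -oo)%E lteN2; exact: vE.
Qed.

Lemma restrict_minor a b c f v V gam : a <= b -> a <= c <= b ->
  minor_pair a b f v V -> point_value V c gam ->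
  exists v' V', minor_pair a c f v' V' /\ point_value V' c gam.
Proof.
move=> ab acb /minor_opp mV /point_value_opp Vc.
have [u' [U' [mU Uc]]] := restrict_major ab acb mV Vc.
exists (sopp u'), (sopp U'); split; first exact: major_opp.
by rewrite -[gam]opprK; exact: point_value_opp.
Qed.

(** The restricted major pair bounds the infimum over [[a, c]] from above. Every major pair on
    [[a, c]] lies above the restricted minor pair, which bounds it from below. Hence the infimum is
    finite and [fine] returns it. *)
Lemma dist_integral_between a b c f u U v V (gam del : R) : a <= b -> a <= c <= b ->
  major_pair a b f u U -> minor_pair a b f v V ->
  point_value U c gam -> point_value V c del -> del <= dist_integral a c f <= gam.
Proof.
move=> ab acb mU mV Uc Vc.
have [u' [U' [mU' Uc']]] := restrict_major ab acb mU Uc.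
have [v' [V' [mV' Vc']]] := restrict_minor ab acb mV Vc.
have h1 : (ereal_inf (major_values a c f) <= gam%:E)%E.
  by apply: ereal_inf_lbound; exists gam => //; exists u', U'.
have h2 : (del%:E <= ereal_inf (major_values a c f))%E.
  apply: le_ereal_inf_tmp => _ [k [u1 [U1 [mU1 Uk]]] <-]; rewrite lee_fin.
  have ac : a <= c by case/andP: acb.
  have pos := major_minor_nonneg ac mU1 mV'.
  have [_ _ eU1 Ua1 _] := mU1; have [_ _ eV' Va' _] := mV'.
  have pos' : nonneg_distr (dderiv (sdlin (-1) V' U1)).
    move=> psi tp p0; rewrite sdlin_dderiv /sdlin/=.
    have := pos psi tp p0; rewrite {1}/sdlin/= -eU1// -eV'//.
  have := values_le pos' ac (point_value_lin (-1) Va' Ua1) (point_value_lin (-1) Vc' Uk).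
  lra.
rewrite /dist_integral; move: h1 h2; case: ereal_inf => //= l.
by rewrite !lee_fin => -> ->.
Qed.

End restrict.

(** * Approximation of the indefinite integral by pairs *)

Section indefinite.
Variable R : realType.
Implicit Types (psi phi chi : R -> R) (x y c t z r e s : R) (m n k N j : nat).
Implicit Types (w u v U V W G : sdistr R) (E Z : set R).
Local Notation mu := (@lebesgue_measure R).

Lemma sdlin_derivE c G W psi : dderiv (sdlin c G W) psi = c * dderiv G psi + dderiv W psi.
Proof. by rewrite sdlin_dderiv. Qed.

(** Both [G] and [e - G] have nonnegative values, hence are nonnegative distributions, and [chi] is
    a difference of two nonnegative test functions. As [M] depends on [chi] only, uniform closeness
    of values becomes convergence of distributions. *)
Lemma small_values chi : test_function chi -> exists2 M : R, 0 <= M & forall G e,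
  (forall x, exists2 gam : R, 0 <= gam <= e & point_value G x gam) -> `|G chi| <= e * M.
Proof.
move=> tc; have /test_functionP[sc [r r0 cr]] := tc.
have [C C0 HC] := @smooth_bounded R chi 0 r sc.
pose xi := plateau r; have txi : test_function xi := test_plateau r0.
have tx := test_functionL C txi tc.
have xi0 y : 0 <= xi y by exact: bump_ge0.
have p0 y : 0 <= C * xi y + chi y.
  have [y0|/cr yr] := eqVneq (chi y) 0; first by rewrite y0 addr0 mulr_ge0.
  rewrite /xi plateau1// mulr1; have := HC 0%N y isT yr; rewrite derive1n0 ler_norml; lra.
pose I1 := \int[mu]_y (C * xi y + chi y); pose I2 := \int[mu]_y xi y.
have I10 : 0 <= I1 by exact: integral_test_ge0.
have I20 : 0 <= I2 by exact: integral_test_ge0.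
exists (I1 + C * I2) => [|G e HG]; first by rewrite addr_ge0// mulr_ge0.
have pG : nonneg_distr G.
  by apply: values_nonneg_distr => x; have [g /andP[g0 _] Hg] := HG x; exists g.
have pG' : nonneg_distr (sdlin (-1) G (sconst e)).
  apply: values_nonneg_distr => x; have [g /andP[_ ge] Hg] := HG x.
  exists (-1 * g + e); first by lra.
  exact: (point_value_lin (-1) Hg (point_value_const e x)).
have h1 := pG _ tx p0; have h2 := pG' _ tx p0.
have h3 := pG _ txi xi0; have h4 := pG' _ txi xi0.
rewrite /sdlin/= -/I1 in h2; rewrite /sdlin/= -/I2 in h4.
have E1 : G (fun y => C * xi y + chi y) = C * G xi + G chi by rewrite spair_linear.
rewrite E1 in h1 h2.
have h5 := mulr_ge0 C0 h3; have h6 := mulr_ge0 C0 h4.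
move: h1 h2 h4 h5 h6; move: (G xi) (G chi) => p q h1 h2 h4 h5 h6.
rewrite ler_norml; apply/andP; split; nra.
Qed.

Variables (a b : R) (f : R -> \bar R) (F : sdistr R).
Hypotheses (hab : a <= b) (hf : dist_integrable a b f).
Hypothesis hF : lojasiewicz_assoc (indefinite_integral a b f) F.
Local Notation Fv := (indefinite_integral a b f).

Lemma supported_eq u U (K : set R) : supported_in u K -> eq_sdistr (dderiv U) u ->
  supported_in (dderiv U) K.
Proof. by move=> su eU psi tp pK; rewrite eU// su. Qed.

Lemma indefinite_between u U v V x (gam del : R) : major_pair a b f u U ->
  minor_pair a b f v V -> point_value U x gam -> point_value V x del ->
  del <= Fv x <= gam.
Proof.
move=> mU mV Ux Vx; have [su lU eU Ua _] := mU; have [sv lV eV Va _] := mV.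
have sU := supported_eq su eU; have sV := supported_eq sv eV.
rewrite /Fv /indefinite_integral; have [xa|ax] := ltP x a.
  have h := values_constant sU (ltW xa) (or_introl (lexx a)) Ux Ua.
  have h' := values_constant sV (ltW xa) (or_introl (lexx a)) Vx Va.
  by rewrite h h' lexx.
have [xb|bx] := leP x b.
  by apply: (dist_integral_between hab _ mU mV Ux Vx); rewrite ax.
have [g Ub] := lU b; have [d Vb] := lV b.
rewrite -(values_constant sU (ltW bx) (or_intror (lexx b)) Ub Ux).
rewrite -(values_constant sV (ltW bx) (or_intror (lexx b)) Vb Vx).
by apply: (dist_integral_between hab _ mU mV Ub Vb); rewrite hab lexx.
Qed.

Lemma approx_values e : 0 < e -> exists u U v V (gam del : R),
  [/\ major_pair a b f u U, minor_pair a b f v V, point_value U b gam,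
      point_value V b del & gam - del <= e].
Proof.
move=> e0; have [[u0 [U0 mU0]] [v0 [V0 mV0]] Heq] := hf.
have [_ lU0 _ _ _] := mU0; have [_ lV0 _ _ _] := mV0.
have [g0 Ug0] := lU0 b; have [d0 Vd0] := lV0 b.
have h1 : (ereal_inf (major_values a b f) <= g0%:E)%E.
  by apply: ereal_inf_lbound; exists g0 => //; exists u0, U0.
have h2 : (d0%:E <= ereal_sup (minor_values a b f))%E.
  by apply: ereal_sup_ubound; exists d0 => //; exists v0, V0.
have [I IE] : exists I : R, ereal_inf (major_values a b f) = I%:E.
  rewrite Heq in h2; move: h1 h2; case: ereal_inf => //= l; by exists l.
have e20 : 0 < e / 2 by rewrite divr_gt0.
have : (ereal_inf (major_values a b f) < (I + e / 2)%:E)%E.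
  by rewrite IE lte_fin ltrDl.
move=> /ereal_inf_lt[_ [gam [u [U [mU Ug]]] <-] gI].
have : ((I - e / 2)%:E < ereal_sup (minor_values a b f))%E.
  by rewrite Heq IE lte_fin; lra.
move=> /ereal_sup_gt[_ [del [v [V [mV Vd]]] <-] dI].
exists u, U, v, V, gam, del; split => //.
by move: gI dI; rewrite !lte_fin; lra.
Qed.

Lemma major_minor_value u U v V x (gam del g d e : R) : major_pair a b f u U ->
  minor_pair a b f v V -> point_value U b gam -> point_value V b del -> gam - del <= e ->
  point_value U x g -> point_value V x d -> g - d <= e.
Proof.
move=> mU mV Ub Vb ge Ux Vx; have [su lU eU Ua _] := mU; have [sv lV eV Va _] := mV.
have sU := supported_eq su eU; have sV := supported_eq sv eV.
have pos : nonneg_distr (dderiv (sdlin (-1) V U)).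
  move=> psi tp p0; have := major_minor_nonneg hab mU mV tp p0.
  by rewrite sdlin_derivE /sdlin/= -eU// -eV.
have [xb|/ltW bx] := leP x b.
  have := values_le pos xb (point_value_lin (-1) Vx Ux) (point_value_lin (-1) Vb Ub); lra.
rewrite -(values_constant sU bx (or_intror (lexx b)) Ub Ux).
by rewrite -(values_constant sV bx (or_intror (lexx b)) Vb Vx).
Qed.

Lemma indefinite_close u U v V (gam del e : R) : major_pair a b f u U ->
  minor_pair a b f v V -> point_value U b gam -> point_value V b del -> gam - del <= e ->
  (forall x, exists2 g : R, 0 <= g <= e & point_value (sdlin (-1) F U) x g) /\
  (forall x, exists2 g : R, 0 <= g <= e & point_value (sdlin (-1) V F) x g).
Proof.
move=> mU mV Ub Vb ge; have [_ lU _ _ _] := mU; have [_ lV _ _ _] := mV.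
split=> x; have [g Ux] := lU x; have [d Vx] := lV x;
  have := indefinite_between mU mV Ux Vx; have := major_minor_value mU mV Ub Vb ge Ux Vx.
  move=> h1 h2; exists (-1 * Fv x + g); first lra.
  exact: (point_value_lin (-1) (@hF x) Ux).
move=> h1 h2; exists (-1 * d + Fv x); first lra.
exact: (point_value_lin (-1) Vx (@hF x)).
Qed.

(** [F] is a limit of primitives [V] of minor pairs, whose derivatives are supported in [[a, b]]. *)
Lemma indefinite_supported : supported_in (dderiv F) `[a, b].
Proof.
move=> psi tp pab; apply/eqP; rewrite -normr_le0; apply/ler_addgt0Pr => e e0; rewrite add0r.
have tp' := test_function_derive1 tp; have [M M0 HM] := small_values tp'.
have M1 : 0 < M + 1 by rewrite ltr_wpDl.
have e10 : 0 < e / (M + 1) by rewrite divr_gt0.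
have [u [U [v [V [gam [del [mU mV Ub Vb ge]]]]]]] := approx_values e10.
have [_ H] := indefinite_close mU mV Ub Vb ge.
have := HM _ _ H; have [sv _ eV _ _] := mV.
have V0 : dderiv V psi = 0 := supported_eq sv eV tp pab.
move: V0; rewrite /dderiv/= /sdlin/= => /eqP; rewrite oppr_eq0 => /eqP ->.
rewrite mulr0 add0r normrN => H1; apply: (le_trans H1).
by rewrite mulrAC ler_pdivrMr// ler_pM2l// lerDl.
Qed.

(** For the sign, [u - v1 >= 0] passes to the limit along minor pairs whose primitives approach [F],
    and symmetrically for [v]. For the mass, the values of [U - F] and [F - V] lie in [[0, e]], so
    their increments are at most [e]. *)
Lemma approx_pairs e : 0 < e -> exists u U v V,
  [/\ major_pair a b f u U, minor_pair a b f v V,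
    nonneg_distr (sdlin (-1) (dderiv F) u) /\ nonneg_distr (sdlin (-1) v (dderiv F)) &
    forall psi, test_function psi -> (forall y, psi y <= 1) ->
      sdlin (-1) (dderiv F) u psi <= e /\ sdlin (-1) v (dderiv F) psi <= e].
Proof.
move=> e0; have [u [U [v [V [gam [del [mU mV Ub Vb ge]]]]]]] := approx_values e0.
exists u, U, v, V.
have [_ _ eU _ _] := mU; have [_ _ eV _ _] := mV.
have small (h M : R) : 0 < h -> 0 <= M -> h / (M + 1) * M <= h.
  by move=> h0 M0; rewrite mulrAC ler_pdivrMr ?ltr_wpDl// ler_pM2l// lerDl.
have P1 : nonneg_distr (sdlin (-1) (dderiv F) u).
  move=> psi tp p0; apply/ler_addgt0Pr => h h0; rewrite -lerBlDr sub0r.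
  have tp' := test_function_derive1 tp; have [M M0 HM] := small_values tp'.
  have h1 : 0 < h / (M + 1) by rewrite divr_gt0// ltr_wpDl.
  have [u1 [U1 [v1 [V1 [g1 [d1 [mU1 mV1 Ub1 Vb1 ge1]]]]]]] := approx_values h1.
  have [_ H] := indefinite_close mU1 mV1 Ub1 Vb1 ge1.
  have := le_trans (HM _ _ H) (small h M h0 M0).
  have := major_minor_nonneg hab mU mV1 tp p0; have [_ _ eV1 _ _] := mV1.
  by rewrite /sdlin/= -eV1// /dderiv/= ler_norml; lra.
have P2 : nonneg_distr (sdlin (-1) v (dderiv F)).
  move=> psi tp p0; apply/ler_addgt0Pr => h h0; rewrite -lerBlDr sub0r.
  have tp' := test_function_derive1 tp; have [M M0 HM] := small_values tp'.
  have h1 : 0 < h / (M + 1) by rewrite divr_gt0// ltr_wpDl.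
  have [u1 [U1 [v1 [V1 [g1 [d1 [mU1 mV1 Ub1 Vb1 ge1]]]]]]] := approx_values h1.
  have [H _] := indefinite_close mU1 mV1 Ub1 Vb1 ge1.
  have := le_trans (HM _ _ H) (small h M h0 M0).
  have := major_minor_nonneg hab mU1 mV tp p0; have [_ _ eU1 _ _] := mU1.
  by rewrite /sdlin/= -eU1// /dderiv/= ler_norml; lra.
split => // psi tp p1.
have [H1 H2] := indefinite_close mU mV Ub Vb ge.
have /test_functionP[_ [r r0 pr]] := tp.
have rr : - (r + 1) <= r by lra.
have ps y : psi y != 0 -> - (r + 1) + 1 <= y <= r by move=> /pr; rewrite ler_norml; lra.
have E1 phi : test_function phi -> dderiv (sdlin (-1) F U) phi = sdlin (-1) (dderiv F) u phi.
  by move=> tphi; rewrite sdlin_derivE eU.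
have E2 phi : test_function phi -> dderiv (sdlin (-1) V F) phi = sdlin (-1) v (dderiv F) phi.
  by move=> tphi; rewrite sdlin_derivE eV.
have Q1 : nonneg_distr (dderiv (sdlin (-1) F U)) by move=> phi tphi p0; rewrite E1//; exact: P1.
have Q2 : nonneg_distr (dderiv (sdlin (-1) V F)) by move=> phi tphi p0; rewrite E2//; exact: P2.
rewrite -E1// -E2//; split.
  have [g1 b1 v1] := H1 (- (r + 1)); have [g2 b2 v2] := H1 r.
  by have := mass_bound Q1 rr ltr01 v1 v2 tp p1 ps; lra.
have [g1 b1 v1] := H2 (- (r + 1)); have [g2 b2 v2] := H2 r.
by have := mass_bound Q2 rr ltr01 v1 v2 tp p1 ps; lra.
Qed.

End indefinite.

(** * Point values almost everywhere *)

Section weak_type.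
Variable R : realType.
Implicit Types (psi phi chi : R -> R) (x y t z r e s : R) (m n k N j : nat).
Implicit Types (P : sdistr R).
Local Notation mu := (@lebesgue_measure R).

Definition bump_at x r : R -> R := fun y => bumpf ((y - x) / r).

Lemma test_bump_at x r : 0 < r -> test_function (bump_at x r).
Proof. by move=> r0; apply: test_function_dil; [rewrite gt_eqF|exact: test_function_bump]. Qed.

Lemma bump_at_supp x r y : 0 < r -> bump_at x r y != 0 -> `|y - x| < r.
Proof.
move=> r0; rewrite ltNge; apply: contraNN => h; apply/eqP; rewrite /bump_at bump0//.
by rewrite normrM normfV (gtr0_norm r0) ler_pdivlMr// mul1r.
Qed.

(** Vitali's covering lemma selects disjoint balls whose fivefold enlargements cover. The bumps on
    the selected balls add up to at most 1, so [P] gives them at most [e] in total, while each has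
    more than [l] times its radius; an enlarged ball of radius [5 r] has length [10 r]. *)
Lemma weak_type P (e l : R) : nonneg_distr P -> 0 < l ->
  (forall psi, test_function psi -> (forall y, psi y <= 1) -> P psi <= e) ->
  exists B : set R, [/\ measurable B, (mu B <= (10 / l * e)%:E)%E &
    forall x r, 0 < r <= 1 -> l * r < P (bump_at x r) -> B x].
Proof.
move=> pP l0 Pe.
(* The radius 1 is a default that makes every index a genuine ball; indices in [V] have a positive
   radius. *)
pose rad (i : R * R) : R := if 0 < i.2 then i.2 else 1.
have rad0 i : 0 < rad i by rewrite /rad; case: ifPn.
pose Bl (i : R * R) : set R := ball i.1 (rad i).
pose V := [set i : R * R | 0 < i.2 <= 1 /\ l * i.2 < P (bump_at i.1 i.2)].
have radB i : (radius (Bl i))%:num = rad i by rewrite /Bl radius_ball_num// ltW.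
have [||D [cD DV tD VD]] := @vitali_lemma_infinite_cover R _ Bl V 1 (fun i => is_ball_ball _ _).
- by move=> i; rewrite radB.
- by move=> i [/andP[i0 i1] _]; rewrite radB /rad i0.
have [ix injx] : exists i : R * R -> nat, {in D &, injective i} by apply/countable_injP.
(* The countable subfamily is numbered through an injection into [nat]; numbers that are not
   attained carry the empty set and the zero function. *)
pose valid n := `[< exists i, D i /\ ix i = n >].
pose jn n : R * R := xget (0, 1) [set i | D i /\ ix i = n].
have jnP n : valid n -> D (jn n) /\ ix (jn n) = n.
  by move=> /asboolP H; rewrite /jn; case: xgetP => [y _ //|Hn]; case: H => i /Hn.
have jr n : valid n -> rad (jn n) = (jn n).2 /\ 0 < (jn n).2.
  by move=> /jnP[/DV[/andP[i0 _] _] _]; rewrite /rad i0.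
pose C n : set R := if valid n then closed_ball (jn n).1 (5 * rad (jn n)) else set0.
pose xi n : R -> R := if valid n then bump_at (jn n).1 (jn n).2 else cst 0.
have txi n : test_function (xi n).
  rewrite /xi; case: ifPn => [/jr[_ j0]|_]; [exact: test_bump_at|exact: test_function0].
have xi0 n y : 0 <= xi n y by rewrite /xi; case: ifPn => // _; exact: bump_ge0.
have xi1 n y : xi n y <= 1 by rewrite /xi; case: ifPn => _; [exact: bump_le1|exact: ler01].
pose S N y := \sum_(n < N) xi n y.
have SS N : S N.+1 = (fun y => S N y + xi N y).
  by apply/funext => y; rewrite /S big_ord_recr.
have tS N : test_function (S N).
  elim: N => [|N IH]; last by rewrite SS; exact: test_functionD.
  have -> : S 0%N = cst 0 by apply/funext => y; rewrite /S big_ord0.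
  exact: test_function0.
have S0 N y : S N y != 0 -> exists2 n, (n < N)%N & xi n y != 0.
  elim: N => [|N IH]; first by rewrite /S big_ord0 eqxx.
  rewrite SS; have [->|xy _] := eqVneq (xi N y) 0; last by exists N.
  by rewrite addr0 => /IH[n nN xn]; exists n => //; exact: ltnW.
(* The selected balls are disjoint, so at most one bump is nonzero at a point and the sums stay
   below 1. *)
have sep n m y : xi n y != 0 -> xi m y != 0 -> n = m.
  rewrite /xi; case: ifPn => [vn|_]; last by rewrite eqxx.
  case: ifPn => [vm|_]; last by rewrite eqxx.
  have [rn n0] := jr n vn; have [rm m0] := jr m vm.
  move=> /(bump_at_supp n0) yn /(bump_at_supp m0) ym.
  have [Dn <-] := jnP n vn; have [Dm <-] := jnP m vm; congr ix.
  apply: tD => //; exists y; split; apply: subset_closure.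
    by rewrite /Bl /ball/= distrC rn.
  by rewrite /Bl /ball/= distrC rm.
have S1 N y : S N y <= 1.
  elim: N => [|N IH]; first by rewrite /S big_ord0 ler01.
  rewrite SS; have [->|xy] := eqVneq (xi N y) 0; first by rewrite addr0.
  have [->|/S0[n nN xn]] := eqVneq (S N y) 0; first by rewrite add0r.
  by move: nN; rewrite (sep _ _ _ xn xy) ltnn.
pose c n : R := if valid n then 10 * (jn n).2 else 0.
have cP n : c n <= 10 / l * P (xi n).
  rewrite /c /xi; case: ifPn => [/jnP[/DV[_ H] _]|_]; last by rewrite sdistr0 mulr0.
  rewrite -mulrA ler_pM2l// mulrC ler_pdivlMr// mulrC; exact: ltW.
have csum N : \sum_(n < N) c n <= 10 / l * e.
  apply: (@le_trans _ _ (10 / l * P (S N))); last first.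
    by rewrite ler_pM2l ?divr_gt0//; apply: Pe.
  elim: N => [|N IH].
    rewrite big_ord0 mulr_ge0 ?divr_ge0 ?(ltW l0)//; apply: pP => // y.
    by rewrite /S big_ord0.
  rewrite big_ord_recr SS (sdistrD P (tS N) (txi N)) mulrDr; apply: lerD => //.
have mC n : measurable (C n).
  by rewrite /C; case: ifPn => _; [exact: measurable_closed_ball|exact: measurable0].
have muC n : mu (C n) = (c n)%:E.
  rewrite /C /c; case: ifPn => [/jr[-> j0]|_]; last by rewrite measure0.
  rewrite lebesgue_measure_closed_ball ?mulr_ge0 ?(ltW j0)//.
  by congr EFin; rewrite -mulr_natr; ring.
have c0 n : 0 <= c n.
  by rewrite /c; case: ifPn => // /jr[_ j0]; rewrite mulr_ge0// ltW.
have mB : measurable (\bigcup_n C n) by apply: bigcup_measurable => n _.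
exists (\bigcup_n C n); split => //.
- apply: (@le_trans _ _ (\sum_(0 <= n <oo) mu (C n))%E).
    exact: measure_sigma_subadditive.
  apply: lime_le; first by apply: is_cvg_nneseries => n _ _; exact: measure_ge0.
  apply: nearW => N; rewrite (eq_bigr (fun n => (c n)%:E)) => [|n _]; last exact: muC.
  by rewrite sumEFin lee_fin big_mkord.
move=> x r r01 Hx.
have Vx : V (x, r) by split.
have [] := VD x; first by exists (x, r) => //=; apply: subset_closure; exact: ballxx.
move=> i Di /= xi'; exists (ix i) => //.
have vi : valid (ix i) by apply/asboolP; exists i.
have [Dj ej] := jnP _ vi.
have ji : jn (ix i) = i by apply: injx => //; rewrite inE.
rewrite /C vi ji; move: xi'; rewrite /Bl scale_ballE//.
Qed.

End weak_type.

(** * Squeezing the derivative of the indefinite integral *)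

Section point_values.
Variable R : realType.
Implicit Types (psi phi chi : R -> R) (x y c t z r h s : R) (m n k N j : nat).
Implicit Types (u v U V G : sdistr R) (E Z : set R).
Local Notation mu := (@lebesgue_measure R).
Variables (a b : R) (f : R -> \bar R).

Lemma cpair_test u psi : supported_in u `[a, b] -> test_function psi -> cpair u psi = u psi.
Proof.
move=> su /[dup] tp /test_functionP[sp [s s0 ps]].
have [r r0 [ra br]] := exists_radius a b.
rewrite (@cpair_cut R u a b (r + s) psi su) ?addr_gt0//; [|lra|lra].
by rewrite cut_on ?addr_gt0// => y /ps; lra.
Qed.

(** The last clause bounds a centred maximal function of the two measures [u - G] and [G - v]; the
    distributions [u] and [v] may change with [n]. *)
Definition sandwiched G n x := exists u v,
  [/\ supported_in u `[a, b], supported_in v `[a, b],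
      (forall phi, T0 phi -> (f x <= lower_value u phi x)%E /\ (upper_value v phi x <= f x)%E),
      (forall phi, T1 phi -> (-oo < lower_value u phi x)%E /\ (upper_value v phi x < +oo)%E) &
      [/\ nonneg_distr (sdlin (-1) G u), nonneg_distr (sdlin (-1) v G) &
        forall r, 0 < r <= 1 -> sdlin (-1) G u (bump_at x r) <= 2 ^- n * r /\
          sdlin (-1) v G (bump_at x r) <= 2 ^- n * r]].

(** The dilate of [phi] is at most [|t|^-1 K] times a bump of radius [2 r |t|], whose mass is at
    most [2 l r |t|]; the factors [|t|] cancel. The choice of [d] keeps that radius at most 1. *)
Lemma dilate_bound phi : test_function phi -> exists M d : R, [/\ 0 <= M, 0 < d &
  forall G l x, nonneg_distr G -> (forall r, 0 < r <= 1 -> G (bump_at x r) <= l * r) ->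
    forall t, t != 0 -> `|t| <= d -> G (dilate phi x t) <= M * l].
Proof.
move=> /[dup] tp /test_functionP[sp [r r0 pr]].
have [K K0 HK] := @smooth_bounded R phi 0 r sp.
exists (K * (2 * r)), (2 * r)^-1; split; rewrite ?invr_gt0 ?mulr_gt0//.
  by rewrite mulr_ge0// mulr_ge0// ltW.
move=> G l x pG Gl t t0 td; have nt : 0 < `|t| by rewrite normr_gt0.
pose q := 2 * r * `|t|.
have q0 : 0 < q by rewrite !mulr_gt0.
have q1 : q <= 1 by rewrite /q mulrC -ler_pdivlMr ?mulr_gt0// div1r.
have tb := test_bump_at x q0.
have td' := test_function_dilate x t0 tp.
have := pG _ (test_functionL (- 1) td' (test_functionZ (`|t|^-1 * K) tb)).
rewrite (spair_linear G _ td' (test_functionZ _ tb)) (sdistrZ G _ tb) => H.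
have H1 : 0 <= -1 * G (dilate phi x t) + `|t|^-1 * K * G (bump_at x q).
  apply: H => y; have b0 : 0 <= bump_at x q y by exact: bump_ge0.
  have [->|dy] := eqVneq (dilate phi x t y) 0.
    by rewrite mulr0 add0r mulr_ge0// mulr_ge0// invr_ge0.
  move: dy; rewrite /dilate mulf_eq0 negb_or => /andP[_ /pr yr].
  rewrite /bump_at bump1; last first.
    move: yr; rewrite !normrM !normfV (gtr0_norm q0) !ler_pdivrMr// /q; lra.
  rewrite mulN1r mulr1 addrC subr_ge0 ler_pM2l ?invr_gt0//.
  by have := HK 0%N _ isT yr; rewrite derive1n0 ler_norml => /andP[].
have H2 : `|t|^-1 * K * G (bump_at x q) <= `|t|^-1 * K * (l * q).
  by apply: ler_wpM2l; [rewrite mulr_ge0// invr_ge0|apply: Gl; rewrite q0].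
have E1 : `|t|^-1 * K * (l * q) = K * (2 * r) * l by rewrite /q; field; rewrite normr_eq0.
rewrite E1 in H2; lra.
Qed.

Section at_point.
Variables (G : sdistr R) (x : R) (N0 : nat).
Hypothesis HG : forall n, (N0 <= n)%N -> sandwiched G n x.

Lemma sandwich phi h : test_function phi -> 0 < h ->
  exists u v (d : R), [/\ supported_in u `[a, b] /\ supported_in v `[a, b], 0 < d,
    (forall phi, T0 phi -> (f x <= lower_value u phi x)%E /\ (upper_value v phi x <= f x)%E),
    (forall phi, T1 phi -> (-oo < lower_value u phi x)%E /\ (upper_value v phi x < +oo)%E) &
    forall t, t != 0 -> `|t| <= d -> u (dilate phi x t) - h <= G (dilate phi x t) /\
        G (dilate phi x t) <= v (dilate phi x t) + h].
Proof.
move=> tp h0; have [M [d [M0 d0 HM]]] := dilate_bound tp.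
(* For this [n] the masses left between the pairs and [G] cost at most [h]. *)
pose n := (N0 + Num.bound (M / h))%N.
have Mn : M * 2 ^- n <= h.
  rewrite ler_pdivrMr ?exprn_gt0// mulrC -ler_pdivrMr//.
  have Mh : 0 <= M / h by rewrite divr_ge0// ltW.
  apply: (le_trans (ltW (archi_boundP Mh))); rewrite -natrX ler_nat.
  apply: (leq_trans (leq_addl N0 _)); exact: ltnW (ltn_expl _ _).
have [u [v [su sv H1 H2 [P1 P2 H3]]]] := HG (leq_addr _ _ : (N0 <= n)%N).
exists u, v, d; split => // t t0 td.
have h1 := HM _ _ x P1 (fun r r01 => (H3 r r01).1) t t0 td.
have h2 := HM _ _ x P2 (fun r r01 => (H3 r r01).2) t t0 td.
by move: h1 h2; rewrite /sdlin/=; split; lra.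
Qed.

(** If [f x] were [+oo], the lower value of [u] would be infinite while the upper value of [v] is
    not; but the two pairings differ by at most 2 once [h = 1]. The case [-oo] is symmetric. *)
Lemma finite_value : exists gam : R, f x = gam%:E.
Proof.
have tb : test_function (@bumpn R) := test_functionZ _ (test_function_bump R).
have [u [v [d [[su sv] d0 H0 H1 H]]]] := sandwich tb ltr01.
have T := T1_bumpn R.
have cu t : t != 0 -> cpair u (dilate (@bumpn R) x t) = u (dilate (@bumpn R) x t).
  by move=> t0; apply: cpair_test => //; exact: test_function_dilate.
have cv t : t != 0 -> cpair v (dilate (@bumpn R) x t) = v (dilate (@bumpn R) x t).
  by move=> t0; apply: cpair_test => //; exact: test_function_dilate.
have contra (p q : R) : (p%:E < lower_value u (@bumpn R) x)%E ->
    (upper_value v (@bumpn R) x < q%:E)%E -> p <= q + 2.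
  move=> /einf_gt n1 /esup_lt n2.
  have [t [t0 td h1 h2]] : exists t, [/\ 0 < t, t <= d,
      p < cpair u (dilate (@bumpn R) x t) & cpair v (dilate (@bumpn R) x t) < q].
    apply: (@filter_ex _ (0^'+ : set_system R)); near=> t; split; near: t.
    - exact: nbhs_right_gt.
    - exact: nbhs_right_le.
    - exact: n1.
    - exact: n2.
  have tn : t != 0 by rewrite gt_eqF.
  have nt : `|t| <= d by rewrite gtr0_norm.
  by have := H t tn nt; rewrite -cu// -cv//; lra.
have [l1 l2] := H0 _ T.1; have [l3 l4] := H1 _ T.
case E : (f x) => [gam| |]; first by exists gam.
  have [k /andP[k1 _]] := ereal_lt_dense l4.
  move: l1; rewrite E leye_eq => /eqP lu.
  by have := contra (k + 3) k; rewrite lu ltry => /(_ isT k1); lra.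
have [k /andP[_ k1]] := ereal_lt_dense l3.
move: l2; rewrite E leeNy_eq => /eqP lv.
by have := contra k (k - 3) k1; rewrite lv ltNyr => /(_ isT); lra.
Unshelve. all: by end_near.
Qed.

Variable gam : R.
Hypothesis fx : f x = gam%:E.

Lemma right_value phi h : test_function phi -> (forall y, 0 <= phi y) ->
  0 < \int[mu]_y phi y -> 0 < h ->
  exists2 d : R, 0 < d & forall t, 0 < t < d ->
    `|G (dilate phi x t) - gam * \int[mu]_y phi y| <= h.
Proof.
move=> tp p0 I0 h0; pose I := \int[mu]_y phi y.
have h20 : 0 < h / 2 by rewrite divr_gt0.
have [u [v [d [[su sv] d0 H0 _ H]]]] := sandwich tp h20.
have T := test_T0 tp p0 I0; rewrite -/I in I0 T *.
pose pn := fun y => I^-1 * phi y; rewrite -/pn in T.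
have In : I != 0 by rewrite gt_eqF.
have dE w t : supported_in w `[a, b] -> t != 0 ->
    cpair w (dilate pn x t) = I^-1 * w (dilate phi x t).
  move=> sw t0; have td := test_function_dilate x t0 tp.
  have -> : dilate pn x t = (fun y => I^-1 * dilate phi x t y).
    by apply/funext => y; rewrite /dilate /pn; ring.
  by rewrite (cpair_test sw (test_functionZ _ td)) sdistrZ.
have [l1 l2] := H0 _ T.
have hI : 0 < h / 2 / I by rewrite divr_gt0.
have n1 : \forall t \near 0^'+, gam - h / 2 / I < cpair u (dilate pn x t).
  by apply: einf_gt; apply: lt_le_trans l1; rewrite fx lte_fin ltrBlDr ltrDl.
have n2 : \forall t \near 0^'+, cpair v (dilate pn x t) < gam + h / 2 / I.
  by apply: esup_lt; apply: le_lt_trans l2 _; rewrite fx lte_fin ltrDl.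
apply/near_0_rightP; near=> t.
have t0 : 0 < t by near: t; exact: nbhs_right_gt.
have tn : t != 0 by rewrite gt_eqF.
have td : `|t| <= d by rewrite gtr0_norm//; near: t; exact: nbhs_right_le.
have h1 : gam - h / 2 / I < cpair u (dilate pn x t) by near: t.
have h2 : cpair v (dilate pn x t) < gam + h / 2 / I by near: t.
rewrite (dE u t su tn) -(ltr_pM2l I0) mulrA mulfV// mul1r mulrBr in h1.
rewrite (dE v t sv tn) -(ltr_pM2l I0) mulrA mulfV// mul1r mulrDr in h2.
have E1 : I * (h / 2 / I) = h / 2 by field.
rewrite E1 in h1 h2; have := H t tn td.
by rewrite ler_norml [gam * I]mulrC; lra.
Unshelve. all: by end_near.
Qed.

Lemma dilateN phi t : dilate phi x t = dilate (fun y => phi (- y)) x (- t).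
Proof. by apply/funext => y; rewrite /dilate normrN invrN mulrN opprK. Qed.

(** Lower and upper values only concern [t > 0]. A dilation by a negative [t] is a dilation by [- t]
    of the reflected function, which is again nonnegative with the same integral. *)
Lemma two_sided_value phi : test_function phi -> (forall y, 0 <= phi y) ->
  0 < \int[mu]_y phi y ->
  G (dilate phi x t) @[t --> 0^'] --> gam * \int[mu]_y phi y.
Proof.
move=> tp p0 I0; apply/cvgrPdist_le => h h0.
have NE : (fun y => phi (- y)) = dilate phi 0 (-1).
  by apply/funext => y; rewrite /dilate normrN1 invr1 mul1r subr0 invrN invr1 mulrN1.
have n1 : -1 != 0 :> R by rewrite oppr_eq0 oner_neq0.
have tpN : test_function (fun y => phi (- y)) by rewrite NE; exact: test_function_dilate.
have IN : \int[mu]_y phi (- y) = \int[mu]_y phi y by rewrite NE integral_dilate.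
have I0' : 0 < \int[mu]_y phi (- y) by rewrite IN.
have [d1 d10 H1] := right_value tp p0 I0 h0.
have [d2 d20 H2] := right_value tpN (fun y => p0 (- y)) I0' h0.
near=> t.
have tn : t != 0 by near: t; exact: nbhs_dnbhs_neq.
have t1 : `|t| < d1 by near: t; exact: dnbhs0_lt.
have t2 : `|t| < d2 by near: t; exact: dnbhs0_lt.
rewrite distrC; case: (ltgtP t 0) tn => // t0 _.
  rewrite dilateN -IN; apply: H2; rewrite oppr_gt0 t0/=.
  by rewrite -(ltr0_norm t0).
by apply: H1; rewrite t0 /= -(gtr0_norm t0).
Unshelve. all: by end_near.
Qed.

Lemma sandwiched_point_value : point_value G x gam.
Proof.
move=> phi /[dup] tp /test_functionP[sp [r r0 pr]].
have [K K0 HK] := @smooth_bounded R phi 0 r sp.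
pose xi := plateau r; have txi : test_function xi := test_plateau r0.
have xi0 y : 0 <= xi y by exact: bump_ge0.
have Ixi : 0 < \int[mu]_y xi y.
  have r20 : 0 < 2 * r by rewrite mulr_gt0.
  have -> : xi = (fun y => (2 * r) * dilate (@bumpf R) 0 (2 * r) y).
    by apply/funext => y; rewrite /xi /plateau /dilate (gtr0_norm r20); field; rewrite gt_eqF.
  have r2n : 2 * r != 0 by rewrite gt_eqF.
  rewrite integral_testZ; last exact: test_function_dilate r2n (test_function_bump R).
  rewrite (integral_dilate 0 (test_function_bump R) r2n).
  exact: mulr_gt0 r20 (integral_bump_gt0 R).
(* A general [phi] is the difference of [psi] and [(K + 1) * xi], both handled by the nonnegative
   case; the additional 1 gives [psi] a positive integral. *)
pose psi y := (K + 1) * xi y + phi y.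
have tpsi : test_function psi := test_functionL (K + 1) txi tp.
have psi1 y : 0 <= psi y - xi y.
  rewrite /psi; have [->|/pr yr] := eqVneq (phi y) 0.
    by have := mulr_ge0 K0 (xi0 y); lra.
  rewrite /xi plateau1//; have := HK 0%N y isT yr; rewrite derive1n0 ler_norml; lra.
have psi0 y : 0 <= psi y by have := psi1 y; have := xi0 y; lra.
have Ipsi : 0 < \int[mu]_y psi y.
  apply: (lt_le_trans Ixi); rewrite -subr_ge0.
  have -> : \int[mu]_y psi y - \int[mu]_y xi y = \int[mu]_y (-1 * xi y + psi y).
    by rewrite (@integral_testL R (-1) xi psi txi tpsi) mulN1r addrC.
  by apply: integral_test_ge0 => [|y]; [exact: test_functionL|have := psi1 y; lra].
have c1 := two_sided_value tpsi psi0 Ipsi.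
have c2 := two_sided_value txi xi0 Ixi.
have E1 : \int[mu]_y phi y = - (K + 1) * \int[mu]_y xi y + \int[mu]_y psi y.
  rewrite -(@integral_testL R (- (K + 1)) xi psi txi tpsi); congr Rintegral.
  by apply/funext => y; rewrite /psi; ring.
have -> : gam * \int[mu]_y phi y =
    - (K + 1) * (gam * \int[mu]_y xi y) + gam * \int[mu]_y psi y by rewrite E1; ring.
have c3 : - (K + 1) * G (dilate xi x t) + G (dilate psi x t) @[t --> 0^'] -->
    - (K + 1) * (gam * \int[mu]_y xi y) + gam * \int[mu]_y psi y.
  by apply: cvgD => //; apply: cvgMr.
apply: cvg_trans c3; apply: near_eq_cvg; near=> t.
have tn : t != 0 by near: t; exact: nbhs_dnbhs_neq.
rewrite -spair_linear; [|exact: test_function_dilate..].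
by congr (spair G); apply/funext => y; rewrite /dilate /psi; ring.
Unshelve. all: by end_near.
Qed.

End at_point.

Variable F : sdistr R.
Hypotheses (hab : a <= b) (hf : dist_integrable a b f).
Hypothesis hF : lojasiewicz_assoc (indefinite_integral a b f) F.

(** Mass [4^-n] against the threshold [2^-n] leaves a set of measure at most [10 * 2^-n] for each of
    the two measures, which is summable in [n]. *)
Lemma exceptional_set n : exists BE : set R * set R,
  [/\ measurable BE.1, (mu BE.1 <= (20 * 2 ^- n)%:E)%E, mu.-negligible BE.2 &
    forall x, x \in `[a, b] -> ~ BE.1 x -> ~ BE.2 x -> sandwiched (dderiv F) n x].
Proof.
have e0 : 0 < 4 ^- n :> R by rewrite invr_gt0 exprn_gt0.
have l0 : 0 < 2 ^- n :> R by rewrite invr_gt0 exprn_gt0.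
have [u [U [v [V [mU mV [P1 P2] H]]]]] := approx_pairs hab hf hF e0.
have [B1 [mB1 B1e HB1]] := weak_type P1 l0 (fun psi tp p1 => (H psi tp p1).1).
have [B2 [mB2 B2e HB2]] := weak_type P2 l0 (fun psi tp p1 => (H psi tp p1).2).
have [su _ _ _ [E1 [Z1 [cE1 nZ1 uZ uE]]]] := mU.
have [sv _ _ _ [E2 [Z2 [cE2 nZ2 vZ vE]]]] := mV.
exists (B1 `|` B2, (E1 `|` E2) `|` (Z1 `|` Z2)); split => /=.
- exact: measurableU.
- have h : (mu (B1 `|` B2) <= mu B1 + mu B2)%E by exact: measureU2.
  apply: (le_trans h).
  apply: (le_trans (leeD B1e B2e)); rewrite -EFinD lee_fin.
  have -> : 4 ^- n = 2 ^- n * 2 ^- n :> R.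
    by rewrite -invfM -expr2 -exprM mulnC exprM; congr (_ ^- _); rewrite expr2; ring.
  rewrite le_eqVlt; apply/orP; left; apply/eqP; field.
  by rewrite expf_neq0.
- by apply: negligibleU; [apply: countable_negligible; exact: countable_setU|exact: negligibleU].
move=> x xab /not_orP[nB1 nB2] /not_orP[/not_orP[nE1 nE2] /not_orP[nZ1x nZ2x]].
exists u, v; split => //.
- by move=> phi tphi; split; [exact: uZ|exact: vZ].
- by move=> phi tphi; split; [exact: uE|exact: vE].
split => // r r01; split; rewrite leNgt; apply/negP => h.
  by apply: nB1; exact: HB1 r01 h.
by apply: nB2; exact: HB2 r01 h.
Qed.

Lemma ae_point_value : {ae mu, forall x, x \in `[a, b] ->
  exists2 gam : R, point_value (dderiv F) x gam & f x = gam%:E}.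
Proof.
have [BE HBE] := choice exceptional_set.
pose B n := (BE n).1; pose E n := (BE n).2.
(* Borel-Cantelli: the measures [20 * 2^-n] add up to 40, so almost every point is eventually
   outside of the sets [B n]. *)
have nB : mu (lim_sup_set B) = 0.
  apply: lim_sup_set_cvg0; first by move=> n; have [] := HBE n.
  apply: (@le_lt_trans _ _ 40%:E); last exact: ltry.
  apply: lime_le; first by apply: is_cvg_nneseries => n _ _; exact: measure_ge0.
  apply: nearW => N; apply: (@le_trans _ _ (\sum_(0 <= n < N) (20 * 2 ^- n)%:E)%E).
    by apply: lee_sum => n _; have [] := HBE n.
  rewrite sumEFin lee_fin big_mkord.
  have -> : \sum_(n < N) (20 * 2 ^- n) = 40 - 40 * 2 ^- N :> R.
    elim: N => [|N IH]; first by rewrite big_ord0 expr0 invr1 mulr1 subrr.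
    by rewrite big_ord_recr IH /= exprS; field; rewrite expf_neq0.
  by rewrite gerBl mulr_ge0// invr_ge0 exprn_ge0.
have nE : mu.-negligible (\bigcup_n E n) by apply: negligible_bigcup => n; have [] := HBE n.
have mB : measurable (lim_sup_set B).
  apply: bigcap_measurable => // k _; apply: bigcup_measurable => j /= _.
  by have [] := HBE j.
have nB' : mu.-negligible (lim_sup_set B).
  by exists (lim_sup_set B); split; [exact: mB|exact: nB|move=> z].
have nBE := negligibleU nB' nE.
apply: (negligibleS _ nBE) => x /= /not_implyP[xab Hx]; apply: contrapT => /not_orP[nBx nEx].
apply: Hx.
have [N HN] : exists N, forall n, (N <= n)%N -> ~ B n x.
  move: nBx; rewrite /lim_sup_set/= => /existsNP[N] /not_implyP[_ HN].
  by exists N => n Nn Bx; apply: HN; exists n.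
have HG n : (N <= n)%N -> sandwiched (dderiv F) n x.
  move=> Nn; have [_ _ _ H] := HBE n; apply: H => //; first exact: HN.
  by move=> Ex; apply: nEx; exists n.
have [gam fx] := finite_value HG.
by exists gam => //; exact: (sandwiched_point_value HG fx).
Qed.

Lemma point_value_outside x : x \notin `[a, b] -> point_value (dderiv F) x 0.
Proof.
rewrite in_itv/= => xab.
have [d d0 Hd] : exists2 d : R, 0 < d & forall y, `|y - x| <= 2 * d -> ~ (a <= y <= b).
  have [xa|xa] := ltP x a.
    exists ((a - x) / 4) => [|y]; first by rewrite divr_gt0// subr_gt0.
    by rewrite ler_norml; lra.
  have [xb|xb] := ltP b x; last by rewrite xa xb in xab.
  exists ((x - b) / 4) => [|y]; first by rewrite divr_gt0// subr_gt0.
  by rewrite ler_norml; lra.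
apply: (point_value_near d0 _ (point_value0 x)) => psi tp px.
rewrite /= mul0r; have := supported_out (indefinite_supported hab hf hF) tp; apply.
exists d => // y yab; apply/eqP; apply: contraT => /px yx; exfalso.
have [ya|ya] := ltP y a.
  by apply: (Hd a); [move: yx; rewrite !ler_norml; lra|rewrite lexx].
have [yb|yb] := ltP b y; last by apply: (Hd y); [lra|rewrite ya].
by apply: (Hd b); [move: yx; rewrite !ler_norml; lra|rewrite hab lexx].
Qed.

End point_values.

Theorem theorem5p3 (R : realType) (a b : R) (hab : a <= b) (f : R -> \bar R)
  (hf : dist_integrable a b f) (F : sdistr R)
  (hF : lojasiewicz_assoc (indefinite_integral a b f) F) :
  {ae (@lebesgue_measure R),
     forall x, exists gamma : R, point_value (dderiv F) x gamma} /\
  {ae (@lebesgue_measure R), forall x, x \in `[a, b] ->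
     exists2 gamma : R, point_value (dderiv F) x gamma & f x = gamma%:E}.
Proof.
have H := ae_point_value hab hf hF; split => //.
apply: (@filterS _ _ (ae_filter_ringOfSetsType (@lebesgue_measure R)) _ _ _ H) => x Hx.
have [/Hx[gam Hg _]|xab] := boolP (x \in `[a, b]); first by exists gam.
by exists 0; exact: (point_value_outside hab hf hF xab).
Qed.
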